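(* Let $n\ge0$ and let $M$ be a complete metric space. The following are equivalent: (i) $M\in\mathrm{FAP}(n)$; (ii) for every simplicial map $p\colon K\to L$ between finite simplicial complexes with $\dim p\le n$, the set $\mathcal R_n^p(L,M)=\{g\in C(K,M):\dim g(p^{-1}(y))\le n\ \forall y\in L\}$ is homotopically dense in $C(K,M)$, i.e. for every $g\in C(K,M)$ and every $\epsilon>0$ there is $g'\in\mathcal R_n^p(L,M)$ which is $\epsilon$-homotopic to $g$.
   Context: $\mathbb I=[0,1]$; $\dim p=\sup_y\dim p^{-1}(y)$. A metric space $M$ has $\mathrm{FAP}(n)$ if for every $\epsilon>0$, every $m\ge0$ and every map $g\colon\mathbb I^m\times\mathbb I^n\to M$ there is a map $g'\colon\mathbb I^m\times\mathbb I^n\to M$ that is $\epsilon$-homotopic to $g$ and satisfies $\dim g'(\{z\}\times\mathbb I^n)\le n$ for all $z\in\mathbb I^m$. Maps $g,g'$ are $\epsilon$-homotopic if there is a homotopy $h$ from $g$ to $g'$ with $\operatorname{diam}h(\{x\}\times\mathbb I)<\epsilon$ for every $x$. *)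

(* Defs.v *)
From Stdlib Require Import Reals List Lra.
Open Scope R_scope.

Definition is_metric {X : Type} (d : X -> X -> R) : Prop :=
  (forall x y, 0 <= d x y) /\ (forall x y, d x y = 0 <-> x = y) /\
  (forall x y, d x y = d y x) /\ (forall x y z, d x z <= d x y + d y z).

Definition complete {X : Type} (d : X -> X -> R) : Prop :=
  forall u : nat -> X,
    (forall e, 0 < e -> exists N, forall p q, (N <= p)%nat -> (N <= q)%nat -> d (u p) (u q) < e) ->
    exists l, forall e, 0 < e -> exists N, forall p, (N <= p)%nat -> d (u p) l < e.

Definition is_open {X : Type} (d : X -> X -> R) (U : X -> Prop) : Prop :=
  forall x, U x -> exists r, 0 < r /\ forall y, d x y < r -> U y.

Definition dim_le {X : Type} (d : X -> X -> R) (A : X -> Prop) (n : nat) : Prop :=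
  forall (k : nat) (U : nat -> X -> Prop),
    (forall i, (i < k)%nat -> is_open d (U i)) ->
    (forall x, A x -> exists i, (i < k)%nat /\ U i x) ->
    exists (m : nat) (V : nat -> X -> Prop),
      (forall j, (j < m)%nat -> is_open d (V j)) /\
      (forall x, A x -> exists j, (j < m)%nat /\ V j x) /\
      (forall j, (j < m)%nat -> exists i, (i < k)%nat /\ forall x, A x -> V j x -> U i x) /\
      (forall x, A x -> forall J : list nat, NoDup J ->
         (forall j, In j J -> (j < m)%nat /\ V j x) -> (length J <= S n)%nat).

Definition cont_on {X Y : Type} (dX : X -> X -> R) (dY : Y -> Y -> R)
  (D : X -> Prop) (g : X -> Y) : Prop :=
  forall x, D x -> forall e, 0 < e -> exists delta, 0 < delta /\
    forall y, D y -> dX x y < delta -> dY (g x) (g y) < e.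

Definition unit_I (s : R) : Prop := 0 <= s <= 1.

Definition eps_homotopic {X Y : Type} (dX : X -> X -> R) (dY : Y -> Y -> R)
  (D : X -> Prop) (eps : R) (g g' : X -> Y) : Prop :=
  exists h : X -> R -> Y,
    (forall x s, D x -> unit_I s -> forall e, 0 < e -> exists delta, 0 < delta /\
       forall y t, D y -> unit_I t -> dX x y < delta -> Rabs (s - t) < delta ->
         dY (h x s) (h y t) < e) /\
    (forall x, D x -> h x 0 = g x /\ h x 1 = g' x) /\
    (forall x, D x -> exists delta, delta < eps /\
       forall s t, unit_I s -> unit_I t -> dY (h x s) (h x t) <= delta).

Fixpoint sumN (k : nat) (f : nat -> R) : R :=
  match k with O => 0 | S k' => sumN k' f + f k' end.

Definition dist_fin (k : nat) (x y : nat -> R) : R := sumN k (fun i => Rabs (x i - y i)).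

Definition cube (m : nat) (z : nat -> R) : Prop :=
  (forall i, (i < m)%nat -> unit_I (z i)) /\ (forall i, (m <= i)%nat -> z i = 0).

Definition dist_pair (m n : nat) (p q : (nat -> R) * (nat -> R)) : R :=
  dist_fin m (fst p) (fst q) + dist_fin n (snd p) (snd q).

Definition cube_pair (m n : nat) (p : (nat -> R) * (nat -> R)) : Prop :=
  cube m (fst p) /\ cube n (snd p).

Definition FAP {M : Type} (dM : M -> M -> R) (n : nat) : Prop :=
  forall (eps : R) (m : nat) (g : (nat -> R) * (nat -> R) -> M),
    0 < eps -> cont_on (dist_pair m n) dM (cube_pair m n) g ->
    exists g' : (nat -> R) * (nat -> R) -> M,
      cont_on (dist_pair m n) dM (cube_pair m n) g' /\
      eps_homotopic (dist_pair m n) dM (cube_pair m n) eps g g' /\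
      (forall z, cube m z ->
         dim_le dM (fun w => exists x, cube n x /\ w = g' (z, x)) n).

(* A finite (abstract) simplicial complex on vertices 0..nv-1: a list of
   simplices (nonempty vertex lists), closed under nonempty faces. *)
Definition is_complex (nv : nat) (S : list (list nat)) : Prop :=
  (forall s, In s S -> s <> nil /\ forall i, In i s -> (i < nv)%nat) /\
  (forall i, (i < nv)%nat -> In (i :: nil) S) /\
  (forall s, In s S -> forall t, t <> nil -> incl t s ->
     exists u, In u S /\ forall i, In i u <-> In i t).

(* points of the geometric realization |K| in R^nv (barycentric coordinates) *)
Definition realiz (nv : nat) (S : list (list nat)) (t : nat -> R) : Prop :=
  (forall i, 0 <= t i) /\
  (exists s, In s S /\ forall i, t i <> 0 -> In i s) /\
  sumN nv t = 1.

Definition is_simplicial (nK : nat) (SK : list (list nat)) (nL : nat) (SL : list (list nat))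
  (f : nat -> nat) : Prop :=
  (forall i, (i < nK)%nat -> (f i < nL)%nat) /\
  (forall s, In s SK -> exists u, In u SL /\ forall j, In j u <-> In j (map f s)).

Definition simp_real (nK : nat) (f : nat -> nat) (t : nat -> R) : nat -> R :=
  fun j => sumN nK (fun i => if Nat.eq_dec (f i) j then t i else 0).

Definition fiber (nK : nat) (SK : list (list nat)) (f : nat -> nat) (y : nat -> R)
  (t : nat -> R) : Prop :=
  realiz nK SK t /\ forall j, simp_real nK f t j = y j.

Definition dim_map_le (nK : nat) (SK : list (list nat)) (nL : nat) (SL : list (list nat))
  (f : nat -> nat) (n : nat) : Prop :=
  forall y, realiz nL SL y -> dim_le (dist_fin nK) (fiber nK SK f y) n.

Definition in_Rnp {M : Type} (dM : M -> M -> R) (n : nat)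
  (nK : nat) (SK : list (list nat)) (nL : nat) (SL : list (list nat))
  (f : nat -> nat) (g : (nat -> R) -> M) : Prop :=
  cont_on (dist_fin nK) dM (realiz nK SK) g /\
  forall y, realiz nL SL y ->
    dim_le dM (fun w => exists t, fiber nK SK f y t /\ w = g t) n.

(* Main.v *)
Require Import Defs.
From Stdlib Require Import Reals List Arith ZArith Lra Lia.
From Stdlib Require Import Classical ClassicalEpsilon FunctionalExtensionality.
Open Scope R_scope.

(** (ii) => (i): collapsing n+1 vertices of an (n+m)-simplex to one point gives a simplicial map
    onto an m-simplex with fibers of dimension n, and I^m x I^n is a retract of the (n+m)-simplex
    by an embedding that sends every slice {z} x I^n into one fiber.

    (i) => (ii): in a simplex s of K choose one vertex over each vertex of p(s). The barycentric
    coordinates of the other vertices, together with p, embed s into I^m x I^n as a retract, slices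
    corresponding to fibers; there are at most n of them because the fiber over the image of the
    barycenter contains a cube with that many sides (Lebesgue's covering theorem, obtained here
    from a discrete Poincaré–Miranda theorem). Hence FAP(n) makes a map fiberwise n-dimensional
    on s, and the small homotopy extends to K. Having fiberwise covers of order n+1 and mesh
    < 1/k on s is an open condition, so an infinite concatenation of shrinking homotopies, which
    converges by completeness, achieves it for all simplices and all k; the finite sum theorem
    for covering dimension concludes. *)

(** M has no extension property, so maps into M arise only from given ones by precomposition,
    pasting and uniform limits. This is why retractions are needed in both directions: a map on a
    cube or a simplex is composed with the retraction, the hypothesis is applied on the larger
    space, and restricting the homotopy along the embedding makes it start at the original map. An
    embedding alone would not suffice.

    The hypothesis [dim_map_le] is topological, whereas the construction needs a count of vertices:
    a simplex must have at most n fiber directions to fit into I^m x I^n. The hypothesis on p enters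
    through this count, and it is what requires a lower bound for covering dimension. *)

Lemma fun_choice {A B : Type} (P : A -> B -> Prop) :
  (forall x, exists y, P x y) -> exists f : A -> B, forall x, P x (f x).
Proof.
  intros H. exists (fun x => proj1_sig (constructive_indefinite_description _ (H x))).
  intros x. apply proj2_sig.
Qed.

(** * Finite sums *)

Lemma sumN_ext k F G : (forall i, (i < k)%nat -> F i = G i) -> sumN k F = sumN k G.
Proof.
  induction k as [|k IH]; intros H; simpl; [easy|].
  rewrite IH, H; auto with arith.
Qed.

Lemma sumN_le k F G : (forall i, (i < k)%nat -> F i <= G i) -> sumN k F <= sumN k G.
Proof.
  induction k as [|k IH]; intros H; simpl; [lra|].
  apply Rplus_le_compat; auto with arith.
Qed.

Lemma sumN_plus k F G : sumN k (fun i => F i + G i) = sumN k F + sumN k G.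
Proof. induction k as [|k IH]; simpl; [|rewrite IH]; lra. Qed.

Lemma sumN_minus k F G : sumN k (fun i => F i - G i) = sumN k F - sumN k G.
Proof. induction k as [|k IH]; simpl; [|rewrite IH]; lra. Qed.

Lemma sumN_scal k c F : sumN k (fun i => c * F i) = c * sumN k F.
Proof. induction k as [|k IH]; simpl; [|rewrite IH]; lra. Qed.

Lemma sumN_const k c : sumN k (fun _ => c) = INR k * c.
Proof. induction k as [|k IH]; [simpl; lra|]. rewrite S_INR. simpl. rewrite IH. lra. Qed.

Lemma sumN_nonneg k F : (forall i, (i < k)%nat -> 0 <= F i) -> 0 <= sumN k F.
Proof.
  intros H. replace 0 with (sumN k (fun _ => 0)) by (rewrite sumN_const; lra).
  now apply sumN_le.
Qed.

Lemma sumN_zero k F : (forall i, (i < k)%nat -> F i = 0) -> sumN k F = 0.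
Proof. intros H. rewrite (sumN_ext k F (fun _ => 0)), sumN_const; auto; lra. Qed.

Lemma sumN_single k F v : (v < k)%nat -> (forall i, (i < k)%nat -> i <> v -> F i = 0) ->
  sumN k F = F v.
Proof.
  induction k as [|k IH]; intros Hv H; [lia|]. simpl.
  destruct (Nat.eq_dec v k) as [->|Hne].
  - rewrite sumN_zero; [lra|]. intros i Hi. apply H; lia.
  - rewrite IH, (H k); auto with arith; try lia. lra.
Qed.

Lemma sumN_term_le k F v : (v < k)%nat -> (forall i, (i < k)%nat -> 0 <= F i) -> F v <= sumN k F.
Proof.
  induction k as [|k IH]; intros Hv H; [lia|]. simpl.
  destruct (Nat.eq_dec v k) as [->|Hne].
  - assert (0 <= sumN k F) by (apply sumN_nonneg; auto with arith). lra.
  - assert (F v <= sumN k F) by (apply IH; auto with arith; lia).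
    assert (0 <= F k) by auto with arith. lra.
Qed.

Lemma sumN_abs k F : Rabs (sumN k F) <= sumN k (fun i => Rabs (F i)).
Proof.
  induction k as [|k IH]; simpl; [rewrite Rabs_R0; lra|].
  pose proof (Rabs_triang (sumN k F) (F k)). lra.
Qed.

Lemma sumN_first k F : sumN (S k) F = F O + sumN k (fun i => F (S i)).
Proof. induction k as [|k IH]; [simpl; lra|]. simpl in *. lra. Qed.

Lemma sumN_swap k l (F : nat -> nat -> R) :
  sumN k (fun i => sumN l (fun j => F i j)) = sumN l (fun j => sumN k (fun i => F i j)).
Proof.
  induction k as [|k IH]; simpl.
  - symmetry. now apply sumN_zero.
  - rewrite IH. now rewrite <- sumN_plus.
Qed.

(** * Pseudometrics *)

Definition pmetric {X : Type} (d : X -> X -> R) : Prop :=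
  (forall x, d x x = 0) /\ (forall x y, d x y = d y x) /\
  (forall x y z, d x z <= d x y + d y z).

Lemma is_metric_pmetric {X : Type} (d : X -> X -> R) : is_metric d -> pmetric d.
Proof.
  intros (_ & H0 & Hs & Ht). repeat split; auto. intros x. now apply H0.
Qed.

Lemma pmetric_nonneg {X : Type} (d : X -> X -> R) : pmetric d -> forall x y, 0 <= d x y.
Proof.
  intros (H0 & Hs & Ht) x y. pose proof (Ht x y x) as H. rewrite H0, (Hs y x) in H. lra.
Qed.

(** Coordinates from k on are ignored although points are functions on all of [nat], so this is no
    metric. The topology below is therefore developed for [pmetric]. *)
Lemma dist_fin_pmetric k : pmetric (dist_fin k).
Proof.
  unfold dist_fin. repeat split.
  - intros x. apply sumN_zero. intros i _. now rewrite Rminus_diag, Rabs_R0.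
  - intros x y. apply sumN_ext. intros i _. apply Rabs_minus_sym.
  - intros x y z. rewrite <- sumN_plus. apply sumN_le. intros i _.
    replace (x i - z i) with ((x i - y i) + (y i - z i)) by lra. apply Rabs_triang.
Qed.

Lemma dist_fin_coord k x y i : (i < k)%nat -> Rabs (x i - y i) <= dist_fin k x y.
Proof.
  intros Hi. apply (sumN_term_le k (fun i => Rabs (x i - y i))); [easy|].
  intros. apply Rabs_pos.
Qed.

Definition dist_prod {X Y : Type} (dX : X -> X -> R) (dY : Y -> Y -> R) (p q : X * Y) : R :=
  dX (fst p) (fst q) + dY (snd p) (snd q).

Lemma dist_prod_pmetric {X Y : Type} (dX : X -> X -> R) (dY : Y -> Y -> R) :
  pmetric dX -> pmetric dY -> pmetric (dist_prod dX dY).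
Proof.
  intros (X0 & Xs & Xt) (Y0 & Ys & Yt). unfold dist_prod. repeat split.
  - intros x. rewrite X0, Y0. lra.
  - intros x y. now rewrite Xs, Ys.
  - intros x y z. specialize (Xt (fst x) (fst y) (fst z)).
    specialize (Yt (snd x) (snd y) (snd z)). lra.
Qed.

Lemma R_dist_pmetric : pmetric R_dist.
Proof.
  repeat split; [exact R_dist_eq|exact R_dist_sym|].
  intros x y z. apply R_dist_tri.
Qed.

(** * Sequential compactness *)

Definition seq_compact {X : Type} (d : X -> X -> R) (A : X -> Prop) : Prop :=
  forall u : nat -> X, (forall k, A (u k)) ->
    exists x, A x /\ forall e N, 0 < e -> exists k, (N <= k)%nat /\ d (u k) x < e.

Lemma inv_INR_small e : 0 < e -> exists N, forall k, (N <= k)%nat -> / INR (S k) < e.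
Proof.
  intros He. destruct (archimed_cor1 e He) as (N & HN & HN0). exists N. intros k Hk.
  apply Rle_lt_trans with (2 := HN). apply Rinv_le_contravar; [now apply lt_0_INR|].
  apply le_INR. lia.
Qed.

Lemma inv_INR_pos k : 0 < / INR (S k).
Proof. apply Rinv_0_lt_compat, lt_0_INR. lia. Qed.

(* A property that fails for every tolerance fails along a sequence with tolerances 1/(k+1),
   hence near a cluster point. *)
Lemma compact_tolerance {X : Type} (d : X -> X -> R) (A : X -> Prop) (P : X -> R -> Prop) :
  seq_compact d A ->
  (forall x, A x -> exists r, 0 < r /\ forall y e, A y -> d y x < r -> 0 < e -> e < r -> P y e) ->
  exists e, 0 < e /\ forall x, A x -> P x e.
Proof.
  intros HA Hloc. apply NNPP. intros Hn.
  assert (H : forall k, exists x, A x /\ ~ P x (/ INR (S k))).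
  { intros k. apply NNPP. intros Hk. apply Hn. exists (/ INR (S k)).
    split; [apply inv_INR_pos|]. intros x Hx. apply NNPP. intros HP. apply Hk. eauto. }
  apply fun_choice in H. destruct H as (u & Hu).
  destruct (HA u (fun k => proj1 (Hu k))) as (x & Hx & Hcl).
  destruct (Hloc x Hx) as (r & Hr & HP).
  destruct (inv_INR_small r Hr) as (N & HN).
  destruct (Hcl r N Hr) as (k & Hk & Hd).
  apply (proj2 (Hu k)). apply HP; [apply Hu|easy|apply inv_INR_pos|auto].
Qed.

Lemma compact_uniform_continuity {X Y : Type} (dX : X -> X -> R) (dY : Y -> Y -> R) (A : X -> Prop)
  (g : X -> Y) :
  pmetric dX -> pmetric dY -> seq_compact dX A -> cont_on dX dY A g ->
  forall e, 0 < e -> exists delta, 0 < delta /\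
    forall x y, A x -> A y -> dX x y < delta -> dY (g x) (g y) < e.
Proof.
  intros HX HY HA Hg e He.
  destruct (compact_tolerance dX A
    (fun x r => forall y, A y -> dX x y < r -> dY (g x) (g y) < e) HA) as (r & Hr & H).
  - intros x Hx. destruct (Hg x Hx (e / 2)) as (r & Hr & H); [lra|].
    exists (r / 2). split; [lra|]. intros y r' Hy Hyx _ Hr' z Hz Hyz.
    destruct HX as (_ & Xs & Xt), HY as (_ & Ys & Yt).
    assert (H1 : dY (g x) (g y) < e / 2) by (apply H; auto; rewrite Xs; lra).
    assert (H2 : dY (g x) (g z) < e / 2).
    { apply H; auto. specialize (Xt x y z). rewrite (Xs x y) in Xt. lra. }
    specialize (Yt (g y) (g x) (g z)). rewrite (Ys (g y) (g x)) in Yt. lra.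
  - exists r. split; auto.
Qed.

Lemma lebesgue_number {X I : Type} (d : X -> X -> R) (A : X -> Prop) (U : I -> X -> Prop)
  (J : I -> Prop) :
  pmetric d -> seq_compact d A -> (forall i, J i -> is_open d (U i)) ->
  (forall x, A x -> exists i, J i /\ U i x) ->
  exists l, 0 < l /\ forall x, A x -> exists i, J i /\ forall y, d x y < l -> U i y.
Proof.
  intros Hd HA HU Hc.
  apply (compact_tolerance d A (fun x l => exists i, J i /\ forall y, d x y < l -> U i y) HA).
  intros x Hx. destruct (Hc x Hx) as (i & Hi & HUx).
  destruct (HU i Hi x HUx) as (r & Hr & H). exists (r / 2). split; [lra|].
  intros y e _ Hyx _ He. exists i. split; [easy|]. intros z Hz. apply H.
  destruct Hd as (_ & Xs & Xt). specialize (Xt x y z). rewrite (Xs x y) in Xt. lra.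
Qed.

Lemma seq_compact_image {X Y : Type} (dX : X -> X -> R) (dY : Y -> Y -> R) (A : X -> Prop)
  (g : X -> Y) :
  pmetric dX -> pmetric dY -> seq_compact dX A -> cont_on dX dY A g ->
  seq_compact dY (fun w => exists x, A x /\ w = g x).
Proof.
  intros HX HY HA Hg u Hu. apply fun_choice in Hu. destruct Hu as (v & Hv).
  destruct (HA v (fun k => proj1 (Hv k))) as (x & Hx & Hcl). exists (g x). split; [eauto|].
  intros e N He. destruct (Hg x Hx e He) as (r & Hr & H).
  destruct (Hcl r N Hr) as (k & Hk & Hd). exists k. split; [easy|].
  rewrite (proj2 (Hv k)), (proj1 (proj2 HY)). apply H; [apply Hv|].
  now rewrite (proj1 (proj2 HX)).
Qed.

Lemma seq_compact_closed {X : Type} (d : X -> X -> R) (A : X -> Prop) :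
  is_metric d -> seq_compact d A -> is_open d (fun x => ~ A x).
Proof.
  intros Hm HA x Hx. apply NNPP. intros Hn.
  assert (H : forall k, exists y, A y /\ d x y < / INR (S k)).
  { intros k. apply NNPP. intros Hk. apply Hn. exists (/ INR (S k)).
    split; [apply inv_INR_pos|]. intros y Hy HAy. apply Hk. eauto. }
  apply fun_choice in H. destruct H as (u & Hu).
  destruct (HA u (fun k => proj1 (Hu k))) as (a & Ha & Hcl).
  destruct Hm as (H0 & He & Hs & Ht).
  destruct (Req_dec (d x a) 0) as [E|E].
  - apply He in E. now subst.
  - assert (Hp : 0 < d x a) by (specialize (H0 x a); lra).
    destruct (inv_INR_small (d x a / 2)) as (N & HN); [lra|].
    destruct (Hcl (d x a / 2) N) as (k & Hk & Hd); [lra|].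
    specialize (HN k Hk). pose proof (proj2 (Hu k)). specialize (Ht x (u k) a). lra.
Qed.

Lemma finite_net {X : Type} (d : X -> X -> R) (A : X -> Prop) e :
  pmetric d -> seq_compact d A -> 0 < e ->
  exists l : list X, (forall x, In x l -> A x) /\
    forall x, A x -> exists y, In y l /\ d y x < e.
Proof.
  intros Hd HA He. apply NNPP. intros Hn.
  (* otherwise an infinite e-separated sequence exists *)
  assert (Hs : forall l : list X, exists x, (forall y, In y l -> A y) -> A x /\
                 forall y, In y l -> e <= d y x).
  { intros l. destruct (classic (forall y, In y l -> A y)) as [Hl|Hl].
    - apply NNPP. intros Hx. apply Hn. exists l. split; [easy|]. intros x Ax.
      apply NNPP. intros Hy. apply Hx. exists x. intros _. split; [easy|].
      intros y Hin. apply Rnot_lt_le. intros Hlt. apply Hy. eauto.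
    - destruct l as [|a l]; [exfalso; apply Hl; easy|]. exists a. now intros. }
  apply fun_choice in Hs. destruct Hs as (nx & Hnx).
  pose (L := fix L k := match k with O => nil | S k' => nx (L k') :: L k' end).
  assert (HL : forall k y, In y (L k) -> A y).
  { induction k as [|k IH]; simpl; [easy|]. intros y [<-|Hy]; auto. now apply Hnx. }
  destruct (HA (fun k => nx (L k))) as (x & Hx & Hcl).
  { intros k. apply Hnx, HL. }
  assert (Hin : forall k j, (j < k)%nat -> In (nx (L j)) (L k)).
  { induction k as [|k IH]; intros j Hj; [lia|]. simpl.
    destruct (Nat.eq_dec j k) as [->|]; [now left|]. right. apply IH. lia. }
  destruct (Hcl (e / 2) O) as (i & _ & Hi); [lra|].
  destruct (Hcl (e / 2) (S i)) as (j & Hj & Hdj); [lra|].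
  assert (H : e <= d (nx (L i)) (nx (L j))).
  { apply Hnx; [apply HL|]. apply Hin. lia. }
  destruct Hd as (_ & Ds & Dt). specialize (Dt (nx (L i)) x (nx (L j))).
  rewrite (Ds x) in Dt. lra.
Qed.

Lemma cluster_subsequence {X : Type} (d : X -> X -> R) (u : nat -> X) x :
  (forall e N, 0 < e -> exists k, (N <= k)%nat /\ d (u k) x < e) ->
  exists phi : nat -> nat, (forall k, (phi k < phi (S k))%nat) /\
    forall k, d (u (phi k)) x < / INR (S k).
Proof.
  intros Hcl.
  assert (H : forall kN : nat * nat, exists j, (snd kN <= j)%nat /\ d (u j) x < / INR (S (fst kN))).
  { intros kN. apply Hcl, inv_INR_pos. }
  apply fun_choice in H. destruct H as (pk & Hpk).
  pose (phi := fix phi k := match k with O => pk (O, O) | S k' => pk (k, S (phi k')) end).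
  exists phi. split.
  - intros k. apply (proj1 (Hpk (S k, S (phi k)))).
  - intros [|k]; [apply (proj2 (Hpk (O, O)))|apply (proj2 (Hpk (S k, S (phi k))))].
Qed.

Lemma increasing_ge (phi : nat -> nat) : (forall k, (phi k < phi (S k))%nat) ->
  forall k, (k <= phi k)%nat.
Proof. intros H k. induction k as [|k IH]; [lia|]. specialize (H k). lia. Qed.

Lemma seq_compact_prod {X Y : Type} (dX : X -> X -> R) (dY : Y -> Y -> R)
  (A : X -> Prop) (B : Y -> Prop) :
  seq_compact dX A -> seq_compact dY B ->
  seq_compact (dist_prod dX dY) (fun p => A (fst p) /\ B (snd p)).
Proof.
  intros HA HB u Hu.
  destruct (HA (fun k => fst (u k)) (fun k => proj1 (Hu k))) as (x & Hx & Hcx).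
  apply cluster_subsequence in Hcx. destruct Hcx as (phi & Hphi & Hcx).
  destruct (HB (fun k => snd (u (phi k))) (fun k => proj2 (Hu (phi k)))) as (y & Hy & Hcy).
  exists (x, y). split; [easy|]. intros e N He.
  destruct (inv_INR_small (e / 2)) as (N1 & HN1); [lra|].
  destruct (Hcy (e / 2) (Nat.max N N1)) as (k & Hk & Hd); [lra|].
  exists (phi k). pose proof (increasing_ge phi Hphi k). split; [lia|].
  unfold dist_prod; simpl. specialize (Hcx k). specialize (HN1 k ltac:(lia)). lra.
Qed.

Lemma seq_compact_unit_I : seq_compact R_dist unit_I.
Proof.
  intros u Hu. destruct (Bolzano_Weierstrass u unit_I (compact_P3 0 1) Hu) as (l & Hl).
  assert (Hcl : forall e N, 0 < e -> exists k, (N <= k)%nat /\ R_dist (u k) l < e).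
  { intros e N He. destruct (Hl (disc l (mkposreal e He)) N) as (k & Hk & Hd); [|eauto].
    exists (mkposreal e He). now intros y Hy. }
  exists l. split; [|easy].
  assert (forall e, 0 < e -> - e <= l <= 1 + e).
  { intros e He. destruct (Hcl e O He) as (k & _ & Hd). unfold R_dist in Hd.
    apply Rabs_def2 in Hd. destruct (Hu k). lra. }
  split; apply Rnot_lt_le; intros Hlt.
  - specialize (H (- l / 2)). lra.
  - specialize (H ((l - 1) / 2)). lra.
Qed.

Lemma coordinatewise_subsequence K (u : nat -> nat -> R) :
  (forall k i, (i < K)%nat -> unit_I (u k i)) ->
  exists (phi : nat -> nat) (x : nat -> R), (forall k, (phi k < phi (S k))%nat) /\
    forall i, (i < K)%nat -> forall e, 0 < e ->
      exists N, forall k, (N <= k)%nat -> Rabs (u (phi k) i - x i) < e.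
Proof.
  induction K as [|K IH]; intros Hu.
  - exists (fun k => k), (fun _ => 0). split; intros; lia.
  - destruct IH as (phi & x & Hphi & Hx); [auto with arith|].
    destruct (seq_compact_unit_I (fun k => u (phi k) K)) as (y & _ & Hcl); [auto|].
    apply cluster_subsequence in Hcl. destruct Hcl as (psi & Hpsi & Hcl).
    exists (fun k => phi (psi k)), (fun i => if Nat.eq_dec i K then y else x i). split.
    + assert (Hmono : forall a b, (a < b)%nat -> (phi a < phi b)%nat).
      { intros a b Hab. induction Hab; [apply Hphi|]. specialize (Hphi m). lia. }
      intros k. apply Hmono, Hpsi.
    + intros i Hi e He. destruct (Nat.eq_dec i K) as [->|Hne].
      * destruct (inv_INR_small e He) as (N & HN). exists N. intros k Hk.
        specialize (Hcl k). specialize (HN k Hk). unfold R_dist in Hcl. lra.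
      * destruct (Hx i ltac:(lia) e He) as (N & HN). exists N. intros k Hk. apply HN.
        pose proof (increasing_ge psi Hpsi k). lia.
Qed.

Lemma dist_fin_small K (x : nat -> nat -> R) y :
  (forall i, (i < K)%nat -> forall e, 0 < e ->
     exists N, forall k, (N <= k)%nat -> Rabs (x k i - y i) < e) ->
  forall e, 0 < e -> exists N, forall k, (N <= k)%nat -> dist_fin K (x k) y < e.
Proof.
  unfold dist_fin. induction K as [|K IH]; intros H e He.
  - exists O. now intros.
  - destruct (IH (fun i Hi => H i (Nat.lt_lt_succ_r _ _ Hi)) (e / 2)) as (N1 & H1); [lra|].
    destruct (H K (Nat.lt_succ_diag_r K) (e / 2)) as (N2 & H2); [lra|].
    exists (Nat.max N1 N2). intros k Hk. simpl.
    specialize (H1 k ltac:(lia)). specialize (H2 k ltac:(lia)). lra.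
Qed.

(* [dist_fin K] ignores the coordinates from K on, hence the closedness of A is only
   required at points vanishing there. *)
Lemma seq_compact_closed_cube K (A : (nat -> R) -> Prop) :
  (forall x, A x -> forall i, (i < K)%nat -> unit_I (x i)) ->
  (forall x, (forall i, (K <= i)%nat -> x i = 0) ->
     (forall e, 0 < e -> exists y, A y /\ dist_fin K x y < e) -> A x) ->
  seq_compact (dist_fin K) A.
Proof.
  intros Hb Hc u Hu.
  destruct (coordinatewise_subsequence K u) as (phi & x & Hphi & Hx); [auto|].
  assert (Hy : forall e, 0 < e -> exists N, forall k, (N <= k)%nat ->
    dist_fin K (u (phi k)) (fun i => if lt_dec i K then x i else 0) < e).
  { apply dist_fin_small. intros i Hi. destruct (lt_dec i K); [auto|lia]. }
  exists (fun i => if lt_dec i K then x i else 0). split.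
  - apply Hc.
    + intros i Hi. destruct (lt_dec i K); [lia|easy].
    + intros e He. destruct (Hy e He) as (N & HN). exists (u (phi N)). split; [apply Hu|].
      rewrite (proj1 (proj2 (dist_fin_pmetric K))). auto.
  - intros e N He. destruct (Hy e He) as (N' & HN). exists (phi (Nat.max N N')).
    pose proof (increasing_ge phi Hphi (Nat.max N N')). split; [lia|]. apply HN. lia.
Qed.

(** * Covering dimension of compact sets *)

(* Unlike in [dim_le], the order is bounded on the whole space: this makes the property
   stable under perturbation of A. *)
Definition small_cover {X : Type} (d : X -> X -> R) (n : nat) (A : X -> Prop) (delta : R) : Prop :=
  exists (m : nat) (V : nat -> X -> Prop),
    (forall j, (j < m)%nat -> is_open d (V j)) /\
    (forall x, A x -> exists j, (j < m)%nat /\ V j x) /\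
    (forall j, (j < m)%nat -> forall x y, V j x -> V j y -> d x y < delta) /\
    (forall x (J : list nat), NoDup J ->
       (forall j, In j J -> (j < m)%nat /\ V j x) -> (length J <= S n)%nat).

Lemma small_cover_mono {X : Type} (d : X -> X -> R) n (A B : X -> Prop) delta :
  (forall x, B x -> A x) -> small_cover d n A delta -> small_cover d n B delta.
Proof.
  intros HBA (m & V & HV & Hc & H). exists m, V. repeat split; try easy; try apply H. auto.
Qed.

Lemma ball_open {X : Type} (d : X -> X -> R) (x : X) r :
  pmetric d -> is_open d (fun y => d x y < r).
Proof.
  intros (_ & _ & Dt) y Hy. exists (r - d x y). split; [lra|].
  intros z Hz. specialize (Dt x y z). lra.
Qed.

(** A given cover by balls of radius delta / 8 controls the mesh. For the order, suppose w lies in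
    several thickened sets: the point x of A that witnesses one membership is within mu of the
    witnesses of the others, hence lies in all the corresponding V j, and the order bound at x
    passes to w. *)
Lemma dim_le_small_cover {X : Type} (d : X -> X -> R) n (A : X -> Prop) :
  pmetric d -> seq_compact d A -> dim_le d A n ->
  forall delta, 0 < delta -> small_cover d n A delta.
Proof.
  intros Hd HA Hdim delta Hdelta.
  destruct (finite_net d A (delta / 8) Hd HA) as (l & HlA & Hl); [lra|].
  (* [nth] needs a default point of X, so an empty X is treated apart. *)
  assert (Hnx : (exists a : X, True) \/ ~ exists a : X, True) by apply classic.
  destruct Hnx as [[a _]|Hnx].
  2:{ exists O, (fun _ _ => False).
      split; [easy|]. split; [intros x; exfalso; eauto|]. split; [easy|].
      intros x; exfalso; eauto. }
  destruct (Hdim (length l) (fun i y => d (nth i l a) y < delta / 8)) as (m & V & HV & Hc & Href & Hord).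
  { intros i _. now apply ball_open. }
  { intros x Hx. destruct (Hl x Hx) as (y & Hy & Hyx).
    destruct (In_nth l y a Hy) as (i & Hi & <-). eauto. }
  destruct (lebesgue_number d A V (fun j => (j < m)%nat) Hd HA HV Hc) as (lam & Hlam & HL).
  set (mu := Rmin lam (delta / 8)).
  assert (Hmu : 0 < mu <= lam /\ mu <= delta / 8).
  { unfold mu. repeat split; [apply Rmin_glb_lt; lra|apply Rmin_l|apply Rmin_r]. }
  destruct Hd as (D0 & Ds & Dt).
  (* thickening the part of A that lies mu-deep in V j keeps the order *)
  exists m, (fun j w => exists x, A x /\ (forall y, d x y < mu -> V j y) /\ d x w < mu / 2).
  split; [|split; [|split]].
  - intros j Hj w (x & Hx & HV' & Hw). exists (mu / 2 - d x w). split; [lra|].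
    intros y Hy. exists x. repeat split; auto. specialize (Dt x w y). lra.
  - intros x Hx. destruct (HL x Hx) as (j & Hj & HB). exists j. split; [easy|].
    exists x. repeat split; auto; [|rewrite D0; lra]. intros y Hy. apply HB. lra.
  - intros j Hj w w' (x & Hx & HVx & Hw) (x' & Hx' & HVx' & Hw').
    destruct (Href j Hj) as (i & Hi & Hin).
    assert (H1 := Hin x Hx (HVx x ltac:(rewrite D0; lra))).
    assert (H2 := Hin x' Hx' (HVx' x' ltac:(rewrite D0; lra))).
    pose proof (Dt w x w'). pose proof (Dt x x' w').
    pose proof (Dt x (nth i l a) x'). rewrite (Ds w x) in *. rewrite (Ds x (nth i l a)) in *. lra.
  - intros w [|j0 J] HJ HJw; [simpl; lia|].
    destruct (HJw j0 (or_introl eq_refl)) as (_ & x & Hx & HVx & Hw).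
    apply (Hord x Hx); [easy|]. intros j Hj.
    destruct (HJw j Hj) as (Hjm & x' & Hx' & HVx' & Hw'). split; [easy|]. apply HVx'.
    specialize (Dt x' w x). rewrite (Ds w x) in Dt. lra.
Qed.

Lemma small_cover_dim_le {X : Type} (d : X -> X -> R) n (A : X -> Prop) :
  pmetric d -> seq_compact d A -> (forall delta, 0 < delta -> small_cover d n A delta) ->
  dim_le d A n.
Proof.
  intros Hd HA HS k U HU Hc.
  (* A point of A provides an index [i0], to which the members of the new cover that miss A are
     assigned. *)
  destruct (classic (exists a, A a)) as [[a Ha]|Hna].
  2:{ exists O, (fun _ _ => False). repeat split; try easy; intros x Hx; exfalso; eauto. }
  destruct (Hc a Ha) as (i0 & Hi0 & _).
  destruct (lebesgue_number d A U (fun i => (i < k)%nat) Hd HA HU Hc) as (lam & Hlam & HL).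
  destruct (HS lam Hlam) as (m & V & HV & HVc & Hmesh & Hord).
  exists m, V. split; [easy|]. split; [easy|]. split; [|intros x _; apply Hord].
  intros j Hj. destruct (classic (exists x, A x /\ V j x)) as [(x & Hx & HVx)|Hn].
  - destruct (HL x Hx) as (i & Hi & HB). exists i. split; [easy|].
    intros y _ Hy. apply HB. now apply (Hmesh j Hj).
  - exists i0. split; [easy|]. intros x Hx HVx. exfalso. eauto.
Qed.

(** Not formal from [dim_le], since an open cover of B need not cover A. For compact sets the
    description by small covers is monotone. *)
Lemma dim_le_compact_subset {X : Type} (d : X -> X -> R) n (A B : X -> Prop) :
  pmetric d -> seq_compact d A -> seq_compact d B -> (forall x, B x -> A x) ->
  dim_le d A n -> dim_le d B n.
Proof.
  intros Hd HA HB HBA Hdim. apply small_cover_dim_le; auto. intros delta Hdelta.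
  apply small_cover_mono with A; auto. now apply dim_le_small_cover.
Qed.

(* Outside the closed set A the cover U is kept; on A it is replaced by the pieces of a refinement
   of order n+1, collected by index. The result refines U index by index, so iterating over
   several closed sets never increases the order reached before. *)
Lemma precise_refinement {X : Type} (d : X -> X -> R) n (A B : X -> Prop) (k : nat)
  (U : nat -> X -> Prop) :
  is_open d (fun x => ~ A x) -> dim_le d A n -> (forall x, A x -> B x) ->
  (forall i, (i < k)%nat -> is_open d (U i)) ->
  (forall x, B x -> exists i, (i < k)%nat /\ U i x) ->
  exists W : nat -> X -> Prop,
    (forall i, (i < k)%nat -> is_open d (W i)) /\
    (forall x, B x -> exists i, (i < k)%nat /\ W i x) /\
    (forall i x, W i x -> U i x) /\
    (forall x, A x -> forall J : list nat, NoDup J ->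
         (forall j, In j J -> (j < k)%nat /\ W j x) -> (length J <= S n)%nat).
Proof.
  intros HA Hdim HAB HU Hc.
  destruct (Hdim k U HU) as (m & V & HV & HVc & Href & Hord); [auto|].
  assert (H : forall j, exists i, (j < m)%nat -> (i < k)%nat /\ forall x, A x -> V j x -> U i x).
  { intros j. destruct (lt_dec j m) as [Hj|Hj]; [|now exists O].
    destruct (Href j Hj) as (i & Hi). exists i. auto. }
  apply fun_choice in H. destruct H as (c & Hcj).
  exists (fun i x => U i x /\ (~ A x \/ exists j, (j < m)%nat /\ c j = i /\ V j x)).
  split; [|split; [|split]].
  - intros i Hi x (HUx & Hx). destruct (HU i Hi x HUx) as (r1 & Hr1 & H1).
    assert (H2 : exists r2, 0 < r2 /\ forall y, d x y < r2 ->
              ~ A y \/ exists j, (j < m)%nat /\ c j = i /\ V j y).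
    { destruct Hx as [Hx|(j & Hj & Hji & HVx)].
      - destruct (HA x Hx) as (r2 & Hr2 & H2). exists r2. auto.
      - destruct (HV j Hj x HVx) as (r2 & Hr2 & H2). exists r2. split; [easy|]. right. eauto. }
    destruct H2 as (r2 & Hr2 & H2). exists (Rmin r1 r2). split; [now apply Rmin_glb_lt|].
    pose proof (Rmin_l r1 r2). pose proof (Rmin_r r1 r2).
    intros y Hy. split; [apply H1|apply H2]; lra.
  - intros x Hx. destruct (classic (A x)) as [HAx|HAx].
    + destruct (HVc x HAx) as (j & Hj & HVx). destruct (Hcj j Hj) as (Hck & HUj).
      exists (c j). repeat split; auto. right. eauto.
    + destruct (Hc x Hx) as (i & Hi & HUx). exists i. auto.
  - now intros i x [].
  - intros x Hx J HJ HJx.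
    (* Each i in J is witnessed by a piece b i with c (b i) = i. Hence b is injective on J, and the
       order of V at x bounds the length of J. *)
    assert (H : forall i, exists j, In i J -> (j < m)%nat /\ c j = i /\ V j x).
    { intros i. destruct (classic (In i J)) as [Hi|Hi]; [|now exists O].
      destruct (HJx i Hi) as (_ & _ & [Hn|(j & Hj)]); [easy|]. exists j. auto. }
    apply fun_choice in H. destruct H as (b & Hb).
    rewrite <- (length_map b). apply (Hord x Hx).
    + apply NoDup_map_NoDup_ForallPairs; [|easy].
      intros i i' Hi Hi' E. rewrite <- (proj1 (proj2 (Hb i Hi))), E. now apply Hb.
    + intros j Hj. apply in_map_iff in Hj. destruct Hj as (i & <- & Hi).
      split; now apply Hb.
Qed.

Lemma dim_le_finite_union {X I : Type} (d : X -> X -> R) n (P : I -> X -> Prop) (B : X -> Prop)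
  (l : list I) :
  (forall i, In i l -> is_open d (fun x => ~ P i x) /\ dim_le d (P i) n /\
     forall x, P i x -> B x) ->
  (forall x, B x -> exists i, In i l /\ P i x) ->
  dim_le d B n.
Proof.
  intros Hl HB k U HU Hc.
  assert (H : exists W : nat -> X -> Prop,
    (forall i, (i < k)%nat -> is_open d (W i)) /\
    (forall x, B x -> exists i, (i < k)%nat /\ W i x) /\
    (forall i x, W i x -> U i x) /\
    (forall a, In a l -> forall x, P a x -> forall J : list nat, NoDup J ->
         (forall j, In j J -> (j < k)%nat /\ W j x) -> (length J <= S n)%nat)).
  { clear HB. induction l as [|a l IH].
    - exists U. repeat split; auto. intros a [].
    - destruct IH as (W & HW & HWc & HWU & Hord); [intros i Hi; apply Hl; now right|].
      destruct (Hl a (or_introl eq_refl)) as (Ho & Hdim & HPB).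
      destruct (precise_refinement d n (P a) B k W Ho Hdim HPB HW HWc)
        as (W' & HW' & HWc' & HWU' & Hord').
      exists W'. repeat split; auto.
      intros b [<-|Hb] x Hx J HJ HJx; [eauto|].
      apply (Hord b Hb x Hx J HJ). intros j Hj. split; [now apply HJx|].
      apply HWU'. now apply HJx. }
  destruct H as (W & HW & HWc & HWU & Hord). exists k, W. repeat split; auto.
  - intros j Hj. exists j. split; auto.
  - intros x Hx. destruct (HB x Hx) as (i & Hi & HPx). now apply (Hord i).
Qed.

(** * Continuous functions *)

Lemma cont_ext {X Y : Type} (dX : X -> X -> R) (dY : Y -> Y -> R) D (f g : X -> Y) :
  (forall x, D x -> f x = g x) -> cont_on dX dY D f -> cont_on dX dY D g.
Proof.
  intros E H x Hx e He. destruct (H x Hx e He) as (r & Hr & Hf). exists r. split; [easy|].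
  intros y Hy Hxy. rewrite <- !E; auto.
Qed.

Lemma cont_sub {X Y : Type} (dX : X -> X -> R) (dY : Y -> Y -> R) (D E : X -> Prop) (f : X -> Y) :
  (forall x, E x -> D x) -> cont_on dX dY D f -> cont_on dX dY E f.
Proof.
  intros HED H x Hx e He. destruct (H x (HED x Hx) e He) as (r & Hr & Hf). exists r. auto.
Qed.

Lemma cont_comp {X Y Z : Type} (dX : X -> X -> R) (dY : Y -> Y -> R) (dZ : Z -> Z -> R)
  (D : X -> Prop) (E : Y -> Prop) (f : X -> Y) (g : Y -> Z) :
  (forall x, D x -> E (f x)) -> cont_on dX dY D f -> cont_on dY dZ E g ->
  cont_on dX dZ D (fun x => g (f x)).
Proof.
  intros HDE Hf Hg x Hx e He. destruct (Hg (f x) (HDE x Hx) e He) as (r & Hr & H1).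
  destruct (Hf x Hx r Hr) as (r' & Hr' & H2). exists r'. auto.
Qed.

Lemma cont_pair {X Y Z : Type} (dX : X -> X -> R) (dY : Y -> Y -> R) (dZ : Z -> Z -> R)
  (D : X -> Prop) (f : X -> Y) (g : X -> Z) :
  cont_on dX dY D f -> cont_on dX dZ D g ->
  cont_on dX (dist_prod dY dZ) D (fun x => (f x, g x)).
Proof.
  intros Hf Hg x Hx e He. destruct (Hf x Hx (e / 2)) as (r1 & Hr1 & H1); [lra|].
  destruct (Hg x Hx (e / 2)) as (r2 & Hr2 & H2); [lra|].
  exists (Rmin r1 r2). split; [now apply Rmin_glb_lt|]. intros y Hy Hxy.
  pose proof (Rmin_l r1 r2). pose proof (Rmin_r r1 r2).
  specialize (H1 y Hy ltac:(lra)). specialize (H2 y Hy ltac:(lra)).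
  unfold dist_prod; simpl. lra.
Qed.

Lemma cont_lipschitz {X Y : Type} (dX : X -> X -> R) (dY : Y -> Y -> R) (D : X -> Prop)
  (f : X -> Y) : (forall x y, dY (f x) (f y) <= dX x y) -> cont_on dX dY D f.
Proof.
  intros H x _ e He. exists e. split; [easy|]. intros y _ Hxy. specialize (H x y). lra.
Qed.

Lemma cont_id {X : Type} (dX : X -> X -> R) D : cont_on dX dX D (fun x => x).
Proof. apply cont_lipschitz. intros. lra. Qed.

Lemma cont_fst {X Y : Type} (dX : X -> X -> R) (dY : Y -> Y -> R) D :
  pmetric dY -> cont_on (dist_prod dX dY) dX D fst.
Proof.
  intros HY. apply cont_lipschitz. intros x y. unfold dist_prod.
  pose proof (pmetric_nonneg dY HY (snd x) (snd y)). lra.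
Qed.

Lemma cont_snd {X Y : Type} (dX : X -> X -> R) (dY : Y -> Y -> R) D :
  pmetric dX -> cont_on (dist_prod dX dY) dY D snd.
Proof.
  intros HX. apply cont_lipschitz. intros x y. unfold dist_prod.
  pose proof (pmetric_nonneg dX HX (fst x) (fst y)). lra.
Qed.

Lemma cont_coord K D i : (i < K)%nat -> cont_on (dist_fin K) R_dist D (fun x => x i).
Proof. intros Hi. apply cont_lipschitz. intros x y. now apply dist_fin_coord. Qed.

Section RealFunctions.
  Context {X : Type} (d : X -> X -> R) (D : X -> Prop).

  Lemma cont_const {Y : Type} (dY : Y -> Y -> R) (c : Y) : pmetric dY -> cont_on d dY D (fun _ => c).
  Proof.
    intros HY x _ e He. exists 1. split; [lra|]. intros. now rewrite (proj1 HY).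
  Qed.

  Lemma cont_plus F G : cont_on d R_dist D F -> cont_on d R_dist D G ->
    cont_on d R_dist D (fun x => F x + G x).
  Proof.
    intros HF HG. pose proof (cont_pair _ _ _ _ _ _ HF HG) as HP.
    eapply (cont_comp d (dist_prod R_dist R_dist) R_dist D (fun _ => True)
              (fun x => (F x, G x)) (fun p => fst p + snd p)); [easy|easy|].
    apply cont_lipschitz. intros x y. unfold dist_prod, R_dist.
    replace (fst x + snd x - (fst y + snd y)) with ((fst x - fst y) + (snd x - snd y)) by lra.
    apply Rabs_triang.
  Qed.

  Lemma cont_mult F G : cont_on d R_dist D F -> cont_on d R_dist D G ->
    cont_on d R_dist D (fun x => F x * G x).
  Proof.
    intros HF HG x Hx e He.
    set (e1 := Rmin 1 (e / (2 * (Rabs (G x) + 1)))). set (e2 := e / (2 * (Rabs (F x) + 1))).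
    pose proof (Rabs_pos (F x)) as PF. pose proof (Rabs_pos (G x)) as PG.
    assert (H1 : 0 < e1) by (apply Rmin_glb_lt; [lra|]; apply Rdiv_lt_0_compat; lra).
    assert (H2 : 0 < e2) by (apply Rdiv_lt_0_compat; lra).
    destruct (HF x Hx e1 H1) as (r1 & Hr1 & HF').
    destruct (HG x Hx e2 H2) as (r2 & Hr2 & HG').
    exists (Rmin r1 r2). split; [now apply Rmin_glb_lt|]. intros y Hy Hxy.
    pose proof (Rmin_l r1 r2). pose proof (Rmin_r r1 r2).
    specialize (HF' y Hy ltac:(lra)). specialize (HG' y Hy ltac:(lra)). unfold R_dist in *.
    assert (Ha : Rabs (F x - F y) < 1) by (eapply Rlt_le_trans; [apply HF'|apply Rmin_l]).
    assert (Hb : Rabs (F x - F y) * (2 * (Rabs (G x) + 1)) < e).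
    { apply Rmult_lt_reg_r with (/ (2 * (Rabs (G x) + 1))); [apply Rinv_0_lt_compat; lra|].
      rewrite Rmult_assoc, Rinv_r by lra. rewrite Rmult_1_r.
      eapply Rlt_le_trans; [apply HF'|apply Rmin_r]. }
    assert (Hc : Rabs (G x - G y) * (2 * (Rabs (F x) + 1)) < e).
    { apply Rmult_lt_reg_r with (/ (2 * (Rabs (F x) + 1))); [apply Rinv_0_lt_compat; lra|].
      rewrite Rmult_assoc, Rinv_r by lra. rewrite Rmult_1_r. apply HG'. }
    replace (F x * G x - F y * G y) with ((F x - F y) * G x + F y * (G x - G y)) by ring.
    eapply Rle_lt_trans; [apply Rabs_triang|]. rewrite !Rabs_mult.
    assert (Hd : Rabs (F y) <= Rabs (F x) + 1).
    { replace (F y) with (F x + - (F x - F y)) by ring.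
      eapply Rle_trans; [apply Rabs_triang|]. rewrite Rabs_Ropp. lra. }
    pose proof (Rabs_pos (F x - F y)). pose proof (Rabs_pos (G x - G y)).
    assert (Rabs (F y) * Rabs (G x - G y) <= (Rabs (F x) + 1) * Rabs (G x - G y))
      by (apply Rmult_le_compat_r; lra).
    nra.
  Qed.

  Lemma cont_scal c F : cont_on d R_dist D F -> cont_on d R_dist D (fun x => c * F x).
  Proof. intros HF. apply cont_mult; [apply cont_const, R_dist_pmetric|easy]. Qed.

  Lemma cont_minus F G : cont_on d R_dist D F -> cont_on d R_dist D G ->
    cont_on d R_dist D (fun x => F x - G x).
  Proof.
    intros HF HG. apply cont_ext with (fun x => F x + -1 * G x); [intros; lra|].
    now apply cont_plus, cont_scal.
  Qed.

  Lemma cont_max c F : cont_on d R_dist D F -> cont_on d R_dist D (fun x => Rmax c (F x)).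
  Proof.
    intros HF. apply (cont_comp d R_dist R_dist D (fun _ => True) F (Rmax c)); [easy|easy|].
    apply cont_lipschitz. intros x y. unfold R_dist, Rmax.
    destruct (Rle_dec c x), (Rle_dec c y); unfold Rabs; repeat destruct Rcase_abs; lra.
  Qed.

  Lemma cont_min c F : cont_on d R_dist D F -> cont_on d R_dist D (fun x => Rmin c (F x)).
  Proof.
    intros HF. apply (cont_comp d R_dist R_dist D (fun _ => True) F (Rmin c)); [easy|easy|].
    apply cont_lipschitz. intros x y. unfold R_dist, Rmin.
    destruct (Rle_dec c x), (Rle_dec c y); unfold Rabs; repeat destruct Rcase_abs; lra.
  Qed.

  Lemma cont_inv F : (forall x, D x -> 0 < F x) -> cont_on d R_dist D F ->
    cont_on d R_dist D (fun x => / F x).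
  Proof.
    intros Hp HF x Hx e He. pose proof (Hp x Hx) as Px.
    set (e1 := Rmin (F x / 2) (e * (F x * F x / 2))).
    assert (H1 : 0 < e1).
    { apply Rmin_glb_lt; [lra|]. apply Rmult_lt_0_compat; [easy|]. nra. }
    destruct (HF x Hx e1 H1) as (r & Hr & H). exists r. split; [easy|]. intros y Hy Hxy.
    specialize (H y Hy Hxy). pose proof (Hp y Hy) as Py. unfold R_dist in *.
    assert (Ha : Rabs (F x - F y) < F x / 2) by (eapply Rlt_le_trans; [apply H|apply Rmin_l]).
    assert (Hb : Rabs (F x - F y) < e * (F x * F x / 2))
      by (eapply Rlt_le_trans; [apply H|apply Rmin_r]).
    assert (Hc : F x / 2 < F y) by (apply Rabs_def2 in Ha; lra).
    replace (/ F x - / F y) with (- (F x - F y) * / (F x * F y)) by (field; lra).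
    rewrite Rabs_mult, Rabs_Ropp, (Rabs_pos_eq (/ _))
      by (left; apply Rinv_0_lt_compat; nra).
    apply Rmult_lt_reg_r with (F x * F y); [nra|].
    rewrite Rmult_assoc, Rinv_l by nra. rewrite Rmult_1_r.
    assert (F x * (F x / 2) <= F x * F y) by (apply Rmult_le_compat_l; lra). nra.
  Qed.

  Lemma cont_sumN K (F : nat -> X -> R) :
    (forall i, (i < K)%nat -> cont_on d R_dist D (F i)) ->
    cont_on d R_dist D (fun x => sumN K (fun i => F i x)).
  Proof.
    induction K as [|K IH]; intros H; simpl.
    - apply cont_const, R_dist_pmetric.
    - apply cont_plus; auto with arith.
  Qed.

  Lemma cont_dist_fin K (G : X -> nat -> R) :
    (forall i, (i < K)%nat -> cont_on d R_dist D (fun x => G x i)) ->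
    cont_on d (dist_fin K) D G.
  Proof.
    unfold dist_fin. induction K as [|K IH]; intros H x Hx e He.
    - exists 1. split; [lra|]. easy.
    - destruct (IH (fun i Hi => H i (Nat.lt_lt_succ_r _ _ Hi)) x Hx (e / 2)) as (r1 & Hr1 & H1); [lra|].
      destruct (H K (Nat.lt_succ_diag_r K) x Hx (e / 2)) as (r2 & Hr2 & H2); [lra|].
      exists (Rmin r1 r2). split; [now apply Rmin_glb_lt|]. intros y Hy Hxy. simpl.
      pose proof (Rmin_l r1 r2). pose proof (Rmin_r r1 r2).
      specialize (H1 y Hy ltac:(lra)). specialize (H2 y Hy ltac:(lra)). unfold R_dist in H2. lra.
  Qed.

  Lemma cont_normalise K (u : X -> nat -> R) :
    (forall x, D x -> 0 < sumN K (u x)) ->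
    (forall i, (i < K)%nat -> cont_on d R_dist D (fun x => u x i)) ->
    cont_on d (dist_fin K) D (fun x i => u x i / sumN K (u x)).
  Proof.
    intros Hp Hu. apply cont_dist_fin. intros i Hi. apply cont_mult; [auto|].
    apply cont_inv; [easy|]. apply (cont_sumN K (fun i x => u x i)). auto.
  Qed.
End RealFunctions.

Lemma normalise_sum K (u : nat -> R) : 0 < sumN K u -> sumN K (fun i => u i / sumN K u) = 1.
Proof.
  intros H. rewrite (sumN_ext K _ (fun i => / sumN K u * u i)).
  - rewrite sumN_scal. field. lra.
  - intros. unfold Rdiv. ring.
Qed.

(** * Homotopies as maps on a cylinder *)

Definition cylinder {X : Type} (D : X -> Prop) (p : X * R) : Prop := D (fst p) /\ unit_I (snd p).

(** Translates the continuity clause of [eps_homotopic] into [cont_on] for the sum metric, so that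
    the lemmas on composition and pairing apply to homotopies. *)
Lemma joint_continuity {X Y : Type} (dX : X -> X -> R) (dY : Y -> Y -> R) (D : X -> Prop)
  (h : X -> R -> Y) :
  pmetric dX ->
  ((forall x s, D x -> unit_I s -> forall e, 0 < e -> exists delta, 0 < delta /\
       forall y t, D y -> unit_I t -> dX x y < delta -> Rabs (s - t) < delta ->
         dY (h x s) (h y t) < e) <->
   cont_on (dist_prod dX R_dist) dY (cylinder D) (fun p => h (fst p) (snd p))).
Proof.
  intros HX. split.
  - intros H (x & s) (Hx & Hs) e He. destruct (H x s Hx Hs e He) as (r & Hr & Hh).
    exists r. split; [easy|]. intros (y & t) (Hy & Ht) Hd. unfold dist_prod, R_dist in Hd.
    simpl in *. pose proof (pmetric_nonneg dX HX x y). pose proof (Rabs_pos (s - t)).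
    apply Hh; auto; lra.
  - intros H x s Hx Hs e He. destruct (H (x, s) (conj Hx Hs) e He) as (r & Hr & Hh).
    exists (r / 2). split; [lra|]. intros y t Hy Ht H1 H2. apply (Hh (y, t)); [easy|].
    unfold dist_prod, R_dist. simpl. lra.
Qed.

Lemma eps_homotopic_precompose {X X' Y : Type} (dX : X -> X -> R) (dX' : X' -> X' -> R)
  (dY : Y -> Y -> R) (D : X -> Prop) (D' : X' -> Prop) eps (g g' : X -> Y) (e : X' -> X) :
  pmetric dX -> pmetric dX' ->
  (forall x, D' x -> D (e x)) -> cont_on dX' dX D' e ->
  eps_homotopic dX dY D eps g g' ->
  eps_homotopic dX' dY D' eps (fun x => g (e x)) (fun x => g' (e x)).
Proof.
  intros HX HX' HD He (h & Hc & H01 & Hs). exists (fun x s => h (e x) s).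
  split; [|split]; auto.
  apply joint_continuity; [easy|]. apply joint_continuity in Hc; [|easy].
  apply (cont_comp (dist_prod dX' R_dist) (dist_prod dX R_dist) dY (cylinder D') (cylinder D)
    (fun p => (e (fst p), snd p)) (fun p => h (fst p) (snd p))); [|apply cont_pair|easy].
  - intros p (Hp & Ht). split; simpl; auto.
  - apply (cont_comp _ dX' _ _ D'); [now intros p []|apply cont_fst, R_dist_pmetric|easy].
  - now apply cont_snd.
Qed.

(** * Compactness of realizations, fibers and cubes *)

Lemma realiz_unit nv S t : realiz nv S t -> forall i, (i < nv)%nat -> unit_I (t i).
Proof.
  intros (H0 & _ & H1) i Hi. split; [easy|]. rewrite <- H1. now apply sumN_term_le.
Qed.

Lemma pos_support_near nv x y (v : nat) : (v < nv)%nat -> dist_fin nv x y < Rabs (x v) -> y v <> 0.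
Proof.
  intros Hv Hd E. pose proof (dist_fin_coord nv x y v Hv). rewrite E, Rminus_0_r in H. lra.
Qed.

Lemma list_positive_bound (l : list nat) (x : nat -> R) :
  exists e, 0 < e /\ forall i, In i l -> x i <> 0 -> e < Rabs (x i).
Proof.
  induction l as [|a l (e & He & H)]; [exists 1; split; [lra|easy]|].
  destruct (Req_dec (x a) 0) as [E|E].
  - exists e. split; [easy|]. intros i [<-|Hi] Hx; auto. easy.
  - pose proof (Rabs_pos_lt _ E). exists (Rmin e (Rabs (x a) / 2)).
    pose proof (Rmin_l e (Rabs (x a) / 2)). pose proof (Rmin_r e (Rabs (x a) / 2)).
    split; [apply Rmin_glb_lt; lra|]. intros i [<-|Hi] Hx; [lra|]. specialize (H i Hi Hx). lra.
Qed.

Lemma closed_real_eq (a b : R) : (forall e, 0 < e -> Rabs (a - b) < e) -> a = b.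
Proof.
  intros H. destruct (Req_dec a b) as [|Hne]; [easy|].
  assert (0 < Rabs (a - b)) by (apply Rabs_pos_lt; lra). specialize (H _ H0). lra.
Qed.

Lemma closed_real_nonneg (a : R) : (forall e, 0 < e -> - e <= a) -> 0 <= a.
Proof.
  intros H. apply Rnot_lt_le. intros Hlt. specialize (H (- a / 2)). lra.
Qed.

Lemma realiz_closed nv S x :
  (forall i, (nv <= i)%nat -> x i = 0) ->
  (forall e, 0 < e -> exists y, realiz nv S y /\ dist_fin nv x y < e) -> realiz nv S x.
Proof.
  intros H0 Hcl. repeat split.
  - intros i. destruct (le_lt_dec nv i) as [Hi|Hi]; [rewrite H0; [lra|easy]|].
    apply closed_real_nonneg. intros e He. destruct (Hcl e He) as (y & (Hy & _) & Hd).
    pose proof (dist_fin_coord nv x y i Hi). specialize (Hy i).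
    assert (Hb : Rabs (x i - y i) < e) by lra. apply Rabs_def2 in Hb. lra.
  - destruct (list_positive_bound (seq 0 nv) x) as (e & He & Hb).
    destruct (Hcl e He) as (y & (_ & (s & Hs & Hsy) & _) & Hd).
    exists s. split; [easy|]. intros i Hi. apply Hsy.
    destruct (le_lt_dec nv i) as [Hl|Hl]; [exfalso; auto|].
    apply (pos_support_near nv x y); [easy|]. specialize (Hb i). rewrite in_seq in Hb.
    specialize (Hb ltac:(lia) Hi). lra.
  - apply closed_real_eq. intros e He. destruct (Hcl e He) as (y & (_ & _ & Hy) & Hd).
    rewrite <- Hy, <- sumN_minus. eapply Rle_lt_trans; [apply sumN_abs|exact Hd].
Qed.

Lemma realiz_compact nv S : seq_compact (dist_fin nv) (realiz nv S).
Proof.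
  apply seq_compact_closed_cube; [apply realiz_unit|]. apply realiz_closed.
Qed.

Lemma simp_real_lipschitz nK f x y j :
  Rabs (simp_real nK f x j - simp_real nK f y j) <= dist_fin nK x y.
Proof.
  unfold simp_real. rewrite <- sumN_minus. eapply Rle_trans; [apply sumN_abs|].
  apply sumN_le. intros i _. destruct (Nat.eq_dec (f i) j); [lra|].
  rewrite Rminus_diag, Rabs_R0. apply Rabs_pos.
Qed.

Lemma fiber_compact nK SK f y : seq_compact (dist_fin nK) (fiber nK SK f y).
Proof.
  apply seq_compact_closed_cube; [intros x (Hx & _); eapply realiz_unit; eauto|].
  intros x H0 Hcl. split.
  - apply realiz_closed; [easy|]. intros e He. destruct (Hcl e He) as (t & (Ht & _) & Hd). eauto.
  - intros j. apply closed_real_eq. intros e He. destruct (Hcl e He) as (t & (_ & Ht) & Hd).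
    rewrite <- Ht. eapply Rle_lt_trans; [apply simp_real_lipschitz|exact Hd].
Qed.

Lemma cube_compact k : seq_compact (dist_fin k) (cube k).
Proof.
  apply seq_compact_closed_cube; [intros x (Hx & _); auto|]. intros x H0 Hcl. split; [|easy].
  intros i Hi. split.
  - apply closed_real_nonneg. intros e He. destruct (Hcl e He) as (y & (Hy & _) & Hd).
    pose proof (dist_fin_coord k x y i Hi). destruct (Hy i Hi).
    assert (Hb : Rabs (x i - y i) < e) by lra. apply Rabs_def2 in Hb. lra.
  - cut (0 <= 1 - x i); [lra|]. apply closed_real_nonneg. intros e He.
    destruct (Hcl e He) as (y & (Hy & _) & Hd).
    pose proof (dist_fin_coord k x y i Hi). destruct (Hy i Hi).
    assert (Hb : Rabs (x i - y i) < e) by lra. apply Rabs_def2 in Hb. lra.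
Qed.

(** * Extending a small homotopy from a simplex to the complex *)

(* [(collapse t a, level t a)] is a retraction of |K| x I onto |K| x 0 together with
   (simplex s) x I: the coordinates outside s are cut by c * a and the point is renormalised. *)
Definition cut (c : R) (s : list nat) (t : nat -> R) (a : R) (v : nat) : R :=
  if in_dec Nat.eq_dec v s then t v else Rmax 0 (t v - c * a).

Definition collapse (nK : nat) (c : R) (s : list nat) (t : nat -> R) (a : R) (v : nat) : R :=
  cut c s t a v / sumN nK (cut c s t a).

Definition level (nK : nat) (c : R) (s : list nat) (t : nat -> R) (a : R) : R :=
  Rmax 0 (a - / c * sumN nK (fun v => if in_dec Nat.eq_dec v s then 0 else t v)).

Section Extension.
  Context (nK : nat) (SK : list (list nat)) (s : list nat) (c : R).
  Hypothesis vertices : forall s', In s' SK -> forall i, In i s' -> (i < nK)%nat.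
  Hypothesis c_pos : 0 < c.
  Hypothesis c_small : INR nK * c <= / 2.
  Let D := realiz nK SK.
  Let sigma := realiz nK (s :: nil).

  Lemma realiz_outside t v : D t -> (nK <= v)%nat -> t v = 0.
  Proof.
    intros (_ & (s' & Hs' & H) & _) Hv. apply NNPP. intros Hn.
    specialize (vertices s' Hs' v (H v Hn)). lia.
  Qed.

  Lemma cut_bounds t a v : D t -> unit_I a ->
    0 <= cut c s t a v <= t v /\ t v - c <= cut c s t a v.
  Proof.
    intros (Ht & _) (Ha0 & Ha1). specialize (Ht v). unfold cut.
    destruct in_dec; [lra|]. unfold Rmax. destruct Rle_dec; nra.
  Qed.

  (** Each coordinate loses at most c. By [c_small] at least half of the mass survives, which makes
      the normalisation in [collapse] safe. *)
  Lemma cut_sum_bounds t a : D t -> unit_I a ->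
    1 - INR nK * c <= sumN nK (cut c s t a) <= 1.
  Proof.
    intros Ht Ha. destruct Ht as (H0 & Hs & H1) eqn:E. rewrite <- H1. split.
    - rewrite <- (sumN_const nK c), <- sumN_minus. apply sumN_le. intros i _.
      now apply cut_bounds.
    - apply sumN_le. intros i _. now apply cut_bounds.
  Qed.

  Lemma cut_sum_pos t a : D t -> unit_I a -> 0 < sumN nK (cut c s t a).
  Proof. intros Ht Ha. pose proof (cut_sum_bounds t a Ht Ha). lra. Qed.

  Lemma collapse_realiz t a : D t -> unit_I a -> D (collapse nK c s t a).
  Proof.
    intros Ht Ha. pose proof (cut_sum_pos t a Ht Ha) as HT. repeat split.
    - intros i. apply Rmult_le_pos; [now apply cut_bounds|]. left. now apply Rinv_0_lt_compat.
    - destruct Ht as (H0 & (s' & Hs' & H) & H1) eqn:E. exists s'. split; [easy|].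
      intros i Hi. apply H. intros E0. apply Hi. unfold collapse.
      destruct (cut_bounds t a i Ht Ha) as ((Hb1 & Hb2) & _).
      replace (cut c s t a i) with 0 by lra. unfold Rdiv. ring.
    - now apply normalise_sum.
  Qed.

  Lemma collapse_id t a : D t -> (forall v, cut c s t a v = t v) -> collapse nK c s t a = t.
  Proof.
    intros Ht H. apply functional_extensionality. intros v. unfold collapse.
    rewrite H, (sumN_ext nK _ t) by auto. destruct Ht as (_ & _ & ->). field.
  Qed.

  Lemma collapse_0 t : D t -> collapse nK c s t 0 = t.
  Proof.
    intros Ht. apply collapse_id; [easy|]. intros v. unfold cut. destruct in_dec; [easy|].
    rewrite Rmult_0_r, Rminus_0_r. apply Rmax_right, Ht.
  Qed.

  Lemma collapse_face t a : D t -> sigma t -> unit_I a -> collapse nK c s t a = t.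
  Proof.
    intros Ht (_ & (s' & [<-|[]] & H) & _) (Ha & _). apply collapse_id; [easy|].
    intros v. unfold cut. destruct in_dec as [|Hv]; [easy|].
    assert (E : t v = 0) by (apply NNPP; auto). rewrite E. apply Rmax_left. nra.
  Qed.

  Lemma level_unit t a : D t -> unit_I a -> unit_I (level nK c s t a).
  Proof.
    intros (Ht & _) (Ha0 & Ha1). unfold level.
    assert (0 <= / c * sumN nK (fun v => if in_dec Nat.eq_dec v s then 0 else t v)).
    { apply Rmult_le_pos; [left; now apply Rinv_0_lt_compat|]. apply sumN_nonneg.
      intros i _. destruct in_dec; [lra|easy]. }
    split; [apply Rmax_l|]. apply Rmax_lub; lra.
  Qed.

  Lemma level_face t a : D t -> sigma t -> unit_I a -> level nK c s t a = a.
  Proof.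
    intros Ht (_ & (s' & [<-|[]] & H) & _) (Ha & _). unfold level.
    rewrite sumN_zero; [rewrite Rmult_0_r, Rminus_0_r; now apply Rmax_right|].
    intros v _. destruct in_dec as [|Hv]; [easy|]. apply NNPP; auto.
  Qed.

  Lemma level_0 t : D t -> level nK c s t 0 = 0.
  Proof.
    intros (Ht & _). apply Rmax_left.
    assert (0 <= / c * sumN nK (fun v => if in_dec Nat.eq_dec v s then 0 else t v)); [|lra].
    apply Rmult_le_pos; [left; now apply Rinv_0_lt_compat|]. apply sumN_nonneg.
    intros i _. destruct in_dec; [lra|easy].
  Qed.

  Lemma level_mono t a b : a <= b -> level nK c s t a <= level nK c s t b.
  Proof. intros H. unfold level. apply Rle_max_compat_l. lra. Qed.

  (** A positive level says that the total mass outside s is below c * a. Every single outside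
      coordinate is then below c * a and is cut to 0; this is the reason for the factor / c in
      [level]. *)
  Lemma collapse_in_face t a : D t -> unit_I a -> 0 < level nK c s t a ->
    sigma (collapse nK c s t a).
  Proof.
    intros Ht Ha Hl. destruct (collapse_realiz t a Ht Ha) as (H0 & _ & H1).
    split; [easy|]. split; [|easy]. exists s. split; [now left|]. intros v Hv.
    destruct (in_dec Nat.eq_dec v s) as [|Hn]; [easy|]. exfalso. apply Hv.
    unfold collapse. replace (cut c s t a v) with 0; [unfold Rdiv; ring|].
    unfold cut. destruct in_dec; [easy|]. symmetry. apply Rmax_left.
    destruct (le_lt_dec nK v) as [Hv'|Hv'].
    { rewrite (realiz_outside t v Ht Hv'). destruct Ha. nra. }
    unfold level in Hl. revert Hl. unfold Rmax. destruct Rle_dec as [Hl|]; [|lra]. intros Hl'.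
    set (F := fun v => if in_dec Nat.eq_dec v s then 0 else t v) in *.
    assert (HF : F v <= sumN nK F).
    { apply sumN_term_le; [easy|]. intros i _. unfold F. destruct in_dec; [lra|apply Ht]. }
    unfold F in HF at 1. destruct in_dec; [easy|].
    assert (sumN nK F < c * a); [|lra].
    replace (sumN nK F) with (c * (/ c * sumN nK F)) by (field; lra).
    apply Rmult_lt_compat_l; lra.
  Qed.

  (** Cutting removes a mass of at most nK * c and the normalisation gives the same amount back; the
      factor 2 counts both. *)
  Lemma collapse_near t a : D t -> unit_I a ->
    dist_fin nK (collapse nK c s t a) t <= 2 * (INR nK * c).
  Proof.
    intros Ht Ha. pose proof (cut_sum_bounds t a Ht Ha) as HT.
    set (T := sumN nK (cut c s t a)) in *.
    assert (Hle : dist_fin nK (collapse nK c s t a) t <=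
              sumN nK (fun v => (/ T - 1) * cut c s t a v + c)).
    { apply sumN_le. intros v _. unfold collapse. fold T.
      destruct (cut_bounds t a v Ht Ha) as ((Hb1 & Hb2) & Hb3).
      assert (1 <= / T) by (rewrite <- Rinv_1 at 1; apply Rinv_le_contravar; lra).
      replace (cut c s t a v / T - t v) with
        ((/ T - 1) * cut c s t a v - (t v - cut c s t a v)) by (unfold Rdiv; ring).
      assert (0 <= (/ T - 1) * cut c s t a v) by (apply Rmult_le_pos; lra).
      apply Rabs_le. lra. }
    rewrite sumN_plus, sumN_scal, sumN_const in Hle. fold T in Hle.
    replace ((/ T - 1) * T) with (1 - T) in Hle by (field; lra). lra.
  Qed.

  Lemma cont_cut v : (v < nK)%nat ->
    cont_on (dist_prod (dist_fin nK) R_dist) R_dist (cylinder D)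
      (fun p => cut c s (fst p) (snd p) v).
  Proof.
    intros Hv. unfold cut.
    assert (Hc : cont_on (dist_prod (dist_fin nK) R_dist) R_dist (cylinder D) (fun p => fst p v)).
    { apply (cont_comp _ (dist_fin nK) _ _ (fun _ => True) fst (fun x => x v));
        [easy|apply cont_fst, R_dist_pmetric|now apply cont_coord]. }
    destruct in_dec; [easy|]. apply cont_max, cont_minus; [easy|].
    apply cont_scal, cont_snd, dist_fin_pmetric.
  Qed.

  Lemma cont_collapse :
    cont_on (dist_prod (dist_fin nK) R_dist) (dist_fin nK) (cylinder D)
      (fun p => collapse nK c s (fst p) (snd p)).
  Proof.
    apply (cont_normalise _ _ nK (fun p => cut c s (fst p) (snd p))).
    - intros p (Hp & Ha). now apply cut_sum_pos.
    - apply cont_cut.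
  Qed.

  Lemma cont_level :
    cont_on (dist_prod (dist_fin nK) R_dist) R_dist (cylinder D)
      (fun p => level nK c s (fst p) (snd p)).
  Proof.
    apply cont_max, cont_minus; [apply cont_snd, dist_fin_pmetric|]. apply cont_scal.
    apply (cont_sumN _ _ nK (fun v p => if in_dec Nat.eq_dec v s then 0 else fst p v)).
    intros v Hv. destruct in_dec; [apply cont_const, R_dist_pmetric|].
    apply (cont_comp _ (dist_fin nK) _ _ (fun _ => True) fst (fun x => x v));
        [easy|apply cont_fst, R_dist_pmetric|now apply cont_coord].
  Qed.
End Extension.

(* Pasting along the two closed sets [level = 0] and [collapse in s]. *)
Definition extended {M : Type} (nK : nat) (c : R) (s : list nat) (g : (nat -> R) -> M)
  (h0 : (nat -> R) -> R -> M) (t : nat -> R) (a : R) : M :=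
  if Rlt_dec 0 (level nK c s t a) then h0 (collapse nK c s t a) (level nK c s t a)
  else g (collapse nK c s t a).

(** A positive level persists nearby. At level 0 with the collapsed point in s, both branches are
    close to the same value because h0 starts at g. At level 0 with the collapsed point off s, only
    the branch of g occurs nearby. *)
Lemma cont_extended {M : Type} (dM : M -> M -> R) nK SK s c (g : (nat -> R) -> M)
  (h0 : (nat -> R) -> R -> M) :
  (forall s', In s' SK -> forall i, In i s' -> (i < nK)%nat) -> 0 < c -> INR nK * c <= / 2 ->
  pmetric dM ->
  (forall t, realiz nK (s :: nil) t -> realiz nK SK t) ->
  cont_on (dist_fin nK) dM (realiz nK SK) g ->
  cont_on (dist_prod (dist_fin nK) R_dist) dM (cylinder (realiz nK (s :: nil)))
    (fun p => h0 (fst p) (snd p)) ->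
  (forall t, realiz nK (s :: nil) t -> h0 t 0 = g t) ->
  cont_on (dist_prod (dist_fin nK) R_dist) dM (cylinder (realiz nK SK))
    (fun p => extended nK c s g h0 (fst p) (snd p)).
Proof.
  intros Hv Hc Hcs HM Hsub Hg Hh H0 p Hp e He.
  pose proof (cont_collapse nK SK s c Hc Hcs p Hp) as Cphi.
  pose proof (cont_level nK SK s c p Hp) as Clev.
  destruct p as (t & a). destruct Hp as (Ht & Ha). unfold extended. simpl in *.
  pose proof (level_unit nK SK s c Hc t a Ht Ha) as Hlu.
  set (ph := collapse nK c s t a) in *. set (lv := level nK c s t a) in *.
  assert (Hph : realiz nK SK ph) by now apply collapse_realiz.
  assert (near_h0 : realiz nK (s :: nil) ph -> exists r, 0 < r /\ forall q, cylinder (realiz nK SK) q ->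
     dist_prod (dist_fin nK) R_dist (t, a) q < r -> 0 < level nK c s (fst q) (snd q) ->
     dM (h0 ph lv) (h0 (collapse nK c s (fst q) (snd q)) (level nK c s (fst q) (snd q))) < e).
  { intros Hs. destruct (Hh (ph, lv) (conj Hs Hlu) e He) as (r & Hr & HH).
    destruct (Cphi (r / 2)) as (r1 & Hr1 & H1); [lra|].
    destruct (Clev (r / 2)) as (r2 & Hr2 & H2); [lra|].
    exists (Rmin r1 r2). split; [now apply Rmin_glb_lt|]. intros q Hq Hd Hl.
    pose proof (Rmin_l r1 r2). pose proof (Rmin_r r1 r2).
    specialize (H1 q Hq ltac:(lra)). specialize (H2 q Hq ltac:(lra)). destruct Hq as (Hq1 & Hq2).
    apply (HH (collapse nK c s (fst q) (snd q), level nK c s (fst q) (snd q))).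
    - split; simpl; [now apply (collapse_in_face nK SK)|now apply (level_unit nK SK)].
    - unfold dist_prod in *. simpl in *. lra. }
  destruct (Rlt_dec 0 lv) as [Hl|Hl].
  - destruct near_h0 as (r1 & Hr1 & H1); [now apply (collapse_in_face nK SK)|].
    destruct (Clev lv Hl) as (r2 & Hr2 & H2).
    exists (Rmin r1 r2). split; [now apply Rmin_glb_lt|]. intros q Hq Hd.
    pose proof (Rmin_l r1 r2). pose proof (Rmin_r r1 r2).
    specialize (H2 q Hq ltac:(lra)). unfold R_dist in H2. apply Rabs_def2 in H2.
    destruct Rlt_dec as [Hl'|Hl']; [|lra]. apply H1; auto. lra.
  - assert (Elv : lv = 0) by (destruct Hlu; lra).
    destruct (Hg ph Hph e He) as (r & Hr & HG).
    destruct (Cphi r Hr) as (r1 & Hr1 & H1).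
    destruct (classic (realiz nK (s :: nil) ph)) as [Hs|Hs].
    + destruct (near_h0 Hs) as (r2 & Hr2 & H2). rewrite Elv, (H0 ph Hs) in H2.
      exists (Rmin r1 r2). split; [now apply Rmin_glb_lt|]. intros q Hq Hd.
      pose proof (Rmin_l r1 r2). pose proof (Rmin_r r1 r2).
      destruct Rlt_dec; [apply H2; auto; lra|]. apply HG; [|apply H1; auto; lra].
      destruct Hq. now apply collapse_realiz.
    (* A vertex w outside s that carries weight at [ph] still does so after a small move, so nearby
       collapsed points are not in s and their level is 0. *)
    + assert (Hw : exists w, (w < nK)%nat /\ ~ In w s /\ ph w <> 0).
      { apply NNPP. intros Hn. apply Hs. destruct Hph as (P0 & P1 & P2) eqn:E.
        split; [easy|]. split; [|easy]. exists s. split; [now left|]. intros i Hi.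
        apply NNPP. intros Hni. apply Hn. exists i. repeat split; auto.
        apply Nat.nle_gt. intros Hle. apply Hi. now apply (realiz_outside nK SK). }
      destruct Hw as (w & Hw & Hws & Hpw). pose proof (Rabs_pos_lt _ Hpw) as Hpos.
      destruct (Cphi _ Hpos) as (r2 & Hr2 & H2).
      exists (Rmin r1 r2). split; [now apply Rmin_glb_lt|]. intros q Hq Hd.
      pose proof (Rmin_l r1 r2). pose proof (Rmin_r r1 r2).
      destruct Rlt_dec as [Hlq|].
      * exfalso. destruct Hq as (Hq1 & Hq2) eqn:Eq.
        destruct (collapse_in_face nK SK s c Hv Hc Hcs _ _ Hq1 Hq2 Hlq)
          as (_ & (s' & [<-|[]] & Hsup) & _).
        apply Hws, Hsup. apply (pos_support_near nK ph); [easy|]. apply H2; auto. lra.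
      * apply HG; [|apply H1; auto; lra]. destruct Hq. now apply collapse_realiz.
Qed.

(** If t ever reaches positive level, its track stays within mu of the track of h0 at the single
    point [collapse nK c s t 1], which moves by at most eps; the two ends cost 2 * mu. Otherwise the
    track is the image under g of a short path. *)
Lemma homotopy_extension {M : Type} (dM : M -> M -> R) nK SK s (g : (nat -> R) -> M)
  (h0 : (nat -> R) -> R -> M) eps mu :
  (forall s', In s' SK -> forall i, In i s' -> (i < nK)%nat) -> In s SK ->
  pmetric dM ->
  cont_on (dist_fin nK) dM (realiz nK SK) g ->
  cont_on (dist_prod (dist_fin nK) R_dist) dM (cylinder (realiz nK (s :: nil)))
    (fun p => h0 (fst p) (snd p)) ->
  (forall t, realiz nK (s :: nil) t -> h0 t 0 = g t) ->
  (forall t, realiz nK (s :: nil) t -> forall a b, unit_I a -> unit_I b ->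
     dM (h0 t a) (h0 t b) <= eps) ->
  0 <= eps -> 0 < mu ->
  exists h : (nat -> R) -> R -> M,
    cont_on (dist_prod (dist_fin nK) R_dist) dM (cylinder (realiz nK SK))
      (fun p => h (fst p) (snd p)) /\
    (forall t, realiz nK SK t -> h t 0 = g t) /\
    (forall t, realiz nK (s :: nil) t -> h t 1 = h0 t 1) /\
    (forall t, realiz nK SK t -> forall a b, unit_I a -> unit_I b ->
     dM (h t a) (h t b) <= eps + 2 * mu).
Proof.
  intros Hv Hs HM Hg Hh H0 Hdiam Heps Hmu.
  assert (Hsub : forall t, realiz nK (s :: nil) t -> realiz nK SK t).
  { intros t (A & (s' & [<-|[]] & B) & C). split; [easy|]. split; [eauto|easy]. }
  pose proof (dist_fin_pmetric nK) as Hd.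
  destruct (compact_uniform_continuity _ _ _ g Hd HM (realiz_compact nK SK) Hg mu Hmu) as (r1 & Hr1 & U1).
  destruct (compact_uniform_continuity _ _ _ _ (dist_prod_pmetric _ _ Hd R_dist_pmetric) HM
    (seq_compact_prod _ _ _ _ (realiz_compact nK (s :: nil)) seq_compact_unit_I) Hh mu Hmu)
    as (r2 & Hr2 & U2).
  set (r := Rmin r1 r2). assert (Hr : 0 < r /\ r <= r1 /\ r <= r2).
  { unfold r. repeat split; [now apply Rmin_glb_lt|apply Rmin_l|apply Rmin_r]. }
  (* Collapsing moves t by at most 2 * nK * c <= r / 4, so two collapsed positions of t are less
     than r apart. The successor of nK avoids a division by 0. *)
  set (c := Rmin (/ 2) (r / 8) / INR (S nK)).
  assert (Hm : 0 < Rmin (/ 2) (r / 8)) by (apply Rmin_glb_lt; lra).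
  assert (HN : 0 < INR (S nK)) by (apply lt_0_INR; lia).
  assert (Hc : 0 < c) by now apply Rdiv_lt_0_compat.
  assert (Hcm : INR nK * c <= Rmin (/ 2) (r / 8)).
  { replace (Rmin (/ 2) (r / 8)) with (INR (S nK) * c) by (unfold c; field; lra).
    apply Rmult_le_compat_r; [lra|]. apply le_INR. lia. }
  pose proof (Rmin_l (/ 2) (r / 8)). pose proof (Rmin_r (/ 2) (r / 8)).
  assert (Hcs : INR nK * c <= / 2) by lra.
  assert (Hnear : forall t a b, realiz nK SK t -> unit_I a -> unit_I b ->
     dist_fin nK (collapse nK c s t a) (collapse nK c s t b) < r).
  { intros t a b Ht Ha Hb. destruct Hd as (_ & Ds & Dt).
    pose proof (collapse_near nK SK s c Hc Hcs t a Ht Ha).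
    pose proof (collapse_near nK SK s c Hc Hcs t b Ht Hb).
    specialize (Dt (collapse nK c s t a) t (collapse nK c s t b)).
    rewrite (Ds t) in Dt. lra. }
  assert (I1 : unit_I 1) by (split; lra). assert (I0 : unit_I 0) by (split; lra).
  destruct HM as (M0 & Ms & Mt) eqn:EM. clear EM.
  exists (extended nK c s g h0). split; [|split; [|split]].
  - now apply cont_extended.
  - intros t Ht. unfold extended. rewrite (level_0 nK SK), (collapse_0 nK SK) by easy.
    destruct Rlt_dec; [lra|easy].
  - intros t Ht. unfold extended. rewrite (level_face nK SK), (collapse_face nK SK) by auto.
    destruct Rlt_dec; [easy|lra].
  - intros t Ht. destruct (Rlt_dec 0 (level nK c s t 1)) as [Hl|Hl].
    + pose proof (collapse_in_face nK SK s c Hv Hc Hcs t 1 Ht I1 Hl) as Hs1.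
      assert (K : forall a, unit_I a -> dM (extended nK c s g h0 t a)
                  (h0 (collapse nK c s t 1) (level nK c s t a)) < mu).
      { intros a Ha. unfold extended. pose proof (level_unit nK SK s c Hc t a Ht Ha) as Hlu.
        destruct Rlt_dec as [Hla|Hla].
        - apply (U2 (collapse nK c s t a, level nK c s t a)
            (collapse nK c s t 1, level nK c s t a)).
          + split; [now apply (collapse_in_face nK SK)|easy].
          + now split.
          + unfold dist_prod. simpl. rewrite R_dist_eq. specialize (Hnear t a 1 Ht Ha I1). lra.
        - replace (level nK c s t a) with 0 by (destruct Hlu; lra). rewrite H0 by easy.
          apply U1; [now apply collapse_realiz|now apply collapse_realiz|].
          specialize (Hnear t a 1 Ht Ha I1). lra. }
      intros a b Ha Hb. pose proof (K a Ha) as Ka. pose proof (K b Hb) as Kb.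
      rewrite Ms in Kb.
      pose proof (Hdiam _ Hs1 _ _ (level_unit nK SK s c Hc t a Ht Ha)
        (level_unit nK SK s c Hc t b Ht Hb)) as Hab.
      eapply Rle_trans; [eapply Mt|].
      eapply Rle_trans; [apply Rplus_le_compat_l; eapply Mt|].
      eapply Rle_trans; [apply Rplus_le_compat; [left; apply Ka|];
        apply Rplus_le_compat; [apply Hab|left; apply Kb]|]. lra.
    + assert (K : forall a, unit_I a -> extended nK c s g h0 t a = g (collapse nK c s t a)).
      { intros a Ha. unfold extended. destruct Rlt_dec as [Hla|]; [|easy].
        pose proof (level_mono nK s c t a 1 (proj2 Ha)). lra. }
      intros a b Ha Hb. rewrite !K by easy.
      assert (dM (g (collapse nK c s t a)) (g (collapse nK c s t b)) < mu); [|lra].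
      apply U1; [now apply collapse_realiz|now apply collapse_realiz|].
      specialize (Hnear t a b Ht Ha Hb). lra.
Qed.

(** * Intersections of open homotopically dense sets *)

Lemma cont_paste {X Y : Type} (dX : X -> X -> R) (dY : Y -> Y -> R) (D : X -> Prop)
  (phi : X -> R) (c : R) (F1 F2 : X -> Y) :
  cont_on dX R_dist D phi -> cont_on dX dY D F1 -> cont_on dX dY D F2 ->
  (forall x, D x -> phi x = c -> F1 x = F2 x) ->
  cont_on dX dY D (fun x => if Rle_dec (phi x) c then F1 x else F2 x).
Proof.
  intros Hphi H1 H2 E x Hx e He.
  destruct (H1 x Hx e He) as (r1 & Hr1 & K1). destruct (H2 x Hx e He) as (r2 & Hr2 & K2).
  (* Off the wall phi = c this radius keeps y on the side of x; on the wall F1 and F2 agree at x and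
     any radius will do. *)
  set (r3 := if Req_dec_T (phi x) c then 1 else Rabs (phi x - c)).
  assert (Hr3 : 0 < r3).
  { unfold r3. destruct Req_dec_T; [lra|]. apply Rabs_pos_lt. lra. }
  destruct (Hphi x Hx r3 Hr3) as (r4 & Hr4 & K3).
  exists (Rmin (Rmin r1 r2) r4). split; [repeat apply Rmin_glb_lt; easy|]. intros y Hy Hd.
  pose proof (Rmin_l (Rmin r1 r2) r4). pose proof (Rmin_r (Rmin r1 r2) r4).
  pose proof (Rmin_l r1 r2). pose proof (Rmin_r r1 r2).
  specialize (K1 y Hy ltac:(lra)). specialize (K2 y Hy ltac:(lra)). specialize (K3 y Hy ltac:(lra)).
  unfold r3, R_dist in K3. destruct (Req_dec_T (phi x) c) as [Ec|Ec].
  - specialize (E x Hx Ec). destruct (Rle_dec (phi x) c); [|lra].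
    destruct (Rle_dec (phi y) c); [easy|]. now rewrite E.
  - destruct (Rle_dec (phi x) c), (Rle_dec (phi y) c); try easy; exfalso;
      revert K3; unfold Rabs; repeat destruct Rcase_abs; lra.
Qed.

Lemma uniform_limit_cont {X Y : Type} (dX : X -> X -> R) (dY : Y -> Y -> R) (D : X -> Prop)
  (G : nat -> X -> Y) (L : X -> Y) :
  pmetric dY -> (forall k, cont_on dX dY D (G k)) ->
  (forall e, 0 < e -> exists k, forall x, D x -> dY (G k x) (L x) < e) ->
  cont_on dX dY D L.
Proof.
  intros (_ & Ys & Yt) HG Hu x Hx e He. destruct (Hu (e / 3)) as (k & Hk); [lra|].
  destruct (HG k x Hx (e / 3)) as (r & Hr & H); [lra|]. exists r. split; [easy|].
  intros y Hy Hd. specialize (H y Hy Hd). pose proof (Hk x Hx). pose proof (Hk y Hy).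
  pose proof (Yt (L x) (G k x) (L y)). pose proof (Yt (G k x) (G k y) (L y)).
  rewrite (Ys (L x) (G k x)) in *. lra.
Qed.

(** The k-th homotopy of the concatenation runs on the interval from [knot k] to [knot (S k)], of
    length 2^-(k+1); [ramp k] is the affine parameter there, clamped to [0,1]. *)
Definition knot (k : nat) : R := 1 - (/ 2) ^ k.

Definition ramp (k : nat) (a : R) : R := Rmin 1 (Rmax 0 ((a - knot k) * 2 ^ S k)).

Lemma half_pow k : 0 < (/ 2) ^ k <= 1.
Proof. induction k as [|k IH]; simpl; lra. Qed.

Lemma half_pow_inv k : (/ 2) ^ k * 2 ^ k = 1.
Proof. rewrite <- Rpow_mult_distr, Rinv_l, pow1; lra. Qed.

Lemma ramp_unit k a : unit_I (ramp k a).
Proof.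
  unfold ramp. split; [|apply Rmin_l]. apply Rmin_glb; [lra|apply Rmax_l].
Qed.

Lemma ramp_knot k : ramp k (knot k) = 0.
Proof. unfold ramp. rewrite Rminus_diag, Rmult_0_l, Rmax_left, Rmin_right; lra. Qed.

Lemma ramp_end k a : knot (S k) <= a -> ramp k a = 1.
Proof.
  intros Ha. unfold ramp. pose proof (half_pow_inv k) as E. pose proof (half_pow k).
  assert (1 <= (a - knot k) * 2 ^ S k).
  { unfold knot in *. simpl in *.
    assert (0 < 2 ^ k) by (apply pow_lt; lra).
    assert (/ 2 * (/ 2) ^ k * (2 * 2 ^ k) <= (a - (1 - (/ 2) ^ k)) * (2 * 2 ^ k));
      [apply Rmult_le_compat_r; lra|]. lra. }
  rewrite Rmax_right, Rmin_left; lra.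
Qed.

Section HomotopicalBaire.
  Context {X M : Type} (dX : X -> X -> R) (dM : M -> M -> R) (D : X -> Prop).
  Hypothesis HX : pmetric dX.
  Hypothesis HM : is_metric dM.
  Hypothesis complete_M : complete dM.

  Section Sequence.
    Context (g : nat -> X -> M) (h : nat -> X -> R -> M) (e : nat -> R).
    Hypothesis e_pos : forall k, 0 < e k.
    Hypothesis e_half : forall k, 2 * e (S k) <= e k.
    Hypothesis g0_cont : cont_on dX dM D (g O).
    Hypothesis h_cont : forall k, cont_on (dist_prod dX R_dist) dM (cylinder D)
      (fun p => h k (fst p) (snd p)).
    Hypothesis h_0 : forall k x, D x -> h k x 0 = g k x.
    Hypothesis h_1 : forall k x, D x -> h k x 1 = g (S k) x.
    Hypothesis h_small : forall k x, D x -> forall a b, unit_I a -> unit_I b ->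
      dM (h k x a) (h k x b) <= e k.

    (** The first k homotopies in succession, stationary at g k from [knot k] on. Stages k and k + 1
        differ only past [knot k]. *)
    Fixpoint partial_homotopy (k : nat) (p : X * R) : M :=
      match k with
      | O => g O (fst p)
      | S k' => if Rle_dec (snd p) (knot k') then partial_homotopy k' p
                else h k' (fst p) (ramp k' (snd p))
      end.

    Lemma partial_homotopy_end k p : D (fst p) -> knot k <= snd p ->
      partial_homotopy k p = g k (fst p).
    Proof.
      destruct k as [|k]; intros Hp Hk; [easy|]. simpl. destruct Rle_dec as [Hle|_].
      - unfold knot in *. simpl in *. pose proof (half_pow k). lra.
      - rewrite ramp_end; auto.
    Qed.

    Lemma partial_homotopy_start k x : partial_homotopy k (x, 0) = g O x.
    Proof.
      induction k as [|k IH]; [easy|]. simpl. destruct Rle_dec as [|Hn]; [easy|].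
      exfalso. apply Hn. unfold knot. pose proof (half_pow k). lra.
    Qed.

    Lemma partial_homotopy_cont k :
      cont_on (dist_prod dX R_dist) dM (cylinder D) (partial_homotopy k).
    Proof.
      induction k as [|k IH]; simpl.
      - apply (cont_comp _ dX _ _ D fst (g O)); [now intros p []| |easy].
        apply cont_fst, R_dist_pmetric.
      - apply (cont_paste _ _ _ snd (knot k) (partial_homotopy k)
          (fun p => h k (fst p) (ramp k (snd p)))); [now apply cont_snd|easy| |].
        + apply (cont_comp _ (dist_prod dX R_dist) _ _ (cylinder D)
            (fun p => (fst p, ramp k (snd p))) (fun p => h k (fst p) (snd p)));
            [|apply cont_pair|easy].
          * intros p (Hp & _). split; [easy|apply ramp_unit].
          * apply cont_fst, R_dist_pmetric.
          * apply cont_min, cont_max.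
            apply (cont_mult _ _ (fun p : X * R => snd p - knot k) (fun _ => 2 ^ S k));
              [|apply cont_const, R_dist_pmetric].
            apply cont_minus; [now apply cont_snd|apply cont_const, R_dist_pmetric].
        + intros p (Hp & _) E. rewrite partial_homotopy_end by (auto; lra).
          rewrite E, ramp_knot. now rewrite h_0.
    Qed.

    Lemma partial_homotopy_step k p : cylinder D p ->
      dM (partial_homotopy k p) (partial_homotopy (S k) p) <= e k.
    Proof.
      intros (Hp & Ha). simpl. destruct Rle_dec as [|Hn].
      - destruct (is_metric_pmetric _ HM) as (M0 & _). rewrite M0. specialize (e_pos k). lra.
      - rewrite partial_homotopy_end by (auto; lra). rewrite <- h_0 by easy.
        apply h_small; [easy|split; lra|apply ramp_unit].
    Qed.

    (** Halving gives e k <= 2 * (e k - e (k+1)), so the bounds on the steps telescope. Keeping the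
        negative term makes the induction close. *)
    Lemma partial_homotopy_tail k j p : cylinder D p ->
      dM (partial_homotopy k p) (partial_homotopy (j + k) p) <= 2 * (e k - e (j + k)).
    Proof.
      intros Hp. destruct (is_metric_pmetric _ HM) as (M0 & Ms & Mt).
      induction j as [|j IH]; [simpl; rewrite M0; lra|].
      pose proof (partial_homotopy_step (j + k) p Hp).
      pose proof (Mt (partial_homotopy k p) (partial_homotopy (j + k) p)
        (partial_homotopy (S j + k) p)).
      specialize (e_half (j + k)). change (S j + k)%nat with (S (j + k)) in *. lra.
    Qed.

    Lemma e_small r : 0 < r -> exists k, e k < r.
    Proof.
      intros Hr.
      assert (Hk : forall k, e k <= e O * (/ 2) ^ k).
      { induction k as [|k IH]; simpl; [lra|]. specialize (e_half k). lra. }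
      destruct (pow_lt_1_zero (/ 2) ltac:(rewrite Rabs_pos_eq; lra) (r / e O)) as (N & HN).
      { apply Rdiv_lt_0_compat; auto. }
      exists N. eapply Rle_lt_trans; [apply Hk|]. specialize (HN N (le_n N)).
      rewrite Rabs_pos_eq in HN by (left; apply half_pow).
      apply Rmult_lt_compat_l with (r := e O) in HN; [|auto].
      replace (e O * (r / e O)) with r in HN by (field; specialize (e_pos O); lra). easy.
    Qed.

    Lemma limit_homotopy : exists G : X * R -> M,
      cont_on (dist_prod dX R_dist) dM (cylinder D) G /\
      (forall x, D x -> G (x, 0) = g O x) /\
      (forall k p, cylinder D p -> dM (partial_homotopy k p) (G p) <= 2 * e k).
    Proof.
      destruct (is_metric_pmetric _ HM) as (M0 & Ms & Mt) eqn:EM. clear EM.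
      assert (Htail : forall k q p, (k <= q)%nat -> cylinder D p ->
                dM (partial_homotopy k p) (partial_homotopy q p) <= 2 * e k).
      { intros k q p Hq Hp. pose proof (partial_homotopy_tail k (q - k) p Hp) as H.
        replace (q - k + k)%nat with q in H by lia. specialize (e_pos q). lra. }
      assert (H : forall p, exists l, cylinder D p -> forall r, 0 < r -> exists N, forall k,
                (N <= k)%nat -> dM (partial_homotopy k p) l < r).
      { intros p. destruct (classic (cylinder D p)) as [Hp|Hp]; [|now exists (g O (fst p))].
        destruct (complete_M (fun k => partial_homotopy k p)) as (l & Hl); [|now exists l].
        intros r Hr. destruct (e_small (r / 4)) as (N & HN); [lra|]. exists N.
        intros q q' Hq Hq'. pose proof (Htail N q p Hq Hp). pose proof (Htail N q' p Hq' Hp).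
        pose proof (Mt (partial_homotopy q p) (partial_homotopy N p) (partial_homotopy q' p)).
        rewrite (Ms (partial_homotopy q p) (partial_homotopy N p)) in *. lra. }
      apply fun_choice in H. destruct H as (G & HG).
      assert (Hclose : forall k p, cylinder D p -> dM (partial_homotopy k p) (G p) <= 2 * e k).
      { intros k p Hp. apply Rnot_lt_le. intros Hlt.
        destruct (HG p Hp (dM (partial_homotopy k p) (G p) - 2 * e k)) as (N & HN); [lra|].
        specialize (HN (Nat.max N k) ltac:(lia)). pose proof (Htail k (Nat.max N k) p ltac:(lia) Hp).
        pose proof (Mt (partial_homotopy k p) (partial_homotopy (Nat.max N k) p) (G p)). lra. }
      exists G. split; [|split; [|easy]].
      - apply (uniform_limit_cont _ _ _ partial_homotopy); [now apply is_metric_pmetric|apply partial_homotopy_cont|].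
        intros r Hr. destruct (e_small (r / 2)) as (k & Hk); [lra|]. exists k. intros p Hp.
        specialize (Hclose k p Hp). lra.
      - intros x Hx. symmetry. apply HM. destruct HM as (Mp & _).
        assert (Hc : forall k, dM (g O x) (G (x, 0)) <= 2 * e k).
        { intros k. rewrite <- (partial_homotopy_start k x). apply Hclose. split; [easy|].
          simpl. split; lra. }
        destruct (Req_dec (dM (g O x) (G (x, 0))) 0) as [|Hne]; [easy|].
        specialize (Mp (g O x) (G (x, 0))).
        destruct (e_small (dM (g O x) (G (x, 0)) / 2)) as (k & Hk); [lra|].
        specialize (Hc k). lra.
    Qed.
  End Sequence.

  (** The state is a map with a tolerance. Stage k moves the map into C k and then lowers the
      tolerance so far that all later moves together stay within the margin eta granted by
      openness. *)
  Lemma homotopical_baire (C : nat -> (X -> M) -> Prop) :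
    (forall k g, cont_on dX dM D g -> C k g -> exists eta, 0 < eta /\
       forall g', cont_on dX dM D g' -> (forall x, D x -> dM (g x) (g' x) <= eta) -> C k g') ->
    (forall k g eps, cont_on dX dM D g -> 0 < eps -> exists g',
       cont_on dX dM D g' /\ eps_homotopic dX dM D eps g g' /\ C k g') ->
    forall g eps, cont_on dX dM D g -> 0 < eps -> exists g',
       cont_on dX dM D g' /\ eps_homotopic dX dM D eps g g' /\ forall k, C k g'.
  Proof.
    intros Hopen Hdense g eps Hg Heps.
    assert (Hstep : forall kst : nat * ((X -> M) * R), exists r : ((X -> M) * R) * (X -> R -> M),
      let k := fst kst in let st := snd kst in let st' := fst r in let h := snd r in
      cont_on dX dM D (fst st) /\ 0 < snd st ->
      (cont_on dX dM D (fst st') /\ 0 < snd st') /\ 2 * snd st' <= snd st /\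
      cont_on (dist_prod dX R_dist) dM (cylinder D) (fun p => h (fst p) (snd p)) /\
      (forall x, D x -> h x 0 = fst st x) /\ (forall x, D x -> h x 1 = fst st' x) /\
      (forall x, D x -> forall a b, unit_I a -> unit_I b -> dM (h x a) (h x b) <= snd st) /\
      (forall g', cont_on dX dM D g' -> (forall x, D x -> dM (fst st' x) (g' x) <= 2 * snd st') ->
         C k g')).
    { intros (k & (g1 & e1)). simpl.
      destruct (classic (cont_on dX dM D g1 /\ 0 < e1)) as [(Hg1 & He1)|Hn].
      2:{ exists ((g1, e1), fun x _ => g1 x). easy. }
      destruct (Hdense k g1 e1 Hg1 He1) as (g2 & Hg2 & (h & Hh & H01 & Hs) & HC).
      destruct (Hopen k g2 Hg2 HC) as (eta & Heta & HCo).
      pose proof (Rmin_l e1 eta). pose proof (Rmin_r e1 eta).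
      assert (0 < Rmin e1 eta) by now apply Rmin_glb_lt.
      (* All later moves add up to at most twice the new tolerance, that is to at most eta. *)
      exists ((g2, Rmin e1 eta / 2), h). simpl. intros _.
      split; [split; [easy|lra]|]. split; [lra|]. split; [now apply joint_continuity|].
      split; [intros; now apply H01|]. split; [intros; now apply H01|]. split.
      - intros x Hx a b Ha Hb. destruct (Hs x Hx) as (dl & Hdl & Hs').
        specialize (Hs' a b Ha Hb). lra.
      - intros g' Hg' Hcl. apply HCo; [easy|]. intros x Hx. specialize (Hcl x Hx). lra. }
    apply fun_choice in Hstep. destruct Hstep as (step & Hstep).
    (* With eps / 8 every track stays within eps / 4 of its start, so its diameter is at most eps /
       2. *)
    pose (st := fix st k := match k with O => (g, eps / 8) | S k' => fst (step (k', st k')) end).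
    assert (Hst : forall k, cont_on dX dM D (fst (st k)) /\ 0 < snd (st k)).
    { induction k as [|k IH]; [simpl; split; [easy|lra]|]. apply (Hstep (k, st k) IH). }
    pose proof (fun k => Hstep (k, st k) (Hst k)) as H. simpl in H.
    destruct (limit_homotopy (fun k => fst (st k)) (fun k => snd (step (k, st k)))
      (fun k => snd (st k))) as (G & HG & HG0 & HGc).
    - intros k. apply Hst.
    - intros k. apply H.
    - easy.
    - intros k. apply H.
    - intros k. apply H.
    - intros k. apply H.
    - intros k. apply H.
    - assert (Hcyl : forall x a, D x -> unit_I a -> cylinder D (x, a)) by (now split).
      assert (I1 : unit_I 1) by (split; lra).
      assert (Hg' : cont_on dX dM D (fun x => G (x, 1))).
      { apply (cont_comp dX (dist_prod dX R_dist) dM D (cylinder D) (fun x => (x, 1)) G);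
          [auto| |easy]. apply cont_pair; [apply cont_id|apply cont_const, R_dist_pmetric]. }
      exists (fun x => G (x, 1)). split; [easy|]. split.
      + exists (fun x a => G (x, a)). split; [|split].
        * apply joint_continuity; [easy|]. apply cont_ext with G; [now intros (x & a)|easy].
        * intros x Hx. split; [now apply HG0|easy].
        * intros x Hx. exists (eps / 2). split; [lra|]. intros a b Ha Hb.
          pose proof (HGc O (x, a) (Hcyl x a Hx Ha)) as K1.
          pose proof (HGc O (x, b) (Hcyl x b Hx Hb)) as K2. simpl in K1, K2.
          destruct HM as (_ & _ & Ms & Mt). pose proof (Mt (G (x, a)) (g x) (G (x, b))) as K3.
          rewrite (Ms (G (x, a)) (g x)) in K3. lra.
      + intros k. apply (H k); [easy|]. intros x Hx.
        (* At time 1 the partial homotopy of stage k + 1 is the map chosen to lie in C k. *)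
        pose proof (HGc (S k) (x, 1) (Hcyl x 1 Hx I1)) as K.
        rewrite (partial_homotopy_end (fun k => fst (st k)) (fun k => snd (step (k, st k)))) in K;
          [exact K|intros j y Hy; now apply (H j)|easy|].
        simpl. unfold knot. pose proof (half_pow (S k)). lra.
  Qed.
End HomotopicalBaire.

(** * Upper bound for the covering dimension *)

Lemma nat_pigeonhole n (f : nat -> nat) : (forall i, (i <= n)%nat -> (f i < n)%nat) ->
  exists i j, (i < j <= n)%nat /\ f i = f j.
Proof.
  intros Hf. apply NNPP. intros Hn.
  assert (Hnd : NoDup (map f (seq 0 (S n)))).
  { apply NoDup_map_NoDup_ForallPairs; [|apply seq_NoDup].
    intros i j Hi Hj E. apply in_seq in Hi, Hj.
    destruct (Nat.lt_total i j) as [Hlt|[He|Hlt]]; [|easy|];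
      exfalso; apply Hn; [exists i, j|exists j, i]; split; auto; lia. }
  apply NoDup_incl_length with (l' := seq 0 n) in Hnd.
  - rewrite length_map, !length_seq in Hnd. lia.
  - intros y Hy. apply in_map_iff in Hy. destruct Hy as (i & <- & Hi).
    apply in_seq in Hi. apply in_seq. specialize (Hf i). lia.
Qed.

Lemma open_finite_inter {X : Type} (d : X -> X -> R) n (P : nat -> X -> Prop) :
  (forall k, (k < n)%nat -> is_open d (P k)) ->
  is_open d (fun x => forall k, (k < n)%nat -> P k x).
Proof.
  induction n as [|n IH]; intros H x Hx.
  - exists 1. split; [lra|]. intros. lia.
  - destruct (IH (fun k Hk => H k (Nat.lt_lt_succ_r _ _ Hk)) x) as (r1 & Hr1 & H1); [auto with arith|].
    destruct (H n (Nat.lt_succ_diag_r n) x) as (r2 & Hr2 & H2); [auto with arith|].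
    exists (Rmin r1 r2). split; [now apply Rmin_glb_lt|]. intros y Hy k Hk.
    pose proof (Rmin_l r1 r2). pose proof (Rmin_r r1 r2).
    destruct (Nat.eq_dec k n) as [->|]; [apply H2|apply H1]; try lra. lia.
Qed.

(* The open cubes of side h of the grid shifted by i h / (n+1) in every coordinate. A point lies on
   a wall of at most one of the n+1 shifted grids per coordinate, hence inside a cube of at
   least one grid. *)
Definition grid_cell (n : nat) (h : R) (i : nat) (a : nat -> Z) (x : nat -> R) : Prop :=
  forall k, (k < n)%nat ->
    INR i * h / INR (S n) + h * IZR (a k) < x k < INR i * h / INR (S n) + h * (IZR (a k) + 1).

Lemma grid_cell_unique n h i a b x : 0 < h -> grid_cell n h i a x -> grid_cell n h i b x ->
  forall k, (k < n)%nat -> a k = b k.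
Proof.
  intros Hh Ha Hb k Hk. specialize (Ha k Hk). specialize (Hb k Hk).
  assert (H1 : IZR (a k) < IZR (b k) + 1) by (apply Rmult_lt_reg_l with h; lra).
  assert (H2 : IZR (b k) < IZR (a k) + 1) by (apply Rmult_lt_reg_l with h; lra).
  rewrite <- plus_IZR in H1, H2. apply lt_IZR in H1, H2. lia.
Qed.

(** The label a is set to 0 from n on so that a cell has exactly one label; cells are later
    identified through equality of labels. *)
Lemma grid_cell_exists n h x : 0 < h ->
  exists i a, (i <= n)%nat /\ (forall k, (n <= k)%nat -> a k = 0%Z) /\ grid_cell n h i a x.
Proof.
  intros Hh. apply NNPP. intros Hn.
  pose proof (lt_0_INR (S n) ltac:(lia)) as HN.
  assert (H : forall i, exists k, (i <= n)%nat -> (k < n)%nat /\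
            exists z, x k = INR i * h / INR (S n) + h * IZR z).
  { intros i. destruct (classic (exists k, (k < n)%nat /\
      exists z, x k = INR i * h / INR (S n) + h * IZR z)) as [(k & Hk)|Hk]; [now exists k|].
    exists O. intros Hi. exfalso. apply Hn.
    exists i, (fun k => if lt_dec k n then Int_part ((x k - INR i * h / INR (S n)) / h) else 0%Z).
    split; [easy|]. split; [intros k Hk'; destruct lt_dec; [lia|easy]|].
    intros k Hkn. destruct lt_dec as [_|]; [|easy].
    set (o := INR i * h / INR (S n)) in *. set (r := (x k - o) / h).
    destruct (base_Int_part r) as (H1 & H2).
    assert (Er : x k = o + h * r) by (unfold r; field; lra).
    destruct (Req_dec (IZR (Int_part r)) r) as [E|E].
    { exfalso. apply Hk. exists k. split; [easy|]. exists (Int_part r). now rewrite E. }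
    rewrite Er. split; apply Rplus_lt_compat_l, Rmult_lt_compat_l; lra. }
  apply fun_choice in H. destruct H as (w & Hw).
  destruct (nat_pigeonhole n w) as (i & j & Hij & E); [intros i Hi; now apply Hw|].
  destruct (Hw i ltac:(lia)) as (_ & z & Hz). destruct (Hw j ltac:(lia)) as (_ & z' & Hz').
  rewrite <- E, Hz in Hz'.
  assert (E1 : INR i + INR (S n) * IZR z = INR j + INR (S n) * IZR z').
  { apply Rmult_eq_reg_l with (h / INR (S n)).
    - transitivity (INR i * h / INR (S n) + h * IZR z); [field; lra|]. rewrite Hz'. field. lra.
    - apply Rgt_not_eq, Rdiv_lt_0_compat; lra. }
  rewrite !INR_IZR_INZ, <- !mult_IZR, <- !plus_IZR in E1. apply eq_IZR in E1.
  (* One coordinate on walls of two grids would make j - i, which lies between 1 and n, a multiple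
     of n + 1. *)
  assert (E2 : (Z.of_nat (S n) * (z - z') = Z.of_nat j - Z.of_nat i)%Z) by lia.
  destruct (Z_le_gt_dec (z - z') 0); nia.
Qed.

(** The grid cells are pulled back along q. A point lies in at most one cell of each of the n + 1
    grids, which bounds the order. Since [dim_le] wants a finite family, cells of the same grid that
    are assigned to the same member of U are merged: the index j stands for grid j / k and member j
    mod k. *)
Lemma dim_le_coordinates {X : Type} (d : X -> X -> R) n (A : X -> Prop) (q : X -> nat -> R) C :
  pmetric d -> seq_compact d A ->
  (forall x y i, (i < n)%nat -> Rabs (q x i - q y i) <= d x y) -> 0 <= C ->
  (forall x y, A x -> A y -> d x y <= C * dist_fin n (q x) (q y)) ->
  dim_le d A n.
Proof.
  intros Hd HA Hq HC Hbi k U HU Hc.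
  destruct (lebesgue_number d A U (fun i => (i < k)%nat) Hd HA HU Hc) as (lam & Hlam & HL).
  pose proof (pos_INR n) as Hn0.
  assert (HCn : 0 <= C * INR n) by now apply Rmult_le_pos.
  (* Two points of one cell are at [dist_fin n]-distance at most n * h, so the points of A over a
     cell are less than lam apart. The + 1 covers a vanishing C * n. *)
  set (h := lam / (C * INR n + 1)).
  assert (Hh : 0 < h) by (apply Rdiv_lt_0_compat; lra).
  assert (Hhl : C * (INR n * h) < lam).
  { replace lam with ((C * INR n + 1) * h) by (unfold h; field; lra). lra. }
  assert (Hcell : forall ia : nat * (nat -> Z), exists u,
    (exists x, A x /\ grid_cell n h (fst ia) (snd ia) (q x)) ->
    (u < k)%nat /\ forall x, A x -> grid_cell n h (fst ia) (snd ia) (q x) -> U u x).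
  { intros (i & a). simpl. destruct (classic (exists x, A x /\ grid_cell n h i a (q x)))
      as [(x & Hx & Hxa)|Hno]; [|now exists O].
    destruct (HL x Hx) as (u & Hu & HB). exists u. intros _. split; [easy|].
    intros y Hy Hya. apply HB. eapply Rle_lt_trans; [now apply Hbi|].
    eapply Rle_lt_trans; [|apply Hhl]. apply Rmult_le_compat_l; [easy|].
    rewrite <- sumN_const. apply sumN_le. intros l Hl.
    specialize (Hxa l Hl). specialize (Hya l Hl). apply Rabs_le. lra. }
  apply fun_choice in Hcell. destruct Hcell as (c & Hcell).
  exists (S n * k)%nat, (fun j x => exists a, (forall l, (n <= l)%nat -> a l = 0%Z) /\
    grid_cell n h (j / k) a (q x) /\ c ((j / k)%nat, a) = (j mod k)%nat).
  split; [|split; [|split]].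
  - intros j Hj x (a & Ha0 & Ha & Hca).
    assert (Ho : is_open d (fun x => grid_cell n h (j / k) a (q x))).
    { apply (open_finite_inter d n (fun l x => INR (j / k) * h / INR (S n) + h * IZR (a l) < q x l <
         INR (j / k) * h / INR (S n) + h * (IZR (a l) + 1))).
      intros l Hl y (Hy1 & Hy2).
      exists (Rmin (q y l - (INR (j / k) * h / INR (S n) + h * IZR (a l)))
                   (INR (j / k) * h / INR (S n) + h * (IZR (a l) + 1) - q y l)).
      split; [apply Rmin_glb_lt; lra|]. intros z Hz.
      pose proof (Rle_lt_trans _ _ _ (Hq y z l Hl) Hz) as Hyz. apply Rabs_def2 in Hyz.
      pose proof (Rmin_l (q y l - (INR (j / k) * h / INR (S n) + h * IZR (a l)))
                   (INR (j / k) * h / INR (S n) + h * (IZR (a l) + 1) - q y l)).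
      pose proof (Rmin_r (q y l - (INR (j / k) * h / INR (S n) + h * IZR (a l)))
                   (INR (j / k) * h / INR (S n) + h * (IZR (a l) + 1) - q y l)).
      lra. }
    destruct (Ho x Ha) as (r & Hr & H). exists r. split; [easy|]. intros y Hy. exists a. auto.
  - intros x Hx. destruct (grid_cell_exists n h (q x) Hh) as (i & a & Hi & Ha0 & Ha).
    destruct (Hcell (i, a)) as (Hu & _); [simpl; eauto|].
    exists (i * k + c (i, a))%nat. split; [nia|]. exists a.
    rewrite Nat.div_add_l, Nat.div_small, Nat.add_0_r by lia.
    rewrite Nat.add_comm, Nat.Div0.mod_add, Nat.mod_small by lia. auto.
  - intros j Hj. assert (Hk : k <> O) by (intros ->; lia).
    exists (j mod k)%nat. split; [now apply Nat.mod_upper_bound|].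
    intros x Hx (a & Ha0 & Ha & <-). apply (Hcell ((j / k)%nat, a)); simpl; eauto.
  - intros x Hx J HJ HJx.
    rewrite <- (length_map (fun j => (j / k)%nat) J), <- (length_seq (S n) 0).
    apply NoDup_incl_length.
    + apply NoDup_map_NoDup_ForallPairs; [|easy]. intros j j' Hj Hj' E.
      destruct (HJx j Hj) as (Hjm & a & Ha0 & Ha & Hca).
      destruct (HJx j' Hj') as (Hjm' & a' & Ha0' & Ha' & Hca').
      assert (Ea : a = a').
      { apply functional_extensionality. intros l. destruct (le_lt_dec n l).
        - now rewrite Ha0, Ha0'.
        - rewrite <- E in Ha'. now apply (grid_cell_unique n h (j / k) a a' (q x)). }
      rewrite <- E, <- Ea, Hca in Hca'.
      rewrite (Nat.div_mod_eq j k), (Nat.div_mod_eq j' k). now rewrite E, Hca'.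
    + intros i Hi. apply in_map_iff in Hi. destruct Hi as (j & <- & Hj).
      destruct (HJx j Hj) as (Hjm & _). apply in_seq.
      assert (j / k < S n)%nat; [|lia]. apply Nat.Div0.div_lt_upper_bound. lia.
Qed.

(** * A discrete Poincaré–Miranda theorem over the field with two elements *)

(** Summation in the field with two elements: no orientation signs occur in the cochain calculus. *)
Definition xsum (l : list nat) (F : nat -> bool) : bool :=
  fold_right (fun a b => xorb (F a) b) false l.

Lemma xsum_ext l F G : (forall i, In i l -> F i = G i) -> xsum l F = xsum l G.
Proof.
  induction l as [|a l IH]; intros H; [easy|]. simpl.
  now rewrite (IH (fun i Hi => H i (or_intror Hi))), (H a (or_introl eq_refl)).
Qed.

Lemma xsum_xor l F G : xsum l (fun i => xorb (F i) (G i)) = xorb (xsum l F) (xsum l G).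
Proof.
  induction l as [|a l IH]; [easy|]. simpl. rewrite IH.
  destruct (F a), (G a), (xsum l F), (xsum l G); easy.
Qed.

Lemma xsum_and l b F : xsum l (fun i => andb b (F i)) = andb b (xsum l F).
Proof.
  induction l as [|a l IH]; simpl; [now destruct b|]. rewrite IH. now destruct b, (F a), (xsum l F).
Qed.

Lemma xsum_false l F : (forall i, In i l -> F i = false) -> xsum l F = false.
Proof.
  induction l as [|a l IH]; intros H; [easy|]. simpl.
  now rewrite (IH (fun i Hi => H i (or_intror Hi))), (H a (or_introl eq_refl)).
Qed.

Lemma xsum_true_exists l F : xsum l F = true -> exists i, In i l /\ F i = true.
Proof.
  intros H. apply NNPP. intros Hn. rewrite xsum_false in H; [easy|]. intros i Hi.
  apply Bool.not_true_is_false. intros E. eauto.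
Qed.

Lemma xsum_remove i l F :
  xsum (remove Nat.eq_dec i l) F = xsum l (fun j => if Nat.eq_dec i j then false else F j).
Proof.
  induction l as [|a l IH]; [easy|]. simpl. destruct (Nat.eq_dec i a); [easy|].
  simpl. now rewrite IH.
Qed.

Lemma xsum_exchange l l' F :
  xsum l (fun i => xsum l' (fun j => F i j)) = xsum l' (fun j => xsum l (fun i => F i j)).
Proof.
  induction l as [|a l IH]; simpl.
  - symmetry. now apply xsum_false.
  - rewrite IH. now rewrite <- xsum_xor.
Qed.

Lemma xsum_symmetric l F :
  (forall i j, In i l -> In j l -> F i j = F j i) -> (forall i, F i i = false) ->
  xsum l (fun i => xsum l (fun j => F i j)) = false.
Proof.
  intros Hs H0. induction l as [|a l IH]; [easy|]. simpl.
  rewrite H0, (xsum_xor l (fun i => F i a)), IH by (intros; apply Hs; now right).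
  rewrite (xsum_ext l (fun i => F i a) (fun i => F a i)) by (intros; apply Hs; simpl; auto).
  rewrite Bool.xorb_false_l, Bool.xorb_false_r. apply Bool.xorb_nilpotent.
Qed.

Lemma pair_xsum_swap l F :
  xsum l (fun i => xsum (remove Nat.eq_dec i l) (fun j => F i j)) =
  xsum l (fun i => xsum (remove Nat.eq_dec i l) (fun j => F j i)).
Proof.
  rewrite (xsum_ext l _ (fun i => xsum l (fun j => if Nat.eq_dec i j then false else F i j)))
    by (intros; apply xsum_remove).
  rewrite xsum_exchange. apply xsum_ext. intros i _. rewrite xsum_remove. apply xsum_ext.
  intros j _. destruct (Nat.eq_dec i j), (Nat.eq_dec j i); congruence.
Qed.

Lemma pair_xsum_symmetric l F : (forall i j, In i l -> In j l -> F i j = F j i) ->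
  xsum l (fun i => xsum (remove Nat.eq_dec i l) (fun j => F i j)) = false.
Proof.
  intros H.
  rewrite (xsum_ext l _ (fun i => xsum l (fun j => if Nat.eq_dec i j then false else F i j)))
    by (intros; apply xsum_remove).
  apply xsum_symmetric.
  - intros i j Hi Hj. destruct (Nat.eq_dec i j), (Nat.eq_dec j i); try congruence. auto.
  - intros i. now destruct (Nat.eq_dec i i).
Qed.

Definition bump (i : nat) (x : nat -> nat) (j : nat) : nat :=
  if Nat.eq_dec j i then S (x j) else x j.

Definition set_at (i v : nat) (x : nat -> nat) (j : nat) : nat :=
  if Nat.eq_dec j i then v else x j.

Lemma bump_comm i j x : bump i (bump j x) = bump j (bump i x).
Proof.
  apply functional_extensionality. intros k. unfold bump.
  destruct (Nat.eq_dec k i), (Nat.eq_dec k j); easy.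
Qed.

Lemma bump_set_at i v x : bump i (set_at i v x) = set_at i (S v) x.
Proof.
  apply functional_extensionality. intros k. unfold bump, set_at. now destruct (Nat.eq_dec k i).
Qed.

Lemma set_at_comm i j v w x : i <> j -> set_at i v (set_at j w x) = set_at j w (set_at i v x).
Proof.
  intros Hij. apply functional_extensionality. intros k. unfold set_at.
  destruct (Nat.eq_dec k i), (Nat.eq_dec k j); congruence.
Qed.

(* The cubical cup product of the coboundaries of the functions in [ps], evaluated on the
   cube at x spanned by the directions S. *)
Fixpoint cup (ps : list ((nat -> nat) -> bool)) (S : list nat) (x : nat -> nat) : bool :=
  match ps with
  | nil => true
  | psi :: ps' => xsum S (fun i =>
      andb (xorb (psi (bump i x)) (psi x)) (cup ps' (remove Nat.eq_dec i S) (bump i x)))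
  end.

(** A cup product of coboundaries is a cocycle: the sum runs over the pairs of opposite faces of the
    cube. Expanding the first factor gives four double sums over two directions i, j. The one with
    psi at the far corner is symmetric and cancels modulo 2, the one with psi x becomes symmetric by
    induction, and the remaining two cancel by induction after exchanging i and j. *)
Lemma cup_closed ps : forall S x,
  xsum S (fun i => xorb (cup ps (remove Nat.eq_dec i S) (bump i x))
                        (cup ps (remove Nat.eq_dec i S) x)) = false.
Proof.
  induction ps as [|psi ps IH]; intros S x; [now apply xsum_false|]. cbn [cup].
  set (q := fun i j y => cup ps (remove Nat.eq_dec j (remove Nat.eq_dec i S)) y).
  assert (Hq : forall i j y, q i j y = q j i y) by (intros; unfold q; now rewrite remove_remove_comm).
  transitivity (xsum S (fun i => xsum (remove Nat.eq_dec i S) (fun j =>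
    xorb (xorb (andb (psi (bump j (bump i x))) (q i j (bump j (bump i x))))
               (andb (psi (bump i x)) (q i j (bump j (bump i x)))))
         (xorb (andb (psi (bump j x)) (q i j (bump j x)))
               (andb (psi x) (q i j (bump j x))))))).
  { apply xsum_ext. intros i _. rewrite <- xsum_xor. apply xsum_ext. intros j _.
    change (cup ps (remove Nat.eq_dec j (remove Nat.eq_dec i S))) with (q i j).
    now destruct (psi (bump j (bump i x))), (psi (bump i x)), (psi (bump j x)), (psi x),
      (q i j (bump j (bump i x))), (q i j (bump j x)). }
  assert (Split : forall A B : nat -> nat -> bool,
    xsum S (fun i => xsum (remove Nat.eq_dec i S) (fun j => xorb (A i j) (B i j))) =
    xorb (xsum S (fun i => xsum (remove Nat.eq_dec i S) (fun j => A i j)))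
         (xsum S (fun i => xsum (remove Nat.eq_dec i S) (fun j => B i j)))).
  { intros A B. rewrite <- xsum_xor. apply xsum_ext. intros i _. apply xsum_xor. }
  rewrite !Split.
  rewrite (pair_xsum_symmetric S (fun i j => andb (psi (bump j (bump i x))) (q i j (bump j (bump i x)))))
    by (intros i j _ _; now rewrite (bump_comm j i), (Hq i j)).
  rewrite (pair_xsum_swap S (fun i j => andb (psi (bump j x)) (q i j (bump j x)))).
  assert (E4 : xsum S (fun i => xsum (remove Nat.eq_dec i S) (fun j => andb (psi x) (q i j (bump j x))))
               = false).
  { transitivity (andb (psi x) (xsum S (fun i => xsum (remove Nat.eq_dec i S) (fun j => q i j x)))).
    - rewrite <- xsum_and. apply xsum_ext. intros i _. rewrite <- xsum_and.
      apply Bool.xorb_eq. rewrite <- xsum_xor.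
      transitivity (andb (psi x) (xsum (remove Nat.eq_dec i S)
         (fun j => xorb (q i j (bump j x)) (q i j x)))).
      + rewrite <- xsum_and. apply xsum_ext. intros j _. now destruct (psi x), (q i j (bump j x)), (q i j x).
      + unfold q. rewrite IH. apply Bool.andb_false_r.
    - rewrite pair_xsum_symmetric by auto. apply Bool.andb_false_r. }
  rewrite E4, Bool.xorb_false_l, Bool.xorb_false_r, <- Split.
  apply xsum_false. intros i _.
  transitivity (andb (psi (bump i x)) (xsum (remove Nat.eq_dec i S)
         (fun j => xorb (q i j (bump j (bump i x))) (q i j (bump i x))))).
  - rewrite <- xsum_and. apply xsum_ext. intros j _. rewrite (Hq j i).
    now destruct (psi (bump i x)), (q i j (bump j (bump i x))), (q i j (bump i x)).
  - unfold q. rewrite IH. apply Bool.andb_false_r.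
Qed.

(** The Leibniz rule with a closed second factor: d psi cup omega = d (psi omega). The two sides
    differ by psi x times the sum that [cup_closed] makes zero. *)
Lemma cup_exact psi ps S x :
  cup (psi :: ps) S x =
  xsum S (fun i => xorb (andb (psi (bump i x)) (cup ps (remove Nat.eq_dec i S) (bump i x)))
                        (andb (psi x) (cup ps (remove Nat.eq_dec i S) x))).
Proof.
  apply Bool.xorb_eq. cbn [cup]. rewrite <- xsum_xor.
  transitivity (andb (psi x) (xsum S (fun i => xorb (cup ps (remove Nat.eq_dec i S) (bump i x))
                        (cup ps (remove Nat.eq_dec i S) x)))).
  - rewrite <- xsum_and. apply xsum_ext. intros i _.
    now destruct (psi (bump i x)), (psi x), (cup ps (remove Nat.eq_dec i S) (bump i x)),
      (cup ps (remove Nat.eq_dec i S) x).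
  - rewrite cup_closed. apply Bool.andb_false_r.
Qed.

(** Integration of a cochain modulo 2 over the box [0,N]^D, each unit cube being represented by its
    lowest corner; the coordinates off D are those of x. *)
Fixpoint box_sum (N : nat) (D : list nat) (F : (nat -> nat) -> bool) (x : nat -> nat) : bool :=
  match D with
  | nil => F x
  | a :: D' => xsum (seq 0 N) (fun v => box_sum N D' F (set_at a v x))
  end.

Lemma box_sum_xsum N D l (F : nat -> (nat -> nat) -> bool) x :
  box_sum N D (fun y => xsum l (fun i => F i y)) x = xsum l (fun i => box_sum N D (F i) x).
Proof.
  revert x. induction D as [|a D IH]; intros x; simpl; [easy|].
  rewrite <- xsum_exchange. apply xsum_ext. auto.
Qed.

Lemma box_sum_ext N D F G x : (forall y, F y = G y) -> box_sum N D F x = box_sum N D G x.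
Proof.
  intros H. revert x. induction D as [|a D IH]; intros x; simpl; [easy|]. apply xsum_ext. auto.
Qed.

Lemma box_sum_false N D F x : (forall y, F y = false) -> box_sum N D F x = false.
Proof.
  intros H. revert x. induction D as [|a D IH]; intros x; simpl; [easy|]. now apply xsum_false.
Qed.

Lemma box_sum_set_at N D F i v x : ~ In i D ->
  box_sum N D F (set_at i v x) = box_sum N D (fun y => F (set_at i v y)) x.
Proof.
  revert x. induction D as [|a D IH]; intros x Hi; simpl; [easy|]. apply xsum_ext.
  intros w _. simpl in Hi. rewrite set_at_comm by tauto. apply IH. tauto.
Qed.

Lemma telescope N (f : nat -> bool) :
  xsum (seq 0 N) (fun v => xorb (f (S v)) (f v)) = xorb (f N) (f O).
Proof.
  enough (H : forall a, xsum (seq a N) (fun v => xorb (f (S v)) (f v)) = xorb (f (a + N)%nat) (f a))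
    by apply H.
  induction N as [|N IH]; intros a; simpl.
  - rewrite Nat.add_0_r. now destruct (f a).
  - rewrite IH. replace (a + S N)%nat with (S a + N)%nat by lia.
    now destruct (f (S a + N)%nat), (f (S a)), (f a).
Qed.

Lemma box_sum_telescope N D G i x : NoDup D -> In i D ->
  box_sum N D (fun y => xorb (G (bump i y)) (G y)) x =
  box_sum N (remove Nat.eq_dec i D) (fun y => xorb (G (set_at i N y)) (G (set_at i O y))) x.
Proof.
  intros Hnd. revert x. induction Hnd as [|a D Ha Hnd IH]; intros x Hi; [easy|].
  simpl. destruct (Nat.eq_dec i a) as [<-|Hne].
  - rewrite notin_remove by easy.
    rewrite (xsum_ext _ _ (fun v => box_sum N D
      (fun y => xorb (G (set_at i (S v) y)) (G (set_at i v y))) x)).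
    + rewrite <- box_sum_xsum. apply box_sum_ext. intros y.
      apply (telescope N (fun v => G (set_at i v y))).
    + intros v _. rewrite box_sum_set_at by easy. apply box_sum_ext. intros y.
      now rewrite bump_set_at.
  - simpl. apply xsum_ext. intros v _. apply IH. destruct Hi; congruence.
Qed.

(** A cube without direction i stays in a hyperplane on which the i-th coordinate is constant. There
    psi is constant, so its coboundary vanishes on every edge. *)
Lemma cup_degenerate ps psi i S x :
  In psi ps -> ~ In i S -> (forall y z, y i = x i -> z i = x i -> psi y = psi z) ->
  cup ps S x = false.
Proof.
  revert S x. induction ps as [|phi ps IH]; intros S x Hin Hi Hc; [easy|]. cbn [cup].
  apply xsum_false. intros j Hj. assert (Hne : i <> j) by congruence.
  assert (Eb : bump j x i = x i) by (unfold bump; now destruct (Nat.eq_dec i j)).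
  destruct Hin as [->|Hin].
  - rewrite (Hc (bump j x) x), Bool.xorb_nilpotent; auto.
  - rewrite IH, Bool.andb_false_r; auto.
    + intros Hr. apply in_remove in Hr. tauto.
    + now rewrite Eb.
Qed.

(* Stokes: only the face x_a = N of the first direction contributes, since the coboundary of
   psi_i vanishes on the faces orthogonal to i. *)
Lemma box_sum_cup N (psi : nat -> (nat -> nat) -> bool) D :
  NoDup D ->
  (forall a x, In a D -> x a = O -> psi a x = false) ->
  (forall a x, In a D -> x a = N -> psi a x = true) ->
  forall x, box_sum N D (cup (map psi D) D) x = true.
Proof.
  intros Hnd. induction Hnd as [|a D Ha Hnd IH]; intros H0 HN x; [easy|].
  cbn [map]. rewrite (box_sum_ext _ _ _ _ _ (cup_exact (psi a) (map psi D) (a :: D))).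
  rewrite box_sum_xsum.
  set (G := fun i y => andb (psi a y) (cup (map psi D) (remove Nat.eq_dec i (a :: D)) y)).
  rewrite (xsum_ext _ _ (fun i => box_sum N (remove Nat.eq_dec i (a :: D))
    (fun y => xorb (G i (set_at i N y)) (G i (set_at i O y))) x)).
  2:{ intros i Hi. apply (box_sum_telescope N (a :: D) (G i) i x); [now constructor|easy]. }
  cbn [xsum fold_right]. fold (xsum D (fun i => box_sum N (remove Nat.eq_dec i (a :: D))
    (fun y => xorb (G i (set_at i N y)) (G i (set_at i O y))) x)).
  assert (Hset : forall i v y, set_at i v y i = v)
    by (intros; unfold set_at; now destruct (Nat.eq_dec i i)).
  rewrite xsum_false, Bool.xorb_false_r.
  - assert (Er : remove Nat.eq_dec a (a :: D) = D).
    { simpl. destruct (Nat.eq_dec a a); [|easy]. now apply notin_remove. }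
    unfold G. rewrite Er. rewrite <- (IH (fun b y Hb => H0 b y (or_intror Hb))
      (fun b y Hb => HN b y (or_intror Hb)) (set_at a N x)).
    rewrite box_sum_set_at by easy. apply box_sum_ext. intros y.
    rewrite HN, H0; simpl; auto. apply Bool.xorb_false_r.
  - intros i Hi. apply box_sum_false. intros y. unfold G.
    assert (Hz : forall v, (v = O \/ v = N) -> cup (map psi D) (remove Nat.eq_dec i (a :: D)) (set_at i v y) = false).
    { intros v Hv. apply (cup_degenerate _ (psi i) i); [now apply in_map|apply remove_In|].
      rewrite Hset. intros u w Hu Hw.
      destruct Hv as [->| ->]; [rewrite !H0|rewrite !HN]; simpl; auto. }
    rewrite !Hz, !Bool.andb_false_r; auto.
Qed.

Lemma box_sum_true_exists N D F x : NoDup D -> box_sum N D F x = true ->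
  exists y, F y = true /\ (forall i, In i D -> (y i < N)%nat) /\ (forall i, ~ In i D -> y i = x i).
Proof.
  intros Hnd. revert x. induction Hnd as [|a D Ha Hnd IH]; intros x H; simpl in H.
  - exists x. now repeat split.
  - apply xsum_true_exists in H. destruct H as (v & Hv & H). apply in_seq in Hv.
    destruct (IH _ H) as (y & Hy & Hin & Hout). exists y. split; [easy|]. split.
    + intros i [<-|Hi]; auto. rewrite Hout by easy. unfold set_at.
      destruct (Nat.eq_dec a a); [lia|easy].
    + intros i Hi. simpl in Hi. rewrite Hout by tauto. unfold set_at.
      destruct (Nat.eq_dec i a); [subst; tauto|easy].
Qed.

Definition in_cube_at (x : nat -> nat) (S : list nat) (u : nat -> nat) : Prop :=
  forall j, (x j <= u j)%nat /\ (u j <= if in_dec Nat.eq_dec j S then 1 + x j else x j)%nat.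

(** Each factor of the product is evaluated on an edge of the cube, so a nonzero summand gives an
    edge along which psi changes. *)
Lemma cup_true_jump ps S x psi : cup ps S x = true -> In psi ps ->
  exists u v, in_cube_at x S u /\ in_cube_at x S v /\ psi u = true /\ psi v = false.
Proof.
  revert S x. induction ps as [|phi ps IH]; intros S x H Hin; [easy|]. cbn [cup] in H.
  apply xsum_true_exists in H. destruct H as (i & Hi & H). apply andb_prop in H.
  destruct H as (Hj & Hc). destruct Hin as [->|Hin].
  - assert (H1 : in_cube_at x S x).
    { intros j. destruct in_dec; lia. }
    assert (H2 : in_cube_at x S (bump i x)).
    { intros j. unfold bump. destruct (Nat.eq_dec j i) as [->|]; destruct in_dec; try lia. easy. }
    destruct (psi (bump i x)) eqn:E1, (psi x) eqn:E2; try easy;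
      [exists (bump i x), x|exists x, (bump i x)]; auto.
  - destruct (IH _ _ Hc Hin) as (u & v & Hu & Hv & Huv).
    assert (Hw : forall w, in_cube_at (bump i x) (remove Nat.eq_dec i S) w -> in_cube_at x S w).
    { intros w Hw j. specialize (Hw j). unfold bump in Hw. revert Hw.
      destruct (in_dec Nat.eq_dec j (remove Nat.eq_dec i S)) as [Hr|Hr].
      - apply in_remove in Hr. destruct (Nat.eq_dec j i); destruct in_dec; try lia; tauto.
      - destruct (Nat.eq_dec j i) as [->|]; destruct in_dec; try lia. easy. }
    exists u, v. auto.
Qed.

(** The cup product of the k coboundaries integrates to 1 over the box, hence is nonzero on some
    cube; on that cube each psi a takes both values. *)
Lemma discrete_poincare_miranda k N (psi : nat -> (nat -> nat) -> bool) :
  (forall a x, (a < k)%nat -> x a = O -> psi a x = false) ->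
  (forall a x, (a < k)%nat -> x a = N -> psi a x = true) ->
  exists x, (forall i, (i < k)%nat -> (x i < N)%nat) /\
    forall a, (a < k)%nat -> exists u v, psi a u = true /\ psi a v = false /\
      forall i, (i < k)%nat -> (x i <= u i <= 1 + x i /\ x i <= v i <= 1 + x i)%nat.
Proof.
  intros H0 HN.
  assert (H : box_sum N (seq 0 k) (cup (map psi (seq 0 k)) (seq 0 k)) (fun _ => O) = true).
  { apply box_sum_cup; [apply seq_NoDup| |]; intros a x Ha; apply in_seq in Ha; [apply H0|apply HN]; lia. }
  apply box_sum_true_exists in H; [|apply seq_NoDup]. destruct H as (x & Hc & Hx & _).
  exists x. split; [intros i Hi; apply Hx, in_seq; lia|]. intros a Ha.
  destruct (cup_true_jump _ _ _ (psi a) Hc) as (u & v & Hu & Hv & E1 & E2).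
  { apply in_map, in_seq. lia. }
  exists u, v. repeat split; auto; try apply Hu; try apply Hv.
  - specialize (Hu i). destruct in_dec in Hu; lia.
  - specialize (Hv i). destruct in_dec in Hv; lia.
Qed.

(** * Lower bound for the covering dimension *)

(* Each set V (i+1) is compared with V 0 through the radii of the balls around x that they
   contain; at a cell where no comparison is decided all these radii nearly agree. *)
Lemma cube_kkm k (V : nat -> (nat -> R) -> Prop) :
  (forall i, (i <= k)%nat -> is_open (dist_fin k) (V i)) ->
  (forall x, cube k x -> exists i, (i <= k)%nat /\ V i x) ->
  (forall x i, cube k x -> (i < k)%nat -> V (S i) x -> x i <> 0) ->
  (forall x i, cube k x -> (i < k)%nat -> V O x -> x i <> 1) ->
  exists x, cube k x /\ forall i, (i <= k)%nat -> V i x.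
Proof.
  intros Hopen Hcov Hlow Hhigh.
  pose proof (dist_fin_pmetric k) as Hd.
  destruct (lebesgue_number (dist_fin k) (cube k) V (fun i => (i <= k)%nat) Hd
    (cube_compact k) Hopen Hcov) as (c & Hc & HL).
  destruct Hd as (D0 & Ds & Dt).
  (* The bound mu is the [dist_fin]-diameter of a grid cell. Two comparisons below cost 2 * mu each,
     so 4 * mu < c is needed. *)
  destruct (inv_INR_small (c / (4 * (INR k + 1)))) as (N' & HN').
  { apply Rdiv_lt_0_compat; [easy|]. pose proof (pos_INR k). lra. }
  specialize (HN' N' (le_n _)). set (N := S N') in *.
  assert (HN : 0 < INR N) by (apply lt_0_INR; lia).
  set (mu := INR k * / INR N).
  assert (Hmu0 : 0 <= mu).
  { apply Rmult_le_pos; [apply pos_INR|]. left. now apply Rinv_0_lt_compat. }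
  assert (Hmu : 4 * mu < c).
  { pose proof (pos_INR k). pose proof (Rinv_0_lt_compat _ HN).
    apply Rmult_lt_compat_l with (r := 4 * (INR k + 1)) in HN'; [|lra].
    replace (4 * (INR k + 1) * (c / (4 * (INR k + 1)))) with c in HN' by (field; lra).
    unfold mu. nra. }
  clear HN'.
  pose (pt := fun (x : nat -> nat) i => if lt_dec i k then INR (x i) / INR N else 0).
  pose (ball := fun (P : (nat -> R) -> Prop) x r => forall y, dist_fin k x y < r -> P y).
  assert (Hpt : forall x, (forall i, (i < k)%nat -> (x i <= N)%nat) -> cube k (pt x)).
  { intros x Hx. split; intros i Hi; unfold pt; destruct lt_dec; try easy; try lia.
    split.
    - apply Rmult_le_pos; [apply pos_INR|]. left. now apply Rinv_0_lt_compat.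
    - apply Rmult_le_reg_r with (INR N); [easy|]. unfold Rdiv.
      rewrite Rmult_assoc, Rinv_l, Rmult_1_r, Rmult_1_l by lra. apply le_INR. auto. }
  assert (Hshrink : forall P x x' r, ball P x r -> dist_fin k x x' <= mu -> ball P x' (r - mu)).
  { intros P x x' r HB Hxx y Hy. apply HB. specialize (Dt x x' y). lra. }
  (* Inside the grid, psi j holds where V (j+1) contains a larger ball around the point than V 0
     does. The values on the two faces are forced by the boundary conditions; [Hhigh] and [Hlow]
     rule these forced values out when radii are compared. *)
  pose (psi := fun j (x : nat -> nat) =>
    if Nat.eq_dec (x j) 0 then false else if le_dec N (x j) then true else
    if excluded_middle_informative (exists r, 0 < r /\ ball (V (S j)) (pt x) r /\ ~ ball (V O) (pt x) r)
    then true else false).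
  destruct (discrete_poincare_miranda k N psi) as (x & Hx & Hjump).
  { intros a x _ E. unfold psi. destruct Nat.eq_dec; easy. }
  { intros a x _ E. unfold psi. destruct Nat.eq_dec; [lia|]. destruct le_dec; [easy|lia]. }
  assert (HX : cube k (pt x)) by (apply Hpt; intros i Hi; specialize (Hx i Hi); lia).
  assert (Hnear : forall u, (forall i, (i < k)%nat -> (x i <= u i <= 1 + x i)%nat) ->
            dist_fin k (pt x) (pt u) <= mu /\ cube k (pt u)).
  { intros u Hu. split.
    - unfold mu. rewrite <- sumN_const. apply sumN_le. intros i Hi. unfold pt.
      destruct lt_dec; [|easy]. specialize (Hu i Hi).
      replace (INR (x i) / INR N - INR (u i) / INR N) with ((INR (x i) - INR (u i)) * / INR N)
        by (unfold Rdiv; ring).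
      rewrite Rabs_mult, (Rabs_pos_eq (/ _)) by (left; now apply Rinv_0_lt_compat).
      rewrite <- (Rmult_1_l (/ INR N)) at 2.
      apply Rmult_le_compat_r; [left; now apply Rinv_0_lt_compat|].
      assert (INR (x i) <= INR (u i) <= 1 + INR (x i)); [|apply Rabs_le; lra].
      split; [apply le_INR; lia|]. replace (1 + INR (x i)) with (INR (1 + x i))
        by (rewrite plus_INR; simpl; lra). apply le_INR. lia.
    - apply Hpt. intros i Hi. specialize (Hu i Hi). specialize (Hx i Hi). lia. }
  assert (Up : forall j r, (j < k)%nat -> 2 * mu < r -> ball (V O) (pt x) r ->
            ball (V (S j)) (pt x) (r - 2 * mu)).
  { intros j r Hj Hr HB. destruct (Hjump j Hj) as (u & v & Hu & _ & Hc1).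
    destruct (Hnear u) as (Hdu & Hcu); [intros i Hi; now apply Hc1|].
    unfold psi in Hu. destruct Nat.eq_dec as [|_]; [easy|]. destruct le_dec as [Hle|_].
    - exfalso. apply (Hhigh (pt u) j Hcu Hj); [apply HB; lra|].
      specialize (Hc1 j Hj). specialize (Hx j Hj). unfold pt. destruct lt_dec; [|easy].
      replace (u j) with N by lia. field. lra.
    - destruct excluded_middle_informative as [(r0 & Hr0 & HB1 & HB2)|]; [|easy].
      apply (Hshrink _ _ _ _ HB) in Hdu as HBu.
      assert (Hrr : r - mu < r0).
      { apply Rnot_le_lt. intros Hle. apply HB2. intros y Hy. apply HBu. lra. }
      replace (r - 2 * mu) with (r - mu - mu) by lra.
      apply (Hshrink _ (pt u)); [|now rewrite Ds]. intros y Hy. apply HB1. lra. }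
  assert (Down : forall j r, (j < k)%nat -> 2 * mu < r -> ball (V (S j)) (pt x) r ->
            ball (V O) (pt x) (r - 2 * mu)).
  { intros j r Hj Hr HB. destruct (Hjump j Hj) as (u & v & _ & Hv & Hc1).
    destruct (Hnear v) as (Hdv & Hcv); [intros i Hi; now apply Hc1|].
    unfold psi in Hv. destruct Nat.eq_dec as [E|_].
    - exfalso. apply (Hlow (pt v) j Hcv Hj); [apply HB; lra|].
      unfold pt. destruct lt_dec; [|easy]. rewrite E. simpl. unfold Rdiv. ring.
    - destruct le_dec as [|_]; [easy|]. destruct excluded_middle_informative as [|Hn]; [easy|].
      replace (r - 2 * mu) with (r - mu - mu) by lra.
      apply (Hshrink _ (pt v)); [|now rewrite Ds]. apply NNPP. intros Hb. apply Hn.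
      exists (r - mu). split; [lra|]. split; [|easy]. now apply (Hshrink _ (pt x)). }
  exists (pt x). split; [easy|]. destruct (HL (pt x) HX) as (i0 & Hi0 & HB0).
  assert (HB : ball (V O) (pt x) (c - 2 * mu)).
  { destruct i0 as [|j]; [intros y Hy; apply HB0; lra|]. apply (Down j); [lia|lra|exact HB0]. }
  intros [|j] Hj; [apply HB; rewrite D0; lra|].
  apply (Up j (c - 2 * mu)); [lia|lra|easy|rewrite D0; lra].
Qed.

(** * Simplicial maps on a single simplex *)

Lemma simp_real_plus nK f t t' j :
  simp_real nK f (fun i => t i + t' i) j = simp_real nK f t j + simp_real nK f t' j.
Proof.
  unfold simp_real. rewrite <- sumN_plus. apply sumN_ext. intros i _. destruct Nat.eq_dec; lra.
Qed.

Lemma simp_real_minus nK f t t' j :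
  simp_real nK f (fun i => t i - t' i) j = simp_real nK f t j - simp_real nK f t' j.
Proof.
  unfold simp_real. rewrite <- sumN_minus. apply sumN_ext. intros i _. destruct Nat.eq_dec; lra.
Qed.

Lemma simp_real_scal nK f c t j :
  simp_real nK f (fun i => c * t i) j = c * simp_real nK f t j.
Proof.
  unfold simp_real. rewrite <- sumN_scal. apply sumN_ext. intros i _. destruct Nat.eq_dec; lra.
Qed.

Lemma simp_real_sum nK nL f t : (forall i, (i < nK)%nat -> (f i < nL)%nat) ->
  sumN nL (simp_real nK f t) = sumN nK t.
Proof.
  intros Hf. unfold simp_real. rewrite sumN_swap. apply sumN_ext. intros i Hi.
  rewrite (sumN_single nL _ (f i)); auto.
  - now destruct Nat.eq_dec.
  - intros j _ Hj. destruct Nat.eq_dec; [congruence|easy].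
Qed.

Lemma simp_real_nonneg nK f t j : (forall i, 0 <= t i) -> 0 <= simp_real nK f t j.
Proof.
  intros H. apply sumN_nonneg. intros i _. destruct Nat.eq_dec; [easy|lra].
Qed.

Lemma simp_real_le nK f t j : (forall i, (i < nK)%nat -> 0 <= t i) -> simp_real nK f t j <= sumN nK t.
Proof.
  intros H. apply sumN_le. intros i Hi. destruct Nat.eq_dec; [lra|auto].
Qed.

Lemma simp_real_outside nK f t j : (forall i, (i < nK)%nat -> f i = j -> t i = 0) ->
  simp_real nK f t j = 0.
Proof. intros H. apply sumN_zero. intros i Hi. destruct Nat.eq_dec; auto. Qed.

Lemma cont_simp_real {X : Type} (d : X -> X -> R) D nK f (u : X -> nat -> R) j :
  (forall i, (i < nK)%nat -> cont_on d R_dist D (fun x => u x i)) ->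
  cont_on d R_dist D (fun x => simp_real nK f (u x) j).
Proof.
  intros H. unfold simp_real.
  apply (cont_sumN d D nK (fun i x => if Nat.eq_dec (f i) j then u x i else 0)).
  intros i Hi. destruct Nat.eq_dec; [auto|apply cont_const, R_dist_pmetric].
Qed.

(* One vertex of s is chosen over each vertex of the image; the remaining ones are the
   fiber directions. *)
Definition root (f : nat -> nat) (s : list nat) (j : nat) : nat :=
  match find (fun v => Nat.eqb (f v) j) s with Some v => v | None => O end.

Definition nonroots (f : nat -> nat) (s : list nat) : list nat :=
  filter (fun v => negb (Nat.eqb (root f s (f v)) v)) (nodup Nat.eq_dec s).

Lemma root_spec f s v : In v s -> In (root f s (f v)) s /\ f (root f s (f v)) = f v.
Proof.
  intros Hv. unfold root. destruct (find _ s) as [w|] eqn:E.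
  - apply find_some in E. destruct E as (Hw & E). now apply Nat.eqb_eq in E.
  - apply (find_none _ _ E) in Hv. now rewrite Nat.eqb_refl in Hv.
Qed.

Lemma in_nonroots f s v : In v (nonroots f s) <-> In v s /\ root f s (f v) <> v.
Proof.
  unfold nonroots. rewrite filter_In, nodup_In. split; intros (Hv & H); split; auto.
  - intros E. now rewrite E, Nat.eqb_refl in H.
  - apply Bool.negb_true_iff. now apply Nat.eqb_neq.
Qed.

Lemma nonroots_position f s : exists pos : nat -> nat,
  (forall v, In v (nonroots f s) -> (pos v < length (nonroots f s))%nat /\
     nth (pos v) (nonroots f s) O = v) /\
  (forall i, (i < length (nonroots f s))%nat -> pos (nth i (nonroots f s) O) = i).
Proof.
  assert (H : forall v, exists i, In v (nonroots f s) -> (i < length (nonroots f s))%nat /\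
    nth i (nonroots f s) O = v).
  { intros v. destruct (classic (In v (nonroots f s))) as [Hv|Hv]; [|now exists O].
    destruct (In_nth _ v O Hv) as (i & Hi). now exists i. }
  apply fun_choice in H. destruct H as (pos & Hpos). exists pos. split; [easy|].
  intros i Hi. destruct (Hpos (nth i (nonroots f s) O)) as (H1 & H2); [now apply nth_In|].
  assert (Hnd : NoDup (nonroots f s)) by (apply NoDup_filter, NoDup_nodup).
  now apply (proj1 (NoDup_nth _ O) Hnd).
Qed.

Lemma list_inhabited {A : Type} (l : list A) : l <> nil -> exists a, In a l.
Proof. destruct l as [|a l]; [easy|]. exists a. now left. Qed.

Section Simplex.
  Context (nK nL : nat) (f : nat -> nat) (s : list nat).
  Hypothesis s_vertices : forall i, In i s -> (i < nK)%nat.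
  Hypothesis f_bound : forall i, (i < nK)%nat -> (f i < nL)%nat.

  Let is_root (v : nat) : R :=
    if in_dec Nat.eq_dec v s then if Nat.eq_dec (root f s (f v)) v then 1 else 0 else 0.

  (* Subtracting, at each root, the mass of its class makes any vector over s invisible to f. *)
  Lemma simp_real_root t j : (forall i, (i < nK)%nat -> ~ In i s -> t i = 0) ->
    simp_real nK f (fun v => is_root v * simp_real nK f t (f v)) j = simp_real nK f t j.
  Proof.
    intros Ht. destruct (classic (exists u, In u s /\ f u = j)) as [(u & Hu & <-)|Hn].
    - destruct (root_spec f s u Hu) as (Hr & Efr). unfold simp_real at 1.
      rewrite (sumN_single nK _ (root f s (f u))); [|auto|].
      + destruct Nat.eq_dec; [|easy]. unfold is_root. rewrite Efr.
        destruct in_dec; [|easy]. destruct (Nat.eq_dec (root f s (f u)) _); [ring|easy].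
      + intros i _ Hi. destruct Nat.eq_dec as [E|]; [|easy]. unfold is_root.
        destruct in_dec; [|ring]. destruct Nat.eq_dec as [E'|]; [|ring].
        exfalso. apply Hi. now rewrite <- E', E.
    - rewrite !simp_real_outside; auto.
      + intros i Hi E. apply Ht; [easy|]. intros Hs. eauto.
      + intros i Hi E. unfold is_root. destruct in_dec; [exfalso; eauto|ring].
  Qed.

  (* The fiber of f over the image of the barycenter contains an affine cube whose sides are
      the fiber directions. *)
  Section Lower.
    Context (SK SL : list (list nat)) (n : nat).
    Hypothesis s_in : In s SK.
    Hypothesis s_nonempty : s <> nil.
    Hypothesis f_simplicial : exists u, In u SL /\ forall j, In j u <-> In j (map f s).
    Hypothesis f_dim : dim_map_le nK SK nL SL f n.

    Lemma nonroots_length : (length (nonroots f s) <= n)%nat.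
    Proof.
      (* If there were more than n fiber directions, n + 1 of them would span a cube in the fiber. A
         cover of order n + 1 is then contradicted by a point lying in n + 2 members. *)
      apply Nat.nlt_ge. intros Hlen. set (k := S n).
      destruct (nonroots_position f s) as (pos & Hpos & Hpos').
      set (l := sumN nK (fun v => if in_dec Nat.eq_dec v s then 1 else 0)).
      assert (Hl : 1 <= l).
      { destruct (list_inhabited s s_nonempty) as (v & Hv).
        replace 1 with (if in_dec Nat.eq_dec v s then 1 else 0) by (now destruct in_dec).
        apply (sumN_term_le nK (fun v => if in_dec Nat.eq_dec v s then 1 else 0)); [auto|].
        intros. destruct in_dec; lra. }
      set (b := fun v => if in_dec Nat.eq_dec v s then / l else 0).
      assert (Hil : 0 < / l) by (apply Rinv_0_lt_compat; lra).
      assert (HN : 0 < INR (S nK)) by (apply lt_0_INR; lia).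
      (* The side length of the cube: a root loses at most c * nK, which does not exceed its weight
         / l in the barycenter. *)
      set (c := / l * / INR (S nK)).
      assert (Hc : 0 < c) by (apply Rmult_lt_0_compat; [easy|now apply Rinv_0_lt_compat]).
      assert (HcN : c * INR nK <= / l).
      { replace (/ l) with (c * INR (S nK)) by (unfold c; field; lra).
        apply Rmult_le_compat_l; [lra|]. apply le_INR. lia. }
      pose (X := fun (x : nat -> R) v => if in_dec Nat.eq_dec v (nonroots f s) then
                   if lt_dec (pos v) k then x (pos v) else 0 else 0).
      (* The barycenter is moved by c * x along the fiber directions, and each root compensates for
         its class, so the image under f does not change. *)
      pose (iota := fun x v => b v + c * (X x v - is_root v * simp_real nK f (X x) (f v))).
      assert (Hb1 : sumN nK b = 1).
      { unfold b. rewrite (sumN_ext nK _ (fun v => / l * (if in_dec Nat.eq_dec v s then 1 else 0)))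
          by (intros; destruct in_dec; lra).
        rewrite sumN_scal. fold l. field. lra. }
      assert (Hb0 : forall v, 0 <= b v) by (intros v; unfold b; destruct in_dec; lra).
      assert (HXs : forall x v, ~ In v s -> X x v = 0).
      { intros x v Hv. unfold X. destruct in_dec as [Hw|]; [|easy].
        apply in_nonroots in Hw. tauto. }
      assert (HXu : forall x v, cube k x -> 0 <= X x v <= 1).
      { intros x v (Hx & _). unfold X. destruct in_dec; [|lra]. destruct lt_dec; [|lra].
        now apply Hx. }
      assert (HS : forall x v, cube k x -> 0 <= simp_real nK f (X x) v <= INR nK).
      { intros x v Hx. split; [apply simp_real_nonneg; intros i; now apply HXu|].
        eapply Rle_trans; [apply simp_real_le; intros i _; now apply HXu|].
        rewrite <- (Rmult_1_r (INR nK)), <- sumN_const. apply sumN_le. intros i _. now apply HXu. }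
      assert (Hmap : forall x j, simp_real nK f (iota x) j = simp_real nK f b j).
      { intros x j. unfold iota.
        rewrite (simp_real_plus nK f b), (simp_real_scal nK f c), (simp_real_minus nK f (X x)),
          simp_real_root by auto. ring. }
      assert (Hy : realiz nL SL (simp_real nK f b)).
      { destruct f_simplicial as (u & Hu & Huj). repeat split.
        - intros j. now apply simp_real_nonneg.
        - exists u. split; [easy|]. intros j Hj. apply Huj, NNPP. intros Hn. apply Hj.
          apply simp_real_outside. intros i _ E. unfold b. destruct in_dec; [|easy].
          exfalso. apply Hn. subst. now apply in_map.
        - now rewrite simp_real_sum. }
      assert (Hfib : forall x, cube k x -> fiber nK SK f (simp_real nK f b) (iota x)).
      { intros x Hx. split; [|auto]. repeat split.
        - intros v. unfold iota, b, is_root. specialize (HS x (f v) Hx). specialize (HXu x v Hx).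
          destruct in_dec as [Hv|Hv]; [|rewrite HXs by easy; lra].
          destruct Nat.eq_dec.
          + assert (c * simp_real nK f (X x) (f v) <= c * INR nK) by (apply Rmult_le_compat_l; lra).
            nra.
          + nra.
        - exists s. split; [easy|]. intros v Hv. apply NNPP. intros Hn. apply Hv.
          unfold iota, b, is_root. destruct in_dec; [easy|]. rewrite HXs by easy. ring.
        - rewrite <- (simp_real_sum nK nL f) by easy. rewrite (sumN_ext nL _ (simp_real nK f b)) by auto.
          now rewrite simp_real_sum. }
      assert (Hcont : cont_on (dist_fin k) (dist_fin nK) (fun _ => True) iota).
      { assert (HX : forall v, cont_on (dist_fin k) R_dist (fun _ => True) (fun x => X x v)).
        { intros v. unfold X. destruct in_dec; [|apply cont_const, R_dist_pmetric].
          destruct lt_dec; [now apply cont_coord|apply cont_const, R_dist_pmetric]. }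
        apply cont_dist_fin. intros v _. unfold iota.
        apply (cont_plus _ _ (fun _ => b v)); [apply cont_const, R_dist_pmetric|].
        apply cont_scal, cont_minus; [auto|]. apply cont_scal, cont_simp_real. auto. }
      (* Opposite faces of the embedded cube are at distance at least c, so no member of a cover of
         mesh c meets both. *)
      destruct (dim_le_small_cover (dist_fin nK) n _ (dist_fin_pmetric nK)
        (fiber_compact nK SK f (simp_real nK f b)) (f_dim _ Hy) c Hc)
        as (m & W & HW & HWc & Hmesh & Hord).
      (* A member that misses some face x i = 0 gets the colour i + 1. Any other member meets all
         these faces, hence misses all faces x i = 1, and gets the colour 0. *)
      assert (Hcol : forall j, exists col, (j < m)%nat -> (col <= k)%nat /\
        forall x, cube k x -> W j (iota x) ->
          match col with O => forall i, (i < k)%nat -> x i <> 1 | S i => x i <> 0 end).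
      { intros j. destruct (lt_dec j m) as [Hj|Hj]; [|now exists O].
        destruct (classic (exists i, (i < k)%nat /\ forall x, cube k x -> W j (iota x) -> x i <> 0))
          as [(i & Hi & H)|Hno]; [exists (S i); auto|].
        exists O. intros _. split; [lia|]. intros x Hx HWx i Hi Ex. apply Hno. exists i.
        split; [easy|]. intros y Hy' HWy Ey.
        pose proof (Hmesh j Hj _ _ HWx HWy) as Hd.
        set (w := nth i (nonroots f s) O).
        assert (Hw : In w (nonroots f s)) by (apply nth_In; unfold k in *; lia).
        assert (Hws := proj1 (in_nonroots f s w) Hw).
        pose proof (dist_fin_coord nK (iota x) (iota y) w (s_vertices w (proj1 Hws))) as Hco.
        assert (E : iota x w - iota y w = c).
        { unfold iota, is_root. destruct (in_dec Nat.eq_dec w s); [|tauto].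
          destruct (Nat.eq_dec (root f s (f w)) w); [tauto|].
          unfold X. destruct in_dec; [|easy]. unfold w. rewrite Hpos' by (unfold k in *; lia).
          destruct lt_dec; [|easy]. rewrite Ex, Ey. ring. }
        rewrite E, Rabs_pos_eq in Hco; lra. }
      apply fun_choice in Hcol. destruct Hcol as (col & Hcol).
      (* Grouped by colour, the cover satisfies the boundary conditions of [cube_kkm]. A point
         common to all k + 1 colours lies in k + 1 = n + 2 different members. *)
      destruct (cube_kkm k (fun i x => exists j, (j < m)%nat /\ col j = i /\ W j (iota x)))
        as (x & Hx & Hall).
      - intros i Hi x (j & Hj & Ej & HWx). destruct (HW j Hj _ HWx) as (r & Hr & HB).
        destruct (Hcont x I r Hr) as (r' & Hr' & HB'). exists r'. split; [easy|].
        intros y Hy'. exists j. auto.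
      - intros x Hx. destruct (HWc _ (Hfib x Hx)) as (j & Hj & HWx). exists (col j).
        split; [now apply Hcol|eauto].
      - intros x i Hx Hi (j & Hj & Ej & HWx). destruct (Hcol j Hj) as (_ & H).
        specialize (H x Hx HWx). now rewrite Ej in H.
      - intros x i Hx Hi (j & Hj & Ej & HWx). destruct (Hcol j Hj) as (_ & H).
        specialize (H x Hx HWx). rewrite Ej in H. auto.
      - assert (H : forall i, exists j, (i <= k)%nat -> (j < m)%nat /\ col j = i /\ W j (iota x)).
        { intros i. destruct (le_dec i k) as [Hi|Hi]; [|now exists O].
          destruct (Hall i Hi) as (j & Hj). now exists j. }
        apply fun_choice in H. destruct H as (pick & Hpick).
        assert (Hle : (length (map pick (seq 0 (S k))) <= S n)%nat).
        { apply (Hord (iota x)).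
          - apply NoDup_map_NoDup_ForallPairs; [|apply seq_NoDup].
            intros i i' Hi Hi' E. apply in_seq in Hi, Hi'.
            destruct (Hpick i ltac:(lia)) as (_ & Ei & _).
            destruct (Hpick i' ltac:(lia)) as (_ & Ei' & _). congruence.
          - intros j Hj. apply in_map_iff in Hj. destruct Hj as (i & <- & Hi).
            apply in_seq in Hi. split; apply Hpick; lia. }
        rewrite length_map, length_seq in Hle. unfold k in Hle. lia.
    Qed.
  End Lower.

  (** A point t of the simplex is recovered by reading the nonroot coordinates off [ex t] and giving
      each root what its class still lacks of the image under f. For arbitrary points of the cube
      this is made to land in the simplex: negative amounts are replaced by 0, the vertex v0 fills
      the total up to at least 1, and the result is normalised. None of these corrections acts on
      points that come from the simplex. *)
  Lemma simplex_retract n : s <> nil -> (length (nonroots f s) <= n)%nat ->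
    exists (ex : (nat -> R) -> nat -> R) (r : (nat -> R) * (nat -> R) -> nat -> R),
      cont_on (dist_fin nK) (dist_pair nL n) (realiz nK (s :: nil))
        (fun t => (simp_real nK f t, ex t)) /\
      (forall t, realiz nK (s :: nil) t -> cube_pair nL n (simp_real nK f t, ex t)) /\
      cont_on (dist_pair nL n) (dist_fin nK) (cube_pair nL n) r /\
      (forall p, cube_pair nL n p -> realiz nK (s :: nil) (r p)) /\
      (forall t, realiz nK (s :: nil) t -> r (simp_real nK f t, ex t) = t).
  Proof.
    intros Hs Hlen. destruct (nonroots_position f s) as (pos & Hpos & Hpos').
    destruct (list_inhabited s Hs) as (v0 & Hv0).
    assert (Hpn : forall v, In v (nonroots f s) -> (pos v < n)%nat).
    { intros v Hv. specialize (Hpos v Hv). lia. }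
    pose (ex := fun (t : nat -> R) i =>
      if lt_dec i (length (nonroots f s)) then t (nth i (nonroots f s) O) else 0).
    pose (X := fun (p : (nat -> R) * (nat -> R)) v =>
      if in_dec Nat.eq_dec v (nonroots f s) then snd p (pos v) else 0).
    pose (a := fun (p : (nat -> R) * (nat -> R)) v =>
      X p v + is_root v * Rmax 0 (fst p (f v) - simp_real nK f (X p) (f v))).
    pose (b := fun p v => a p v + (if Nat.eq_dec v v0 then Rmax 0 (1 - sumN nK (a p)) else 0)).
    assert (Hr0 : forall v, 0 <= is_root v).
    { intros v. unfold is_root. destruct in_dec; [destruct Nat.eq_dec|]; lra. }
    assert (Ha0 : forall p v, cube_pair nL n p -> 0 <= a p v).
    { intros p v (_ & (Hp & _)). unfold a.
      assert (0 <= X p v) by (unfold X; destruct in_dec; [apply Hp; auto|lra]).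
      assert (0 <= is_root v * Rmax 0 (fst p (f v) - simp_real nK f (X p) (f v)))
        by (apply Rmult_le_pos; [auto|apply Rmax_l]). lra. }
    assert (Hbsum : forall p, sumN nK (b p) = sumN nK (a p) + Rmax 0 (1 - sumN nK (a p))).
    { intros p. unfold b. rewrite sumN_plus. f_equal. rewrite (sumN_single nK _ v0); auto.
      - now destruct Nat.eq_dec.
      - intros i _ Hi. now destruct Nat.eq_dec. }
    assert (Hbpos : forall p, 0 < sumN nK (b p)).
    { intros p. rewrite Hbsum. unfold Rmax. destruct Rle_dec; lra. }
    assert (Hexc : forall t, realiz nK (s :: nil) t -> cube_pair nL n (simp_real nK f t, ex t)).
    { intros t Ht. pose proof (realiz_unit _ _ _ Ht) as Hu. destruct Ht as (H0 & _ & H1).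
      split; simpl; split.
      - intros j _. split; [now apply simp_real_nonneg|]. rewrite <- H1. now apply simp_real_le.
      - intros j Hj. apply simp_real_outside. intros i Hi E. specialize (f_bound i Hi). lia.
      - intros i _. unfold ex. destruct lt_dec; [|split; lra]. apply Hu, s_vertices.
        apply (in_nonroots f s). now apply nth_In.
      - intros i Hi. unfold ex. destruct lt_dec; [lia|easy]. }
    assert (Hae : forall t v, realiz nK (s :: nil) t -> a (simp_real nK f t, ex t) v = t v).
    { intros t v (H0 & (s' & [<-|[]] & Hsup) & H1).
      assert (Hz : forall u, ~ In u s -> t u = 0) by (intros u Hu; apply NNPP; auto).
      assert (HX : forall u, In u (nonroots f s) -> X (simp_real nK f t, ex t) u = t u).
      { intros u Hu. unfold X. destruct in_dec; [|easy]. simpl. unfold ex.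
        destruct (Hpos u Hu) as (Hp1 & Hp2). destruct lt_dec; [|easy]. now rewrite Hp2. }
      assert (HX0 : forall u, ~ In u (nonroots f s) -> X (simp_real nK f t, ex t) u = 0).
      { intros u Hu. unfold X. now destruct in_dec. }
      unfold a, is_root. simpl. destruct (in_dec Nat.eq_dec v s) as [Hv|Hv].
      - destruct (Nat.eq_dec (root f s (f v)) v) as [E|E].
        + rewrite HX0 by (rewrite in_nonroots; tauto).
          rewrite <- simp_real_minus.
          replace (simp_real nK f (fun i => t i - X (simp_real nK f t, ex t) i) (f v)) with (t v).
          { rewrite Rmax_right by easy. ring. }
          unfold simp_real at 1. rewrite (sumN_single nK _ v); auto.
          * destruct Nat.eq_dec; [|easy]. rewrite HX0 by (rewrite in_nonroots; tauto). ring.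
          * intros i Hi Hne. destruct Nat.eq_dec as [Ef|]; [|easy].
            destruct (in_dec Nat.eq_dec i (nonroots f s)) as [Hin|Hin]; [rewrite HX by easy; ring|].
            rewrite HX0 by easy. rewrite Hz; [ring|]. intros Hi'. apply Hin, in_nonroots.
            split; [easy|]. rewrite Ef, E. congruence.
        + rewrite HX by (rewrite in_nonroots; tauto). ring.
      - rewrite HX0 by (rewrite in_nonroots; tauto). rewrite Hz by easy. ring. }
    exists ex, (fun p v => b p v / sumN nK (b p)).
    split; [|split; [|split; [|split]]].
    - apply (cont_pair (dist_fin nK) (dist_fin nL) (dist_fin n)).
      + apply cont_dist_fin. intros j _. apply (cont_simp_real _ _ nK f (fun t => t)).
        intros i Hi. now apply cont_coord.
      + apply cont_dist_fin. intros i _. unfold ex.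
        destruct lt_dec; [|apply cont_const, R_dist_pmetric]. apply cont_coord, s_vertices.
        apply (in_nonroots f s). now apply nth_In.
    - easy.
    - apply cont_normalise; [auto|].
      assert (HcX : forall i, cont_on (dist_pair nL n) R_dist (cube_pair nL n) (fun p => X p i)).
      { intros i. unfold X. destruct in_dec as [Hi|]; [|apply cont_const, R_dist_pmetric].
        apply (cont_comp _ (dist_fin n) _ _ (fun _ => True) snd (fun x => x (pos i)));
          [easy|apply (cont_snd (dist_fin nL) (dist_fin n)), dist_fin_pmetric|].
        apply cont_coord. auto. }
      assert (Hca : forall i, (i < nK)%nat ->
        cont_on (dist_pair nL n) R_dist (cube_pair nL n) (fun p => a p i)).
      { intros i Hi. unfold a. apply cont_plus; [auto|]. apply cont_scal, cont_max, cont_minus.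
        - apply (cont_comp _ (dist_fin nL) _ _ (fun _ => True) fst (fun x => x (f i)));
          [easy|apply (cont_fst (dist_fin nL) (dist_fin n)), dist_fin_pmetric|].
          apply cont_coord. auto.
        - apply cont_simp_real. auto. }
      intros i Hi. unfold b. apply cont_plus; [auto|].
      destruct Nat.eq_dec; [|apply cont_const, R_dist_pmetric].
      apply cont_max, cont_minus; [apply cont_const, R_dist_pmetric|].
      apply (cont_sumN _ _ nK (fun i p => a p i)). auto.
    - intros p Hp. repeat split.
      + intros v. apply Rmult_le_pos; [|left; now apply Rinv_0_lt_compat].
        specialize (Ha0 p v Hp). pose proof (Rmax_l 0 (1 - sumN nK (a p))).
        unfold b. destruct Nat.eq_dec; lra.
      + exists s. split; [now left|]. intros v Hv. apply NNPP. intros Hn. apply Hv.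
        unfold b, a, X, is_root. destruct (in_dec Nat.eq_dec v (nonroots f s)) as [Hw|];
          [apply in_nonroots in Hw; tauto|]. destruct (in_dec Nat.eq_dec v s); [easy|].
        destruct Nat.eq_dec; [congruence|]. unfold Rdiv. ring.
      + now apply normalise_sum.
    - intros t Ht. apply functional_extensionality. intros v.
      assert (Hsum : sumN nK (a (simp_real nK f t, ex t)) = 1).
      { rewrite (sumN_ext nK _ t) by auto. apply Ht. }
      rewrite Hbsum, Hsum. unfold b. rewrite Hsum, Hae by easy.
      rewrite Rminus_diag, Rmax_left by lra. destruct Nat.eq_dec; field.
  Qed.
End Simplex.

(** * From cubes to simplicial maps *)

(** The fibers are indexed by the points t of the simplex, a compact set on which tolerances can be
    made uniform. *)
Definition fiberwise_small {M : Type} (dM : M -> M -> R) (n nK : nat) (f : nat -> nat)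
  (s : list nat) (delta : R) (g : (nat -> R) -> M) : Prop :=
  forall t, realiz nK (s :: nil) t ->
    small_cover dM n (fun w => exists u, fiber nK (s :: nil) f (simp_real nK f t) u /\ w = g u) delta.

Lemma face_realiz nK SK s t : In s SK -> realiz nK (s :: nil) t -> realiz nK SK t.
Proof.
  intros Hs (A & (s' & [<-|[]] & B) & C). split; [easy|]. split; [eauto|easy].
Qed.

(** The open sets covering the image of one fiber also cover the images of nearby fibers under
    nearby maps. As mesh and order are properties of the sets alone, the same family serves, and
    compactness of the simplex makes eta independent of the fiber. *)
Lemma fiberwise_small_open {M : Type} (dM : M -> M -> R) n nK f s delta (g : (nat -> R) -> M) :
  pmetric dM -> cont_on (dist_fin nK) dM (realiz nK (s :: nil)) g ->
  fiberwise_small dM n nK f s delta g ->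
  exists eta, 0 < eta /\ forall g' : (nat -> R) -> M,
    (forall t, realiz nK (s :: nil) t -> dM (g t) (g' t) <= eta) ->
    fiberwise_small dM n nK f s delta g'.
Proof.
  intros HM Hg Hgood. pose proof (dist_fin_pmetric nK) as Hd.
  pose proof (realiz_compact nK (s :: nil)) as HK.
  set (sigma := realiz nK (s :: nil)) in *.
  destruct (compact_tolerance (dist_fin nK) sigma
    (fun t eta => forall g' : (nat -> R) -> M, (forall t, sigma t -> dM (g t) (g' t) <= eta) ->
      small_cover dM n (fun w => exists u, fiber nK (s :: nil) f (simp_real nK f t) u /\ w = g' u) delta) HK)
    as (eta & Heta & H).
  - intros t Ht. destruct (Hgood t Ht) as (m & V & HV & Hc & Hrest).
    destruct (compact_tolerance (dist_fin nK) sigma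
      (fun u r => forall t', dist_fin nK t' t < r ->
         (forall j, simp_real nK f u j = simp_real nK f t' j) ->
         forall w, dM (g u) w < r -> exists j, (j < m)%nat /\ V j w) HK) as (r & Hr & Hnear).
    (* For u in the fiber of t, some V j contains a ball around g u. A u off that fiber is off the
       fibers of all t' near t, since [simp_real] is 1-Lipschitz, and the condition is void. *)
    + intros u Hu. destruct (classic (forall j, simp_real nK f u j = simp_real nK f t j)) as [E|E].
      * destruct (Hc (g u)) as (j & Hj & HVj); [exists u; exact (conj (conj Hu E) eq_refl)|].
        destruct (HV j Hj _ HVj) as (r & Hr & HB).
        destruct (Hg u Hu (r / 2)) as (r' & Hr' & HB'); [lra|].
        exists (Rmin (r / 2) r'). split; [apply Rmin_glb_lt; lra|].
        pose proof (Rmin_l (r / 2) r'). pose proof (Rmin_r (r / 2) r').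
        intros u' r1 Hu' Hd' _ Hr1 t' _ _ w Hw. exists j. split; [easy|]. apply HB.
        rewrite (proj1 (proj2 Hd)) in Hd'. specialize (HB' u' Hu' ltac:(lra)).
        destruct HM as (_ & _ & Mt). specialize (Mt (g u) (g u') w). lra.
      * apply not_all_ex_not in E. destruct E as (j & E).
        set (al := Rabs (simp_real nK f u j - simp_real nK f t j)).
        assert (Hal : 0 < al) by (apply Rabs_pos_lt; lra).
        exists (al / 2). split; [lra|]. intros u' r1 Hu' Hd' _ Hr1 t' Ht' E'. exfalso.
        pose proof (simp_real_lipschitz nK f u' u j) as L1.
        pose proof (simp_real_lipschitz nK f t' t j) as L2. rewrite (E' j) in L1.
        assert (al <= Rabs (simp_real nK f t' j - simp_real nK f u j) +
                Rabs (simp_real nK f t' j - simp_real nK f t j)); [|lra].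
        unfold al. rewrite (Rabs_minus_sym (simp_real nK f t' j) (simp_real nK f u j)).
        replace (simp_real nK f u j - simp_real nK f t j) with
          ((simp_real nK f u j - simp_real nK f t' j) + (simp_real nK f t' j - simp_real nK f t j)) by ring.
        apply Rabs_triang.
    + exists r. split; [easy|]. intros t' eta Ht' Hd' _ Heta g' Hg'. exists m, V.
      split; [easy|]. split; [|easy]. intros w (u & (Hu & Eu) & ->).
      apply (Hnear u Hu t'); auto. specialize (Hg' u Hu). lra.
  - exists eta. split; [easy|]. intros g' Hg' t Ht. now apply H.
Qed.

(** FAP applies to g composed with the retraction r. Restricted along the embedding, the homotopy
    starts at g on s, and its end map sends each fiber into the image of one slice, which has
    dimension at most n. *)
Lemma fiberwise_small_dense {M : Type} (dM : M -> M -> R) n nK nL SK f s (g : (nat -> R) -> M) eps delta :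
  pmetric dM -> FAP dM n ->
  (forall s', In s' SK -> forall i, In i s' -> (i < nK)%nat) -> In s SK -> s <> nil ->
  (forall i, (i < nK)%nat -> (f i < nL)%nat) -> (length (nonroots f s) <= n)%nat ->
  cont_on (dist_fin nK) dM (realiz nK SK) g -> 0 < eps -> 0 < delta ->
  exists g' : (nat -> R) -> M,
    cont_on (dist_fin nK) dM (realiz nK SK) g' /\
    eps_homotopic (dist_fin nK) dM (realiz nK SK) eps g g' /\
    fiberwise_small dM n nK f s delta g'.
Proof.
  intros HM HFAP Hv Hs Hsn Hf Hlen Hg Heps Hdelta.
  destruct (simplex_retract nK nL f s (Hv s Hs) Hf n Hsn Hlen)
    as (ex & r & Hexc & Hexm & Hrc & Hrm & Hre).
  pose proof (dist_fin_pmetric nK) as Hd.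
  assert (HdP : pmetric (dist_pair nL n))
    by (apply (dist_prod_pmetric (dist_fin nL) (dist_fin n)); apply dist_fin_pmetric).
  (* The homotopy on s uses eps / 2 and its extension adds 2 * (eps / 8), which stays below eps. *)
  destruct (HFAP (eps / 2) nL (fun p => g (r p))) as (G & HG & (H & Hc & H01 & Hsm) & Hdim).
  { lra. }
  { apply (cont_comp _ (dist_fin nK) _ _ (realiz nK SK)); [|easy|easy].
    intros p Hp. apply (face_realiz nK SK s); auto. }
  apply joint_continuity in Hc; [|easy].
  destruct (homotopy_extension dM nK SK s g (fun t a => H (simp_real nK f t, ex t) a) (eps / 2) (eps / 8))
    as (h & Hhc & Hh0 & Hh1 & Hhs); auto; try lra.
  - apply (cont_comp _ (dist_prod (dist_pair nL n) R_dist) _ _ (cylinder (cube_pair nL n))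
      (fun p => ((simp_real nK f (fst p), ex (fst p)), snd p)) (fun p => H (fst p) (snd p)));
      [|apply (cont_pair _ (dist_pair nL n) R_dist)|easy].
    + intros p (Hp & Ha). split; [now apply Hexm|easy].
    + apply (cont_comp _ (dist_fin nK) _ _ (realiz nK (s :: nil)) fst
        (fun t => (simp_real nK f t, ex t))); [now intros p []|apply cont_fst, R_dist_pmetric|easy].
    + now apply cont_snd.
  - intros t Ht. rewrite (proj1 (H01 _ (Hexm t Ht))). now rewrite Hre.
  - intros t Ht a b Ha Hb. destruct (Hsm _ (Hexm t Ht)) as (dl & Hdl & Hs').
    specialize (Hs' a b Ha Hb). lra.
  - assert (I1 : unit_I 1) by (split; lra).
    exists (fun t => h t 1). split; [|split].
    + apply (cont_comp (dist_fin nK) (dist_prod (dist_fin nK) R_dist) dM _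
        (cylinder (realiz nK SK)) (fun t => (t, 1)) (fun p => h (fst p) (snd p))); [now split| |easy].
      apply cont_pair; [apply cont_id|apply cont_const, R_dist_pmetric].
    + exists h. split; [now apply joint_continuity|]. split; [auto|].
      intros t Ht. exists (eps / 2 + 2 * (eps / 8)). split; [lra|]. auto.
    + intros t Ht. pose proof (Hexm t Ht) as (Hz & _). simpl in Hz.
      apply small_cover_mono with (fun w => exists x, cube n x /\ w = G (simp_real nK f t, x)).
      * intros w (u & (Hu & Eu) & ->). exists (ex u). split; [now apply (Hexm u)|].
        rewrite Hh1 by easy. rewrite (proj2 (H01 _ (Hexm u Hu))).
        f_equal. f_equal. now apply functional_extensionality.
      * apply dim_le_small_cover; auto.
        apply (seq_compact_image (dist_fin n) dM (cube n) (fun x => G (simp_real nK f t, x)));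
          [apply dist_fin_pmetric|easy|apply cube_compact|].
        apply (cont_comp (dist_fin n) (dist_pair nL n) dM _ (cube_pair nL n)
          (fun x => (simp_real nK f t, x)) G); [now split| |easy].
        apply (cont_pair _ (dist_fin nL) (dist_fin n));
          [apply cont_const, dist_fin_pmetric|apply cont_id].
Qed.

Lemma FAP_simplicial {M : Type} (dM : M -> M -> R) n nK SK nL SL f (g : (nat -> R) -> M) eps :
  is_metric dM -> complete dM -> FAP dM n ->
  is_complex nK SK -> is_simplicial nK SK nL SL f -> dim_map_le nK SK nL SL f n ->
  cont_on (dist_fin nK) dM (realiz nK SK) g -> 0 < eps ->
  exists g', in_Rnp dM n nK SK nL SL f g' /\
    eps_homotopic (dist_fin nK) dM (realiz nK SK) eps g g'.
Proof.
  intros HM Hcomp HFAP (HK1 & HK2 & HK3) (Hf & Hsimp) Hdim Hg Heps.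
  pose proof (is_metric_pmetric _ HM) as HMp. pose proof (dist_fin_pmetric nK) as Hd.
  assert (Hv : forall s, In s SK -> forall i, In i s -> (i < nK)%nat) by (intros s Hs; now apply HK1).
  assert (Hlen : forall s, In s SK -> (length (nonroots f s) <= n)%nat).
  { intros s Hs. apply (nonroots_length nK nL f s (Hv s Hs) Hf SK SL n Hs); auto. now apply HK1. }
  assert (Hsub : forall s h, In s SK -> cont_on (dist_fin nK) dM (realiz nK SK) h ->
            cont_on (dist_fin nK) dM (realiz nK (s :: nil)) h).
  { intros s h Hs. apply cont_sub. intros t. now apply face_realiz. }
  (* Condition k concerns the simplex with number k modulo the length of [SK], at tolerance 1/(k+1).
     Every simplex thus returns infinitely often, with tolerances tending to 0. *)
  destruct (homotopical_baire (dist_fin nK) dM (realiz nK SK) Hd HM Hcomp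
    (fun k h => forall s, nth_error SK (k mod length SK) = Some s ->
       fiberwise_small dM n nK f s (/ INR (S k)) h)) with (g := g) (eps := eps)
    as (g' & Hg' & Hhom & HC); auto.
  - intros k h Hh HC. destruct (nth_error SK (k mod length SK)) as [s|] eqn:E.
    + pose proof (nth_error_In _ _ E) as Hs.
      destruct (fiberwise_small_open dM n nK f s (/ INR (S k)) h HMp (Hsub s h Hs Hh) (HC s eq_refl))
        as (eta & Heta & Ho).
      exists eta. split; [easy|]. intros h' _ Hh' s' Es'. injection Es' as <-. apply Ho.
      intros t Ht. apply Hh'. now apply (face_realiz nK SK s).
    + exists 1. split; [lra|]. intros. congruence.
  - intros k h e Hh He. destruct (nth_error SK (k mod length SK)) as [s|] eqn:E.
    + pose proof (nth_error_In _ _ E) as Hs.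
      destruct (fiberwise_small_dense dM n nK nL SK f s h e (/ INR (S k))) as (h' & Hh' & Hhh & Hsm);
        auto; [now apply HK1|apply inv_INR_pos|].
      exists h'. repeat split; auto. intros s' Es'. injection Es' as <-. easy.
    + exists h. split; [easy|]. split; [|easy]. exists (fun t _ => h t). split; [|split]; auto.
      * apply joint_continuity; [easy|].
        apply (cont_comp _ (dist_fin nK) _ _ (realiz nK SK) fst h); [now intros p []| |easy].
        apply cont_fst, R_dist_pmetric.
      * intros t Ht. exists (e / 2). split; [lra|]. intros. destruct HMp as (M0 & _). rewrite M0. lra.
  - exists g'. split; [|easy]. split; [easy|]. intros y Hy.
    apply (dim_le_finite_union dM n
      (fun s w => exists t, fiber nK (s :: nil) f y t /\ w = g' t) _ SK).
    + intros s Hs.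
      assert (Hcpt : seq_compact dM (fun w => exists t, fiber nK (s :: nil) f y t /\ w = g' t)).
      { apply (seq_compact_image (dist_fin nK) dM (fiber nK (s :: nil) f y) g'); auto.
        - apply fiber_compact.
        - apply cont_sub with (realiz nK (s :: nil)); [now intros t []|auto]. }
      split; [now apply seq_compact_closed|]. split.
      * apply small_cover_dim_le; auto. intros delta Hdelta.
        destruct (classic (exists t, fiber nK (s :: nil) f y t)) as [(t & Ht & Et)|Hno].
        -- destruct (In_nth_error SK s Hs) as (i & Ei).
           assert (Hi : (i < length SK)%nat) by (apply nth_error_Some; congruence).
           destruct (inv_INR_small delta Hdelta) as (N & HN).
           (* An index of the simplex s that is at least N, because [SK] is nonempty. *)
           set (k := (i + N * length SK)%nat).
           assert (Hk : (k mod length SK)%nat = i)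
             by (unfold k; rewrite Nat.Div0.mod_add; now apply Nat.mod_small).
           assert (Hkd : / INR (S k) < delta) by (apply HN; unfold k; nia).
           specialize (HC k s). rewrite Hk in HC. specialize (HC Ei t Ht).
           destruct HC as (m & V & HV & Hc & Hmesh & Hord). exists m, V.
           split; [easy|]. split; [|split; [|easy]].
           ++ intros w (u & (Hu & Eu) & ->). apply Hc. exists u. repeat split; try easy; try apply Hu.
              intros j. now rewrite Eu, Et.
           ++ intros j Hj x x' Hx Hx'. specialize (Hmesh j Hj x x' Hx Hx'). lra.
        -- exists O, (fun _ _ => False). split; [easy|]. split; [|split; [easy|]].
           ++ intros w (t & Ht & _). exfalso. eauto.
           ++ intros x [|j J] _ HJ; [simpl; lia|]. destruct (HJ j (or_introl eq_refl)). lia.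
      * intros w (t & (Ht & Et) & ->). exists t. split; [|easy]. split; [|easy].
        now apply (face_realiz nK SK s).
    + intros w (t & ((H0 & (s & Hs & Hsup) & H1) & Et) & ->). exists s. split; [easy|].
      exists t. split; [|easy]. split; [|easy]. split; [easy|]. split; [|easy].
      exists s. split; [now left|easy].
Qed.

(** * From simplicial maps to cubes *)

Fixpoint sublists (l : list nat) : list (list nat) :=
  match l with
  | nil => nil :: nil
  | a :: l' => sublists l' ++ map (cons a) (sublists l')
  end.

Lemma sublists_incl l s : In s (sublists l) -> incl s l.
Proof.
  revert s. induction l as [|a l IH]; intros s Hs; simpl in Hs.
  - destruct Hs as [<-|[]]. easy.
  - apply in_app_or in Hs. destruct Hs as [Hs|Hs].
    + intros i Hi. right. now apply (IH s).
    + apply in_map_iff in Hs. destruct Hs as (s' & <- & Hs).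
      intros i [<-|Hi]; [now left|]. right. now apply (IH s').
Qed.

Lemma filter_sublists P l : In (filter P l) (sublists l).
Proof.
  induction l as [|a l IH]; simpl; [now left|]. apply in_or_app.
  destruct (P a); [right; now apply in_map|now left].
Qed.

(** [is_complex] identifies faces only by their vertex sets; increasing lists of vertices represent
    them all. *)
Definition full_simplex (k : nat) : list (list nat) :=
  filter (fun s => match s with nil => false | _ => true end) (sublists (seq 0 k)).

Lemma full_simplex_face k t : t <> nil -> (forall i, In i t -> (i < k)%nat) ->
  exists u, In u (full_simplex k) /\ forall i, In i u <-> In i t.
Proof.
  intros Ht Hk. set (u := filter (fun i => if in_dec Nat.eq_dec i t then true else false) (seq 0 k)).
  assert (Hu : forall i, In i u <-> In i t).
  { intros i. unfold u. rewrite filter_In, in_seq. destruct in_dec as [Hi|Hi].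
    - specialize (Hk i Hi). intuition lia.
    - intuition congruence. }
  exists u. split; [|easy]. apply filter_In. split; [apply filter_sublists|].
  destruct (list_inhabited t Ht) as (v & Hv). apply Hu in Hv. now destruct u.
Qed.

Lemma full_simplex_complex k : is_complex k (full_simplex k).
Proof.
  assert (H : forall s, In s (full_simplex k) -> s <> nil /\ forall i, In i s -> (i < k)%nat).
  { intros s Hs. apply filter_In in Hs. destruct Hs as (Hs & Hn). split; [now destruct s|].
    intros i Hi. apply (sublists_incl _ _ Hs) in Hi. apply in_seq in Hi. lia. }
  repeat split; try apply H; auto.
  - intros i Hi. apply filter_In. split; [|easy].
    clear H. assert (H : forall a l, In a l -> In (a :: nil) (sublists l)).
    { intros a l. induction l as [|b l IH]; intros Ha; [easy|]. simpl. apply in_or_app.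
      destruct Ha as [->|Ha]; [|left; auto]. right. apply in_map_iff. exists nil. split; [easy|].
      replace nil with (filter (fun _ => false) l) by (clear; now induction l).
      apply filter_sublists. }
    apply H, in_seq. lia.
  - intros s Hs t Ht Hinc. apply full_simplex_face; [easy|]. intros i Hi.
    apply (H s Hs). now apply Hinc.
Qed.

Lemma full_simplex_realiz k t : (forall i, 0 <= t i) -> (forall i, (k <= i)%nat -> t i = 0) ->
  sumN k t = 1 -> realiz k (full_simplex k) t.
Proof.
  intros H0 Hk H1. split; [easy|]. split; [|easy].
  destruct (full_simplex_face k (seq 0 k)) as (u & Hu & Hui).
  - destruct k; [simpl in H1; lra|easy].
  - intros i Hi. apply in_seq in Hi. lia.
  - exists u. split; [easy|]. intros i Hi. apply Hui, in_seq.
    destruct (le_lt_dec k i); [exfalso; auto|lia].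
Qed.

Lemma sumN_add_zero n m F : (forall i, (n <= i)%nat -> F i = 0) -> sumN (n + m) F = sumN n F.
Proof.
  intros H. induction m as [|m IH]; [now rewrite Nat.add_0_r|].
  rewrite Nat.add_succ_r. simpl. rewrite IH, H by lia. lra.
Qed.

(* The subtraction i - n is truncated: the first n+1 vertices go to 0. *)
Lemma collapse_simplicial n m :
  is_simplicial (S (n + m)) (full_simplex (S (n + m))) (S m) (full_simplex (S m)) (fun i => (i - n)%nat).
Proof.
  split; [intros; lia|]. intros s Hs.
  destruct (full_simplex_complex (S (n + m))) as (H & _). destruct (H s Hs) as (Hn & Hi).
  apply full_simplex_face; [now destruct s|]. intros j Hj. apply in_map_iff in Hj.
  destruct Hj as (i & <- & Hj). specialize (Hi i Hj). lia.
Qed.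

(** On a fiber the coordinates above n are fixed by y and coordinate 0 is determined by the total
    mass 1, so coordinates 1 to n remain. Coordinate 0 changes by at most the sum of their changes,
    whence the factor 2. *)
Lemma collapse_dim n m :
  dim_map_le (S (n + m)) (full_simplex (S (n + m))) (S m) (full_simplex (S m)) (fun i => (i - n)%nat) n.
Proof.
  intros y _. apply (dim_le_coordinates _ n _ (fun t i => t (S i)) 2);
    [apply dist_fin_pmetric|apply fiber_compact| |lra|].
  - intros t t' i Hi. apply dist_fin_coord. lia.
  - intros t t' ((_ & _ & H1) & Ht) ((_ & _ & H1') & Ht').
    assert (Hcoord : forall u, (forall j, simp_real (S (n + m)) (fun i => (i - n)%nat) u j = y j) ->
      forall i, (n <= i < n + m)%nat -> u (S i) = y (S i - n)%nat).
    { intros u Hu i Hi. rewrite <- Hu. unfold simp_real.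
      rewrite (sumN_single _ _ (S i)); [now destruct Nat.eq_dec|lia|].
      intros i' _ Hne. destruct Nat.eq_dec; [lia|easy]. }
    set (df := fun i => if lt_dec i (n + m) then t (S i) - t' (S i) else 0).
    assert (Hdf : forall i, (n <= i)%nat -> df i = 0).
    { intros i Hi. unfold df. destruct lt_dec; [|easy].
      rewrite (Hcoord t Ht), (Hcoord t' Ht') by lia. lra. }
    assert (Ed : dist_fin n (fun i => t (S i)) (fun i => t' (S i)) = sumN n (fun i => Rabs (df i))).
    { apply sumN_ext. intros i Hi. unfold df. destruct lt_dec; [easy|lia]. }
    rewrite Ed. unfold dist_fin. rewrite sumN_first.
    rewrite (sumN_ext (n + m) _ (fun i => Rabs (df i)))
      by (intros i Hi; unfold df; destruct lt_dec; [easy|lia]).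
    rewrite sumN_add_zero by (intros i Hi; rewrite Hdf by easy; apply Rabs_R0).
    assert (E0 : t O - t' O = - sumN n df).
    { rewrite <- (sumN_add_zero n m df) by easy.
      rewrite sumN_first in H1, H1'.
      rewrite (sumN_ext (n + m) df (fun i => t (S i) - t' (S i)))
        by (intros i Hi; unfold df; destruct lt_dec; [easy|lia]).
      rewrite sumN_minus. lra. }
    rewrite E0, Rabs_Ropp. pose proof (sumN_abs n df). lra.
Qed.

Section CubeEmbedding.
  Context (n m : nat).
  Let scale : R := / INR (S (n + m)).
  Let w (p : (nat -> R) * (nat -> R)) (i : nat) : R :=
    if lt_dec i n then snd p i else fst p (i - n)%nat.

  (** Vertices 1 to n carry x and the next m carry z, scaled by 1/(n+m+1) so that their sum stays
      below 1. The remainder goes to vertex 0, which is collapsed together with the vertices of x: a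
      change of x is not seen by the simplicial map. *)
  Definition cube_to_simplex (p : (nat -> R) * (nat -> R)) (v : nat) : R :=
    match v with
    | O => 1 - scale * sumN (n + m) (w p)
    | S i => if lt_dec i (n + m) then scale * w p i else 0
    end.

  (** Undoes the scaling; the truncation at 1 only concerns points outside the embedded cube. *)
  Definition simplex_to_cube (t : nat -> R) : (nat -> R) * (nat -> R) :=
    (fun j => if lt_dec j m then Rmin 1 (INR (S (n + m)) * t (S (n + j))) else 0,
     fun i => if lt_dec i n then Rmin 1 (INR (S (n + m)) * t (S i)) else 0).

  Lemma scale_pos : 0 < scale.
  Proof. apply Rinv_0_lt_compat, lt_0_INR. lia. Qed.

  Lemma scale_inv x : INR (S (n + m)) * (scale * x) = x.
  Proof. unfold scale. field. apply not_0_INR. lia. Qed.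

  Lemma w_unit p i : cube_pair m n p -> (i < n + m)%nat -> 0 <= w p i <= 1.
  Proof.
    intros ((H1 & _) & (H2 & _)) Hi. unfold w. destruct lt_dec; [now apply H2|apply H1; lia].
  Qed.

  Lemma cube_to_simplex_sum p : sumN (S (n + m)) (cube_to_simplex p) = 1.
  Proof.
    rewrite sumN_first. cbn [cube_to_simplex].
    rewrite (sumN_ext (n + m) (fun i => if lt_dec i (n + m) then scale * w p i else 0)
      (fun i => scale * w p i)); [rewrite sumN_scal; ring|].
    intros i Hi. destruct lt_dec; [easy|lia].
  Qed.

  Lemma cube_to_simplex_realiz p : cube_pair m n p ->
    realiz (S (n + m)) (full_simplex (S (n + m))) (cube_to_simplex p).
  Proof.
    intros Hp. pose proof scale_pos as Hs. apply full_simplex_realiz.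
    - intros [|i]; simpl.
      + assert (Hle : sumN (n + m) (w p) <= INR (n + m)).
        { rewrite <- (Rmult_1_r (INR (n + m))), <- sumN_const. apply sumN_le.
          intros i Hi. now apply w_unit. }
        assert (scale * sumN (n + m) (w p) <= scale * INR (S (n + m))).
        { apply Rmult_le_compat_l; [lra|]. rewrite S_INR. lra. }
        assert (scale * INR (S (n + m)) = 1) by (apply Rinv_l, not_0_INR; lia). lra.
      + destruct lt_dec; [|lra]. apply Rmult_le_pos; [lra|]. now apply w_unit.
    - intros [|i] Hi; [lia|]. simpl. destruct lt_dec; [lia|easy].
    - apply cube_to_simplex_sum.
  Qed.

  Lemma cont_cube_to_simplex :
    cont_on (dist_pair m n) (dist_fin (S (n + m))) (cube_pair m n) cube_to_simplex.
  Proof.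
    assert (Hw : forall i, (i < n + m)%nat ->
      cont_on (dist_pair m n) R_dist (cube_pair m n) (fun p => w p i)).
    { intros i Hi. unfold w. destruct lt_dec as [Hn|Hn].
      - apply (cont_comp _ (dist_fin n) _ _ (fun _ => True) snd (fun x => x i));
          [easy|apply (cont_snd (dist_fin m) (dist_fin n)), dist_fin_pmetric|now apply cont_coord].
      - apply (cont_comp _ (dist_fin m) _ _ (fun _ => True) fst (fun x => x (i - n)%nat));
          [easy|apply (cont_fst (dist_fin m) (dist_fin n)), dist_fin_pmetric|].
        apply cont_coord. lia. }
    apply cont_dist_fin. intros [|i] Hi; simpl.
    - apply cont_minus; [apply cont_const, R_dist_pmetric|]. apply cont_scal.
      now apply (cont_sumN _ _ (n + m) (fun i p => w p i)).
    - destruct lt_dec; [apply cont_scal; auto|apply cont_const, R_dist_pmetric].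
  Qed.

  Lemma simplex_to_cube_pair t : realiz (S (n + m)) (full_simplex (S (n + m))) t ->
    cube_pair m n (simplex_to_cube t).
  Proof.
    intros (H0 & _).
    assert (Hu : forall i, unit_I (Rmin 1 (INR (S (n + m)) * t i))).
    { intros i. split; [|apply Rmin_l]. apply Rmin_glb; [lra|].
      apply Rmult_le_pos; [apply pos_INR|easy]. }
    unfold simplex_to_cube.
    split; split; intros i Hi; cbn [fst snd]; destruct lt_dec; try easy; lia.
  Qed.

  Lemma cont_simplex_to_cube D :
    cont_on (dist_fin (S (n + m))) (dist_pair m n) D simplex_to_cube.
  Proof.
    apply (cont_pair _ (dist_fin m) (dist_fin n)); apply cont_dist_fin; intros i Hi;
      (destruct lt_dec; [|apply cont_const, R_dist_pmetric]);
      apply cont_min, cont_scal, cont_coord; lia.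
  Qed.

  Lemma simplex_to_cube_to_simplex p : cube_pair m n p -> simplex_to_cube (cube_to_simplex p) = p.
  Proof.
    intros Hp. pose proof (w_unit p) as Hw. destruct p as (z, x).
    destruct Hp as ((Hz1 & Hz2) & (Hx1 & Hx2)) eqn:E. cbn [fst snd] in *.
    unfold simplex_to_cube, cube_to_simplex. f_equal; apply functional_extensionality; intros i.
    - destruct (lt_dec i m) as [Hi|Hi]; [|symmetry; apply Hz2; lia].
      destruct lt_dec; [|lia]. rewrite scale_inv, Rmin_right by (apply Hw; [easy|lia]).
      unfold w. destruct lt_dec; [lia|]. cbn [fst]. f_equal. lia.
    - destruct (lt_dec i n) as [Hi|Hi]; [|symmetry; apply Hx2; lia].
      destruct lt_dec; [|lia]. rewrite scale_inv, Rmin_right by (apply Hw; [easy|lia]).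
      unfold w. now destruct lt_dec.
  Qed.

  Lemma cube_to_simplex_fiber z x x' j :
    simp_real (S (n + m)) (fun i => (i - n)%nat) (cube_to_simplex (z, x)) j =
    simp_real (S (n + m)) (fun i => (i - n)%nat) (cube_to_simplex (z, x')) j.
  Proof.
    assert (Hout : forall v, (n < v)%nat -> cube_to_simplex (z, x) v = cube_to_simplex (z, x') v).
    { intros [|i] Hi; [lia|]. simpl. destruct lt_dec; [|easy]. unfold w. destruct lt_dec; [lia|easy]. }
    destruct j as [|j].
    (* Vertex 0 collects the collapsed vertices. All others carry equal weights at both points, so
       the equal totals settle this case. *)
    - apply Rminus_diag_uniq. unfold simp_real. rewrite <- sumN_minus.
      transitivity (sumN (S (n + m)) (cube_to_simplex (z, x)) - sumN (S (n + m)) (cube_to_simplex (z, x'))).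
      + rewrite <- sumN_minus. apply sumN_ext. intros i _.
        destruct Nat.eq_dec; [easy|]. rewrite Hout by lia. lra.
      + rewrite !cube_to_simplex_sum. lra.
    - apply sumN_ext. intros i _. destruct Nat.eq_dec; [|easy]. apply Hout. lia.
  Qed.
End CubeEmbedding.

Theorem theorem2p9 (M : Type) (dM : M -> M -> R) (n : nat) :
  is_metric dM -> complete dM ->
  (FAP dM n <->
   (forall (nK : nat) (SK : list (list nat)) (nL : nat) (SL : list (list nat))
           (f : nat -> nat),
      is_complex nK SK -> is_complex nL SL -> is_simplicial nK SK nL SL f ->
      dim_map_le nK SK nL SL f n ->
      forall (g : (nat -> R) -> M) (eps : R),
        cont_on (dist_fin nK) dM (realiz nK SK) g -> 0 < eps ->
        exists g' : (nat -> R) -> M,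
          in_Rnp dM n nK SK nL SL f g' /\
          eps_homotopic (dist_fin nK) dM (realiz nK SK) eps g g')).
Proof.
  intros HM Hcomp. pose proof (is_metric_pmetric _ HM) as HMp. split.
  - intros HFAP nK SK nL SL f HK _ Hf Hdim g eps Hg Heps. now apply FAP_simplicial.
  - intros H eps m g Heps Hg.
    assert (HdP : pmetric (dist_pair m n))
      by (apply (dist_prod_pmetric (dist_fin m) (dist_fin n)); apply dist_fin_pmetric).
    pose proof (dist_fin_pmetric (S (n + m))) as Hd.
    destruct (H (S (n + m)) (full_simplex (S (n + m))) (S m) (full_simplex (S m)) (fun i => (i - n)%nat)
      (full_simplex_complex _) (full_simplex_complex _) (collapse_simplicial n m) (collapse_dim n m)
      (fun t => g (simplex_to_cube n m t)) eps) as (g' & (Hg' & Hdim) & Hhom); [|easy|].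
    { apply (cont_comp _ (dist_pair m n) _ _ (cube_pair m n)); [|apply cont_simplex_to_cube|easy].
      apply simplex_to_cube_pair. }
    pose proof (cube_to_simplex_realiz n m) as Hreal.
    assert (Hc : cont_on (dist_pair m n) dM (cube_pair m n) (fun p => g' (cube_to_simplex n m p))).
    { apply (cont_comp _ (dist_fin (S (n + m))) _ _
        (realiz (S (n + m)) (full_simplex (S (n + m))))); [easy|apply cont_cube_to_simplex|easy]. }
    exists (fun p => g' (cube_to_simplex n m p)). split; [easy|]. split.
    + apply (eps_homotopic_precompose _ (dist_pair m n) _ _ (cube_pair m n) _ _ _ (cube_to_simplex n m))
        in Hhom; [|easy|easy|easy|apply cont_cube_to_simplex].
      (* The precomposed homotopy starts at g after a round trip through the simplex, which is the
         identity on the cube. *)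
      destruct Hhom as (h & H1 & H2 & H3). exists h. split; [easy|]. split; [|easy].
      intros p Hp. rewrite <- (simplex_to_cube_to_simplex n m p Hp) at 2. now apply H2.
    + intros z Hz.
      assert (Hx0 : cube n (fun _ => 0)) by (split; [intros; split; lra|easy]).
      set (y := simp_real (S (n + m)) (fun i => (i - n)%nat) (cube_to_simplex n m (z, fun _ => 0))).
      assert (Hfib : forall x, cube n x ->
        fiber (S (n + m)) (full_simplex (S (n + m))) (fun i => (i - n)%nat) y (cube_to_simplex n m (z, x))).
      { intros x Hx. split; [now apply Hreal|]. intros j. apply cube_to_simplex_fiber. }
      (* The slice over z lands in the fiber over y, so its image is a compact subset of a compact
         set of dimension at most n. *)
      apply (dim_le_compact_subset dM n (fun w => exists t,
        fiber (S (n + m)) (full_simplex (S (n + m))) (fun i => (i - n)%nat) y t /\ w = g' t)); auto.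
      * apply (seq_compact_image (dist_fin (S (n + m))) dM); auto; [apply fiber_compact|].
        apply cont_sub with (realiz (S (n + m)) (full_simplex (S (n + m)))); [now intros t []|easy].
      * apply (seq_compact_image (dist_fin n) dM (cube n) (fun x => g' (cube_to_simplex n m (z, x)))); auto;
          [apply dist_fin_pmetric|apply cube_compact|].
        apply (cont_comp (dist_fin n) (dist_pair m n) dM _ (cube_pair m n) (fun x => (z, x))
          (fun p => g' (cube_to_simplex n m p))); [now split| |easy].
        apply (cont_pair _ (dist_fin m) (dist_fin n)); [apply cont_const, dist_fin_pmetric|apply cont_id].
      * intros v (x & Hx & ->). eauto.
      * apply Hdim. apply full_simplex_realiz.
        -- intros j. apply simp_real_nonneg. apply (Hreal (z, fun _ => 0)). now split.
        -- intros j Hj. apply simp_real_outside. intros i Hi. lia.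
        -- unfold y. rewrite simp_real_sum by (intros; lia). apply cube_to_simplex_sum.
Qed.
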